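(* Let $\lambda>0$, $1\le\nu\le 3/2$, $\frac{4}{3+2\nu}<\sigma\le1$, $\varphi\in H^1(\mathbb R)$ and $\nabla\varphi\in L^{\frac{2}{3-2\nu}}(\mathbb R)$ (with $\frac{2}{3-2\nu}=\infty$ if $\nu=3/2$). Suppose $\delta>0$ is so small that $(3+2\nu)\sigma-4-(2\nu-1)\delta>0$. Then there exist $s_0\in(0,1]$ and $C>0$ such that $$Q\big[\mathcal U(s,r)\vec{\psi_0}\big](s)\le C\,Q[\psi_0](r),\qquad \vec{\psi_0}=(\psi_0,\overline{\psi_0})^{\mathrm T},\tag{$*$}$$ for all $\psi_0\in H^1(\mathbb R)$ and all $0<r\le s\le s_0$. In particular, for sufficiently small $\delta>0$, $( * )$ holds for $\frac45<\sigma\le1$ if $\varphi\in H^1(\mathbb R)$, and for $\frac23<\sigma\le\frac45$ if in addition $\nabla\varphi\in L^\infty(\mathbb R)$.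
   Context: $\|\cdot\|=\|\cdot\|_{L^2(\mathbb R)}$, $\nabla=\partial_x$, $\Delta=\partial_x^2$. For $s>0$ set $v_{\mathrm p}(s,x)=\varphi(x)\exp\left(-\frac{i\lambda|\varphi(x)|^{2\sigma}s^{\sigma-1}}{\sigma-1}\right)$ if $\sigma<1$, and $v_{\mathrm p}(s,x)=\varphi(x)e^{-i\lambda|\varphi(x)|^2\log s}$ if $\sigma=1$. The modified energy is $$Q[f](s)=\left(\tfrac14\|\nabla f\|^2+s^{-\sigma+\delta}\|f\|^2+\sigma\lambda s^{\sigma-2}\big\||\varphi|^{\sigma-1}\mathrm{Re}[\overline{v_{\mathrm p}(s)}f]\big\|^2\right)^{1/2},\qquad f\in H^1(\mathbb R),$$ and for $\vec f=(f,\overline f)^{\mathrm T}$ one writes $Q[\vec f]:=Q[f]$. Expressions such as $|\varphi|^{\sigma-1}\overline{v_{\mathrm p}}$ and $|\varphi|^{2\sigma-2}v_{\mathrm p}^2$ are $0$ where $\varphi=0$. $\mathcal U(s,r)$, $0<s,r\le1$, is the propagator on $H^1(\mathbb R)^2$ generated by $$\mathcal H(s)=-\frac12\begin{pmatrix}\Delta&0\\0&-\Delta\end{pmatrix}+\lambda s^{\sigma-2}\begin{pmatrix}(\sigma+1)|\varphi|^{2\sigma}&\sigma|\varphi|^{2\sigma-2}v_{\mathrm p}(s)^2\\-\sigma|\varphi|^{2\sigma-2}\overline{v_{\mathrm p}(s)}^2&-(\sigma+1)|\varphi|^{2\sigma}\end{pmatrix},$$ i.e. $\Psi(s)=\mathcal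 U(s,r)\Psi_0$ is the unique solution in $C((0,1],H^1(\mathbb R)^2)$ of $(i\partial_s-\mathcal H(s))\Psi=0$, $\Psi(r)=\Psi_0$. For data of the form $\vec{\psi_0}=(\psi_0,\overline{\psi_0})^{\mathrm T}$ the solution has the form $\mathcal U(s,r)\vec{\psi_0}=(\psi(s),\overline{\psi(s)})^{\mathrm T}$. *)

(* Defs.v *)
From mathcomp Require Import all_boot all_order all_algebra.
From mathcomp Require Import all_classical all_reals all_analysis.
From mathcomp Require Import complex.

Set Implicit Arguments.
Unset Strict Implicit.
Unset Printing Implicit Defensive.

Import Order.TTheory GRing.Theory Num.Theory.
Import numFieldNormedType.Exports.
Import ComplexField.Normc.

Local Open Scope classical_set_scope.
Local Open Scope ring_scope.
Local Open Scope complex_scope.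

(* Elements of Lebesgue and Sobolev spaces are represented by complex-valued
   functions; two functions equal almost everywhere represent the same
   element. *)
Section Spaces.
Context {R : realType}.
Local Notation mu := (@lebesgue_measure R).
Local Notation C := R[i].
Implicit Types f g h : R -> C.

Definition Lp (p : \bar R) f : Prop :=
  [/\ measurable_fun setT (fun x => complex.Re (f x)),
      measurable_fun setT (fun x => complex.Im (f x)) &
      finite_norm mu p (fun x => normc (f x))].

Definition norm2 f : R := fine (Lnorm mu 2%:E (fun x => (normc (f x))%:E)).

Definition cint f : C :=
  (\int[mu]_x complex.Re (f x)) +i* (\int[mu]_x complex.Im (f x)).

Definition test_function (theta : R -> R) : Prop :=
  (forall n x, derivable (derive1n n theta) x 1) /\
  (exists M, forall x, M < `|x| -> theta x = 0).

(* Real-valued test functions suffice, by linearity over C. *)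
Definition weak_derivative f g : Prop :=
  forall theta, test_function theta ->
    cint (fun x => f x * (derive1 theta x)%:C) =
    - cint (fun x => g x * (theta x)%:C).

Definition H1 f : Prop :=
  Lp 2%:E f /\ exists g, Lp 2%:E g /\ weak_derivative f g.

(* A chosen representative of the weak derivative, which is unique up to
   almost everywhere equality; only meaningful when [H1 f]. *)
Definition grad f : R -> C :=
  xget (fun=> 0) [set g | Lp 2%:E g /\ weak_derivative f g].

Definition normH1 f : R := Num.sqrt (norm2 f ^+ 2 + norm2 (grad f) ^+ 2).

(* Elements of H^-1, as antilinear functionals on H^1. *)
Definition functional := (R -> C) -> C.

Definition dual_of f : functional := fun eta => cint (fun x => f x * (eta x)^*%C).

Definition laplacian f : functional :=
  fun eta => - cint (fun x => grad f x * (grad eta x)^*%C).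

Definition unit_times : set R := [set` `]0, 1]].

Definition C_H1 (u : R -> R -> C) : Prop :=
  forall s, unit_times s ->
    H1 (u s) /\
    (fun t => normH1 (fun x => u t x - u s x)) @ within unit_times (nbhs s)
      --> (0 : R).

(* [L] is the derivative at [s] of [F : (0,1] -> H^-1], in the norm of H^-1
   (one-sided when [s = 1]). *)
Definition has_derivative_Hm1 (F : R -> functional) (s : R)
    (L : functional) : Prop :=
  forall e : R, 0 < e ->
    \forall t \near within unit_times (nbhs s), forall eta, H1 eta ->
      normc (F t eta - F s eta - (t - s)%:C * L eta)
        <= e * `|t - s| * normH1 eta.

End Spaces.

Section Propagator.
Context {R : realType}.
Local Notation mu := (@lebesgue_measure R).
Local Notation C := R[i].
Variables (lambda sigma : R) (phi : R -> C).

Definition cexpi (t : R) : C := cos t +i* sin t.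

Definition vp (s x : R) : C :=
  phi x *
  if sigma < 1 then
    cexpi (- (lambda * normc (phi x) `^ (2 * sigma) * s `^ (sigma - 1)
              / (sigma - 1)))
  else cexpi (- (lambda * normc (phi x) ^+ 2 * ln s)).

Definition state := ((R -> C) * (R -> C))%type.

(* |phi|^(2 sigma) and |phi|^(2 sigma - 2) vp^2; the latter is 0 where
   phi = 0, since vp vanishes there. *)
Definition pot_diag (x : R) : C := (normc (phi x) `^ (2 * sigma))%:C.
Definition pot_off (s x : R) : C :=
  (normc (phi x) `^ (2 * sigma - 2))%:C * vp s x ^+ 2.

(* H(s) Psi as an element of H^-1 x H^-1. *)
Definition hamiltonian (s : R) (Psi : state) : functional * functional :=
  (fun eta => - (2^-1)%:C * laplacian Psi.1 eta +
     (lambda * s `^ (sigma - 2))%:C *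
     dual_of (fun x => (sigma + 1)%:C * pot_diag x * Psi.1 x
                       + sigma%:C * pot_off s x * Psi.2 x) eta,
   fun eta => (2^-1)%:C * laplacian Psi.2 eta +
     (lambda * s `^ (sigma - 2))%:C *
     dual_of (fun x => - sigma%:C * (pot_off s x)^*%C * Psi.1 x
                       - (sigma + 1)%:C * pot_diag x * Psi.2 x) eta).

(* Psi in C((0,1], H^1 x H^1) with d/ds Psi = - i H(s) Psi in H^-1. *)
Definition solution (Psi : R -> state) : Prop :=
  [/\ C_H1 (fun s => (Psi s).1), C_H1 (fun s => (Psi s).2) &
      forall s, unit_times s ->
        has_derivative_Hm1 (fun t => dual_of (Psi t).1) s
          (fun eta => - 'i%C * (hamiltonian s (Psi s)).1 eta) /\
        has_derivative_Hm1 (fun t => dual_of (Psi t).2) s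
          (fun eta => - 'i%C * (hamiltonian s (Psi s)).2 eta)].

Definition ae_eq_state (Psi Phi : state) : Prop :=
  {ae mu, forall x, Psi.1 x = Phi.1 x} /\ {ae mu, forall x, Psi.2 x = Phi.2 x}.

Definition is_propagator (U : R -> R -> state -> state) : Prop :=
  forall (r : R) (Psi0 : state), unit_times r -> H1 Psi0.1 -> H1 Psi0.2 ->
    [/\ solution (fun s => U s r Psi0), ae_eq_state (U r r Psi0) Psi0 &
        forall Psi : R -> state, solution Psi -> ae_eq_state (Psi r) Psi0 ->
          forall s, unit_times s -> ae_eq_state (Psi s) (U s r Psi0)].

Definition vec (f : R -> C) : state := (f, fun x => (f x)^*%C).

Variable delta : R.

(* |phi|^(sigma - 1) Re[conj(vp) f] is 0 where phi = 0, since vp vanishes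
   there. *)
Definition Q (f : R -> C) (s : R) : R :=
  Num.sqrt
    (4^-1 * norm2 (grad f) ^+ 2
     + s `^ (- sigma + delta) * norm2 f ^+ 2
     + sigma * lambda * s `^ (sigma - 2) *
       norm2 (fun x => (normc (phi x) `^ (sigma - 1)
                        * complex.Re ((vp s x)^*%C * f x))%:C) ^+ 2).

(* Only used on vectors of the form [vec f]. *)
Definition Qvec (Psi : state) (s : R) : R := Q Psi.1 s.

Definition energy_bound (U : R -> R -> state -> state) : Prop :=
  exists s0 K : R, [/\ 0 < s0, s0 <= 1, 0 < K &
    forall psi0 : R -> C, H1 psi0 ->
    forall r s : R, 0 < r -> r <= s -> s <= s0 ->
      Qvec (U s r (vec psi0)) s <= K * Q psi0 r].

End Propagator.

(* The exponent 2 / (3 - 2 nu), read as infinity for nu = 3/2. *)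
Definition grad_exponent {R : realType} (nu : R) : \bar R :=
  if nu == 3 / 2 then +oo%E else (2 / (3 - 2 * nu))%:E.

(* Main.v *)
Require Import Defs.
From mathcomp Require Import all_boot all_order all_algebra.
From mathcomp Require Import all_classical all_reals all_analysis.
From mathcomp Require Import measurable_realfun ess_sup_inf.
From mathcomp Require Import complex ring lra.
Set Implicit Arguments.
Unset Strict Implicit.
Unset Printing Implicit Defensive.
Import Order.TTheory GRing.Theory Num.Theory.
Import numFieldNormedType.Exports.
Import ComplexField.Normc.
Local Open Scope classical_set_scope.
Local Open Scope ring_scope.
Local Open Scope complex_scope.

(** The estimate is an energy estimate for the first component u of
U(s, r) (psi0, conj psi0).  The pair obtained by exchanging the two components
and conjugating them solves the same equation with the same data, so uniqueness
forces the second component to be conj u, and u solves the real-linear equation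
i u' = - u''/2 + lambda t^(sigma-2) ((sigma+1) m u + sigma k^2 conj u) with
m = |phi|^(2 sigma) and k = |phi|^(sigma-1) vp(t).  Since |k|^2 = m, the square
of the modified energy is, with L^2 norms,
E = |grad u|^2/4 + t^(delta-sigma) |u|^2 + sigma lambda t^(sigma-2) |Re(conj k u)|^2,
that is, half of the quadratic form of the equation, minus half of the weighted
mass lambda t^(sigma-2) int m |u|^2, plus a multiple of the mass.

Slope of E.  The curve u is continuous in H^1 but only differentiable in H^-1,
so |grad u|^2 cannot be differentiated term by term.  Instead, the pairing of
the translate u(t + h) with i u(t) is differentiated ([energy_slope]): the
gradient terms cancel because the Laplacian does not depend on time, what
remains is the variation of the coefficients over a time h, and the pairing
itself equals - h times the quadratic form up to o(h).  This shows that the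
quadratic form is differentiable, with the slope coming from the explicit time
dependence of the coefficients.  In the slope of E, with Y and Z the real and the
imaginary part of conj k u, the terms with int m Y Z, produced by the phase of k
and by the weighted mass, cancel ([energy_has_slope]).  Besides terms of good
sign there remain the current J, which is the pairing of grad u with i m' u, and
X = int Y Z with a coefficient of order t^(delta-2).

Estimate.  The term X is absorbed by the dissipative term t^(sigma-3) |Y|^2
and contributes t^(delta-1) E.  In J the derivative of m is bounded by
C |grad phi|, and |grad phi|^2 is at most A^2 where |grad phi| <= A and at most
A^(2-p) |grad phi|^p elsewhere, p being the integrability exponent; on the
second part u is bounded by its H^1 sup norm.  With the level A = t^(-ell) the
two contributions are at most t^(al-1) E provided that two linear inequalities
hold, and an admissible ell exists exactly because
(3 + 2 nu) sigma - 4 - (2 nu - 1) delta > 0.  When |grad phi| is bounded the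
second part is empty for small times.  So E' <= K t^(al-1) E with al > 0
([slope_bound]), and as t^(al-1) is integrable at 0, Gronwall's lemma gives a
bound uniform in r ([gronwall_powR], [energy_growth]).

Space.  The weak derivatives of the statement are tested against smooth
functions only.  A function with a square integrable weak derivative is almost
everywhere equal to a primitive of it ([rweak_derivative_abscont]); products,
the sup bound and the chain rule for (p^2 + q^2)^s are then proved for such
primitives.  As sigma > 1/2, the density m is one of them, with a derivative
bounded by a multiple of |grad phi| ([sobolev_powR]).  The function phi is
replaced throughout by the representative for which this holds everywhere. *)

(** * Integrable and square integrable real functions *)

Section Integrable.
Context {R : realType}.
Local Notation mu := (@lebesgue_measure R).
Implicit Types (p q r w : R -> R) (D : set R).

Definition itg D p := mu.-integrable D (EFin \o p).

Lemma itgD D p q : measurable D -> itg D p -> itg D q ->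
  itg D (fun x => p x + q x).
Proof.
move=> mD ip iq; rewrite /itg.
have -> : EFin \o (fun x => p x + q x) = ((EFin \o p) \+ (EFin \o q))%E by [].
exact: integrableD.
Qed.

Lemma itgZ D c p : measurable D -> itg D p -> itg D (fun x => c * p x).
Proof.
move=> mD ip; rewrite /itg.
have -> : EFin \o (fun x => c * p x) = (fun x => c%:E * (EFin \o p) x)%E by [].
exact: integrableZl.
Qed.

Lemma itgN D p : measurable D -> itg D p -> itg D (fun x => - p x).
Proof.
by move=> mD /(itgZ (-1) mD); under eq_fun do rewrite mulN1r.
Qed.

Lemma itgB D p q : measurable D -> itg D p -> itg D q ->
  itg D (fun x => p x - q x).
Proof. by move=> mD ip iq; apply: itgD => //; exact: itgN. Qed.

Lemma itg_measurable D p : itg D p -> measurable_fun D p.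
Proof. by move=> /measurable_int/measurable_EFinP. Qed.

Lemma itg_le D p q : measurable D -> measurable_fun D p ->
  (forall x, D x -> `|p x| <= q x) -> itg D q -> itg D p.
Proof.
move=> mD mp pq; apply: le_integrable => //; first exact/measurable_EFinP.
by move=> x Dx /=; rewrite lee_fin (le_trans (pq x Dx))// ler_norm.
Qed.

Lemma itg_norm D p : measurable D -> itg D p -> itg D (fun x => `|p x|).
Proof. by move=> mD; exact: integrable_norm. Qed.

Lemma itgS D E p : measurable D -> measurable E -> E `<=` D -> itg D p ->
  itg E p.
Proof. by move=> mD mE ED; exact: integrableS. Qed.

Lemma eq_itg D p q : measurable D -> (forall x, D x -> p x = q x) ->
  itg D p -> itg D q.
Proof.
by move=> mD pq; apply: eq_integrable => // x /set_mem Dx /=; rewrite pq.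
Qed.

Lemma ae_impl (P Q : R -> Prop) : (forall x, P x -> Q x) ->
  {ae mu, forall x, P x} -> {ae mu, forall x, Q x}.
Proof.
move=> PQ; exact: (@filterS _ _ (ae_filter_ringOfSetsType mu) _ _ PQ).
Qed.

Lemma ae_impl2 (P Q S : R -> Prop) : (forall x, P x -> Q x -> S x) ->
  {ae mu, forall x, P x} -> {ae mu, forall x, Q x} -> {ae mu, forall x, S x}.
Proof.
move=> PQ; exact: (@filterS2 _ _ (ae_filter_ringOfSetsType mu) _ _ _ PQ).
Qed.

Lemma ae_eq_Rintegral D p q : measurable D -> measurable_fun D p ->
  measurable_fun D q -> {ae mu, forall x, p x = q x} ->
  \int[mu]_(x in D) p x = \int[mu]_(x in D) q x.
Proof.
move=> mD mp mq pq; congr fine; apply: ae_eq_integral => //.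
- exact/measurable_EFinP.
- exact/measurable_EFinP.
- by apply: ae_impl pq => x xE _; rewrite xE.
Qed.

Lemma ae_eq_itg D p q : measurable D -> measurable_fun D q ->
  {ae mu, forall x, p x = q x} -> itg D p -> itg D q.
Proof.
move=> mD mq pq /integrableP[mp ip]; apply/integrableP; split.
  exact/measurable_EFinP.
rewrite -(@ae_eq_integral _ _ _ mu D (abse \o (EFin \o q)) (abse \o (EFin \o p))) //.
- exact: measurableT_comp.
- by apply: measurableT_comp => //; exact/measurable_EFinP.
- by apply: ae_impl pq => x xE _ /=; rewrite xE.
Qed.

(** Almost everywhere, q is the maximum of p and q, for which the comparison holds at
every point. *)
Lemma ae_le_Rintegral p q : itg setT p -> itg setT q ->
  {ae mu, forall x, p x <= q x} -> \int[mu]_x p x <= \int[mu]_x q x.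
Proof.
move=> ip iq pq.
have mp := itg_measurable ip; have mq := itg_measurable iq.
have mm : measurable_fun setT (fun x => Num.max (p x) (q x)).
  exact: measurable_maxr.
have qE : {ae mu, forall x, q x = Num.max (p x) (q x)}.
  by apply: ae_impl pq => x pqx; rewrite max_r.
rewrite (ae_eq_Rintegral measurableT mq mm qE).
apply: le_Rintegral => //; first exact: (ae_eq_itg measurableT mm qE).
by move=> x _; rewrite le_max lexx.
Qed.

Lemma Rintegral_sub_le (D : set R) p : measurable D -> itg setT p ->
  (forall x, 0 <= p x) -> \int[mu]_(x in D) p x <= \int[mu]_x p x.
Proof.
move=> mD ip p0; rewrite Rintegral_mkcond; apply: le_Rintegral => //.
  rewrite -restrict_EFin; apply/integrable_restrict => //=.
  by rewrite setTI; exact: integrableS ip.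
by move=> x _; rewrite patchE; case: ifP.
Qed.

Definition L2 p := measurable_fun setT p /\ itg setT (fun x => p x ^+ 2).

Lemma L2_itgM p q : L2 p -> L2 q -> itg setT (fun x => p x * q x).
Proof.
move=> [mp ip] [mq iq].
apply: (@itg_le _ _ (fun x => p x ^+ 2 + q x ^+ 2)) => //.
- exact: measurable_funM.
- by move=> x _; rewrite ler_norml; apply/andP; split; nra.
- exact: itgD.
Qed.

Lemma L2D p q : L2 p -> L2 q -> L2 (fun x => p x + q x).
Proof.
move=> Lp Lq; have [mp ip] := Lp; have [mq iq] := Lq; split.
  exact: measurable_funD.
apply: (@itg_le _ _ (fun x => 2 * (p x ^+ 2 + q x ^+ 2))) => //.
- by apply: measurable_funX; exact: measurable_funD.
- move=> x _; rewrite ger0_norm ?sqr_ge0//.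
  by have := sqr_ge0 (p x - q x); nra.
- by apply: itgZ => //; exact: itgD.
Qed.

Lemma L2Mb p (b : R -> R) (M : R) : measurable_fun setT b -> (forall x, `|b x| <= M) ->
  L2 p -> L2 (fun x => b x * p x).
Proof.
move=> mb bM [mp ip]; split; first exact: measurable_funM.
apply: (@itg_le _ _ (fun x => M ^+ 2 * p x ^+ 2)) => //.
- by apply: measurable_funX; exact: measurable_funM.
- move=> x _; rewrite ger0_norm ?sqr_ge0// exprMn ler_wpM2r ?sqr_ge0//.
  by rewrite -[b x ^+ 2]real_normK ?num_real// lerXn2r ?nnegrE// (le_trans _ (bM x)).
- exact: itgZ.
Qed.

Lemma L2Z c p : L2 p -> L2 (fun x => c * p x).
Proof. by apply: (@L2Mb _ (fun=> c) `|c|). Qed.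

Lemma L2N p : L2 p -> L2 (fun x => - p x).
Proof. by move=> /(L2Z (-1)); under eq_fun do rewrite mulN1r. Qed.

Lemma L2B p q : L2 p -> L2 q -> L2 (fun x => p x - q x).
Proof. by move=> Lp Lq; apply: L2D => //; exact: L2N. Qed.

Lemma L2_0 : L2 (fun=> 0).
Proof.
split; first exact: measurable_cst.
by under eq_fun do rewrite expr0n /=; exact: integrable0.
Qed.

Lemma ae_eq_L2 p q : measurable_fun setT q -> {ae mu, forall x, p x = q x} ->
  L2 p -> L2 q.
Proof.
move=> mq pq [mp ip]; split=> //.
apply: (ae_eq_itg _ _ _ ip) => //; first exact: measurable_funX.
by apply: ae_impl pq => x ->.
Qed.

Lemma L2_norm p : L2 p -> L2 (fun x => `|p x|).
Proof.
move=> [mp ip]; split; first exact: measurableT_comp.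
by under eq_fun do rewrite real_normK ?num_real//.
Qed.

(** On a bounded interval |p| <= 1 + p^2. *)
Lemma L2_itg_itv p (a b : R) : L2 p -> itg `[a, b] p.
Proof.
move=> [mp ip]; apply: (@itg_le _ _ (fun x => 1 + p x ^+ 2)) => //.
- exact: measurable_funTS.
- by move=> x _; rewrite ler_norml; apply/andP; split; nra.
- apply: itgD => //; last exact: itgS ip.
  apply: measurable_bounded_integrable => //.
    by rewrite /= lebesgue_measure_itv /=; case: ifP => // _; rewrite -EFinB ltry.
  exact: bounded_cst.
Qed.

(** The quadratic polynomial t |-> int (p - t q)^2 is nonnegative; its minimiser is B / C. *)
Lemma L2_CS p q : L2 p -> L2 q ->
  (\int[mu]_x (p x * q x)) ^+ 2 <= (\int[mu]_x (p x ^+ 2)) * \int[mu]_x (q x ^+ 2).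
Proof.
move=> Lp Lq; have [mp ip] := Lp; have [mq iq] := Lq.
set A := \int[mu]_x (p x ^+ 2); set C := \int[mu]_x (q x ^+ 2).
set B := \int[mu]_x (p x * q x).
have ipq := L2_itgM Lp Lq.
have C0 : 0 <= C by apply: Rintegral_ge0 => x _; exact: sqr_ge0.
have H t : 0 <= A - 2 * t * B + t ^+ 2 * C.
  have -> : A - 2 * t * B + t ^+ 2 * C = \int[mu]_x ((p x - t * q x) ^+ 2).
    transitivity (\int[mu]_x ((p x ^+ 2 - (2 * t) * (p x * q x)) + t ^+ 2 * q x ^+ 2)).
      rewrite RintegralD//; last 2 first.
        by apply: itgB => //; exact: itgZ.
        exact: itgZ.
      rewrite RintegralB//; last exact: itgZ.
      by rewrite !RintegralZl.
    by apply: eq_Rintegral => x _; ring.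
  by apply: Rintegral_ge0 => x _; exact: sqr_ge0.
(* if C = 0 the polynomial is affine, so B = 0 *)
have [C00|Cn0] := eqVneq C 0.
  have [->|Bn0] := eqVneq B 0; first by rewrite expr0n mulr_ge0// Rintegral_ge0// => x _; exact: sqr_ge0.
  have := H ((A + 1) / (2 * B)); rewrite C00 mulr0 addr0.
  have -> : A - 2 * ((A + 1) / (2 * B)) * B = -1 by field.
  by rewrite ler0N1.
have Cp : 0 < C by rewrite lt_def Cn0.
have := H (B / C).
have -> : A - 2 * (B / C) * B + (B / C) ^+ 2 * C = (A * C - B ^+ 2) / C by field.
by rewrite pmulr_lge0 ?invr_gt0// subr_ge0.
Qed.

Lemma L2_CS_sqrt p q : L2 p -> L2 q ->
  `|\int[mu]_x (p x * q x)| <= Num.sqrt (\int[mu]_x (p x ^+ 2)) * Num.sqrt (\int[mu]_x (q x ^+ 2)).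
Proof.
move=> Lp Lq; rewrite -sqrtr_sqr -sqrtrM ?ler_wsqrtr ?L2_CS//.
by apply: Rintegral_ge0 => x _; exact: sqr_ge0.
Qed.

End Integrable.

(** * Slopes, and a smooth hump *)

Section Derivatives.
Context {R : realType}.
Implicit Types (f g : R -> R) (s t d e : R).

(** This form of differentiability, with an explicit remainder, is the one in which
slopes of energies are established; it agrees with the usual derivative
([has_slopeP]). *)
Definition has_slope f s d := forall e, 0 < e ->
  exists2 eta : R, 0 < eta & forall t, `|t - s| < eta ->
    `|f t - f s - (t - s) * d| <= e * `|t - s|.

Lemma has_slopeP f s d : has_slope f s d <-> is_derive s 1 f d.
Proof.
split=> [H|[/cvg_ex[l /= fl] fd] e e0].
  have cv : (fun h => h^-1 *: (f (h *: 1 + s) - f s)) @ 0^' --> d.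
    apply/cvgrPdist_le => e e0; have [eta eta0 He] := H _ e0.
    near=> h.
    have h0 : h != 0 by near: h; exact: nbhs_dnbhs_neq.
    have hn : 0 < `|h| by rewrite normr_gt0.
    have hE : h *: (1 : R) = h by rewrite /GRing.scale /= mulr1.
    have : `|h| < eta by near: h; apply: dnbhs0_lt.
    rewrite hE -{1}(addrK s h) => /He; rewrite addrK => Hh.
    rewrite -(ler_pM2r hn) -normrM.
    have -> : (d - h^-1 *: (f (h + s) - f s)) * h = - (f (h + s) - f s - h * d).
      by rewrite /GRing.scale /=; field.
    by rewrite normrN.
  split; first by apply/cvg_ex; exists d.
  exact: cvg_lim cv.
have ld : l = d by rewrite -fd; symmetry; apply: cvg_lim.
move: fl; rewrite ld => /cvgrPdist_le/(_ _ e0)[/= eta eta0 H].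
exists eta => // t ts.
have [->|tns] := eqVneq t s; first by rewrite !subrr mul0r subrr normr0 mulr0.
have h0 : t - s != 0 by rewrite subr_eq0.
have := H (t - s); rewrite /= sub0r normrN => /(_ ts h0).
rewrite /GRing.scale /= mulr1 subrK => Hh.
have hn : 0 < `|t - s| by rewrite normr_gt0.
rewrite -(ler_pM2r hn) -normrM in Hh.
apply: le_trans Hh; rewrite -normrN.
rewrite [leLHS](_ : _ = `|(d - (t - s)^-1 * (f t - f s)) * (t - s)|) //.
by congr `|_|; field.
Unshelve. all: by end_near. Qed.

Lemma has_slope_continuous f s d : has_slope f s d -> {for s, continuous f}.
Proof.
by move=> /has_slopeP[df _]; apply/differentiable_continuous/derivable1_diffP.
Qed.

Lemma within_continuous_slope f g (a b : R) :
  (forall t, t \in `[a, b]%R -> has_slope f t (g t)) ->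
  {within `[a, b], continuous f}.
Proof.
move=> H; apply: continuous_in_subspaceT => t tab.
by apply: has_slope_continuous (H t _); move: tab; rewrite inE.
Qed.

(** Mean value theorem for f - K id. *)
Lemma slope_approx f g (a b K e : R) : a <= b ->
  (forall t, t \in `[a, b]%R -> has_slope f t (g t)) ->
  (forall t, t \in `[a, b]%R -> `|g t - K| <= e) ->
  `|f b - f a - (b - a) * K| <= e * (b - a).
Proof.
move=> ab H gK.
have [t tab|c cab ->] := @MVT_segment _ f g a b ab _ (within_continuous_slope H).
  by apply/has_slopeP/H; exact: subset_itv_oo_cc tab.
have -> : g c * (b - a) - (b - a) * K = (g c - K) * (b - a) by ring.
by rewrite normrM (ger0_norm (_ : 0 <= b - a)) ?subr_ge0// ler_wpM2r ?subr_ge0// gK.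
Qed.

Lemma slope_le0 f g (a b : R) : a <= b ->
  (forall t, t \in `[a, b]%R -> has_slope f t (g t)) ->
  (forall t, t \in `[a, b]%R -> g t <= 0) -> f b <= f a.
Proof.
move=> ab H g0.
have [t tab|c cab fE] := @MVT_segment _ f g a b ab _ (within_continuous_slope H).
  by apply/has_slopeP/H; exact: subset_itv_oo_cc tab.
by rewrite -subr_le0 fE mulr_le0_ge0 ?g0// subr_ge0.
Qed.

(** Inductive form of the smoothness required of test functions: it is stable under
sums and products by induction on n, whereas iterated derivatives of products are
unwieldy. *)
Fixpoint ntimes_derivable n f := if n is n'.+1 then
  (forall x : R, derivable f x 1) /\ ntimes_derivable n' (derive1 f) else True.

Lemma ntimes_derivable1n f : (forall n, ntimes_derivable n f) ->
  forall n x, derivable (derive1n n f) x 1.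
Proof.
move=> H n; elim: n f H => [|n IH] f H x; first exact: (H 1).1.
by rewrite derive1Sn; apply: IH => n'; have [] := H n'.+1.
Qed.

Lemma ntimes_derivableS n f : ntimes_derivable n.+1 f -> ntimes_derivable n f.
Proof.
elim: n f => [//|n IH] f [df H]; split=> //; exact: IH.
Qed.

Lemma derive1_funE f g : (forall x : R, is_derive x 1 f (g x)) -> (derive1 f) = g.
Proof. by move=> H; apply/funext => x; rewrite derive1E; case: (H x). Qed.

Lemma ntimes_derivable_of n f g : (forall x : R, is_derive x 1 f (g x)) ->
  ntimes_derivable n g -> ntimes_derivable n.+1 f.
Proof.
by move=> H ng; split; [move=> x; case: (H x)|rewrite (derive1_funE H)].
Qed.

Lemma is_derive1 f : (forall x : R, derivable f x 1) ->
  forall x : R, is_derive x 1 f ((derive1 f) x).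
Proof. by move=> H x; split => //; rewrite derive1E. Qed.

Lemma ntimes_derivableD n f g : ntimes_derivable n f -> ntimes_derivable n g ->
  ntimes_derivable n (fun x => f x + g x).
Proof.
elim: n f g => [//|n IH] f g [df nf] [dg ng].
apply: (@ntimes_derivable_of _ _ (fun x => (derive1 f) x + (derive1 g) x)); last exact: IH.
by move=> x; apply: is_deriveD; exact: is_derive1.
Qed.

Lemma ntimes_derivableM n f g : ntimes_derivable n f -> ntimes_derivable n g ->
  ntimes_derivable n (fun x => f x * g x).
Proof.
elim: n f g => [//|n IH] f g [df nf] [dg ng].
have nf1 : ntimes_derivable n.+1 f by split.
have ng1 : ntimes_derivable n.+1 g by split.
apply: (@ntimes_derivable_of _ _ (fun x => f x * (derive1 g) x + g x * (derive1 f) x)).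
  by move=> x; apply: is_deriveM; exact: is_derive1.
by apply: ntimes_derivableD; apply: IH => //; exact: ntimes_derivableS.
Qed.

Lemma ntimes_derivable_cst n (c : R) : ntimes_derivable n (fun=> c).
Proof.
elim: n c => [//|n IH] c; apply: (@ntimes_derivable_of _ _ (fun=> 0)) => //.
Qed.

Lemma ntimes_derivable_affine n f (a b : R) : ntimes_derivable n f ->
  ntimes_derivable n (fun x => f (a * x + b)).
Proof.
elim: n f => [//|n IH] f [df nf].
apply: (@ntimes_derivable_of _ _ (fun x => (derive1 f) (a * x + b) * a)).
  move=> x; apply: (is_derive1_comp (g := fun x => a * x + b)).
    exact: is_derive1.
  apply/has_slopeP => e e0; exists 1 => // t _.
  by rewrite (_ : _ - _ = 0) ?normr0 ?mulr_ge0 ?(ltW e0)//; ring.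
apply: ntimes_derivableM; first exact: IH.
exact: ntimes_derivable_cst.
Qed.

(** For n = 0 this is the smooth function exp(-1/x) extended by 0; the factors x^(-n)
make the family stable under differentiation. *)
Definition flat n (x : R) : R := if x <= 0 then 0 else (x^-1) ^+ n * expR (- x^-1).

Lemma flat_le0 n x : x <= 0 -> flat n x = 0.
Proof. by rewrite /flat => ->. Qed.

Lemma flatE n (x : R) : 0 < x -> flat n x = (x^-1) ^+ n * expR (- x^-1).
Proof. by move=> x0; rewrite /flat leNgt x0. Qed.

Lemma flat_ge0 n x : 0 <= flat n x.
Proof.
have [x0|x0] := leP x 0; first by rewrite flat_le0.
rewrite flatE//; by rewrite mulr_ge0 ?expR_ge0// exprn_ge0// invr_ge0 ltW.
Qed.

(** The exponential series gives exp(1/x) >= x^(-n-2) / (n+2)!.  The factor x^2 yields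
both the value and the slope 0 at the origin. *)
Lemma flat_bound n (x : R) : 0 < x -> flat n x <= (n.+2)`!%:R * x ^+ 2.
Proof.
move=> x0; rewrite flatE// expRN.
have := @expR_ge1Dxn R x^-1 n.+1; rewrite invr_ge0 (ltW x0) => /(_ isT).
set E := expR _ => HE.
have E0 : 0 < E by exact: expR_gt0.
have f0 : 0 < (n.+2)`!%:R :> R by rewrite ltr0n fact_gt0.
rewrite ler_pdivrMr// -ler_pdivrMl ?mulr_gt0 ?exprn_gt0//.
apply: le_trans (_ : 1 + x^-1 ^+ n.+2 / (n.+2)`!%:R <= _) => //.
apply: le_trans (_ : x^-1 ^+ n.+2 / (n.+2)`!%:R <= _); last by rewrite lerDr.
rewrite !exprS; set y := _ ^+ n; set N := _%:R.
rewrite [leLHS](_ : _ = x^-1 * (x^-1 * y) / N)//.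
by field; rewrite !gt_eqF.
Qed.

(** The derivative stays in the span of the family, which is how smoothness at all orders
follows. *)
Lemma is_derive_flat n (x : R) :
  is_derive x 1 (flat n) (flat n.+2 x - n%:R * flat n.+1 x).
Proof.
have [x0|x0|->] := ltgtP x 0.
- rewrite !flat_le0 ?(ltW x0)// mulr0 subrr.
  apply: (@near_eq_is_derive R R R (fun=> 0) _ _ _ _ _ (is_derive_cst _ _ _)).
  near=> y; rewrite flat_le0//; near: y.
  by apply: filterS (lt_nbhsl x0) => y /ltW.
- apply: (@near_eq_is_derive R R R (fun y => (y^-1) ^+ n * expR (- y^-1))).
    near=> y; rewrite flatE//; near: y.
    exact: lt_nbhsr.
  have dV : is_derive x 1 (fun y : R => y^-1) (- x ^- 2).
    have := @is_deriveV R (fun y => y) x 1 1; rewrite gt_eqF// => /(_ isT _).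
    by rewrite /GRing.scale /= mulr1; apply; exact: is_derive_id.
  have dX := @is_deriveX R R (fun y => y^-1) n x 1 _ dV.
  have dN : is_derive x 1 (fun y : R => - y^-1) (x ^- 2).
    by rewrite -[x ^- 2]opprK; exact: is_deriveN.
  have dE : is_derive x 1 (fun y : R => expR (- y^-1)) (expR (- x^-1) * x ^- 2).
    exact: (@is_derive1_comp R expR (fun y => - y^-1) x _ _ (is_derive_expR _) dN).
  have {}dX : is_derive x 1 (fun y : R => y^-1 ^+ n)
      ((n%:R * x^-1 ^+ n.-1) *: - x ^- 2).
    by move: dX; congr is_derive; apply/funext => y; rewrite exprfctE.
  apply: (is_derive_eq (is_deriveM dX dE)).
  rewrite !flatE// /GRing.scale /=.
  case: n {dX} => [|n]; first by rewrite /= mulr0n expr0 expr2 exprVn; field; rewrite gt_eqF.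
  rewrite /= !exprS; set y := _ ^+ n; set N := n.+1%:R; set E := expR _.
  by field; rewrite gt_eqF.
- apply/has_slopeP => e e0; rewrite !flat_le0// mulr0 subr0.
  have f0 : 0 < (n.+2)`!%:R :> R by rewrite ltr0n fact_gt0.
  exists (e / (n.+2)`!%:R); first exact: divr_gt0.
  move=> t; rewrite !subr0 mulr0 subr0 => te.
  rewrite ger0_norm ?flat_ge0//.
  have [t0|t0] := leP t 0; first by rewrite flat_le0// mulr_ge0// ltW.
  apply: le_trans (flat_bound n t0) _.
  rewrite gtr0_norm// expr2 mulrA ler_wpM2r ?(ltW t0)//.
  by rewrite -ler_pdivlMl// mulrC ltW// -[t]gtr0_norm.
Unshelve. all: by end_near. Qed.

Lemma ntimes_derivable_flat k n : ntimes_derivable k (flat n).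
Proof.
elim: k n => [//|k IH] n.
apply: (ntimes_derivable_of (is_derive_flat n)).
apply: ntimes_derivableD => //.
under eq_fun do rewrite -mulNr.
by apply: ntimes_derivableM => //; exact: ntimes_derivable_cst.
Qed.

(** Smooth, supported in [0, 1] and not identically 0. *)
Definition hump (x : R) := flat 0 x * flat 0 (1 - x).

Lemma ntimes_derivable_hump n : ntimes_derivable n hump.
Proof.
apply: ntimes_derivableM; first exact: ntimes_derivable_flat.
have -> : (fun x => flat 0 (1 - x)) = (fun x => flat 0 (-1 * x + 1)).
  by apply/funext => x; congr flat; ring.
by apply: ntimes_derivable_affine; exact: ntimes_derivable_flat.
Qed.

Lemma hump_ge0 x : 0 <= hump x.
Proof. by rewrite mulr_ge0// flat_ge0. Qed.

Lemma hump_le0 x : x <= 0 -> hump x = 0.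
Proof. by move=> x0; rewrite /hump flat_le0// mul0r. Qed.

Lemma hump_ge1 x : 1 <= x -> hump x = 0.
Proof. by move=> x1; rewrite /hump (@flat_le0 _ (1 - x)) ?subr_le0// mulr0. Qed.

Lemma flat_le1 x : flat 0 x <= 1.
Proof.
have [x0|x0] := leP x 0; first by rewrite flat_le0.
rewrite flatE// expr0 mul1r -[leRHS]expR0 ler_expR.
by rewrite oppr_le0 invr_ge0 ltW.
Qed.

Lemma hump_le1 x : hump x <= 1.
Proof. by rewrite /hump mulr_ile1 ?flat_ge0 ?flat_le1. Qed.

End Derivatives.

(** * Primitives of locally integrable functions *)

Section AbsolutelyContinuous.
Context {R : realType}.
Local Notation mu := (@lebesgue_measure R).
Implicit Types (f g d w p q : R -> R) (a b c e : R).

Definition locint d := measurable_fun setT d /\ forall a b, itg `[a, b] d.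

Definition incr d a b := \int[mu]_(x in `[a, b]) d x.

Lemma locintD d w : locint d -> locint w -> locint (fun x => d x + w x).
Proof.
move=> [md id] [mw iw]; split; first exact: measurable_funD.
by move=> a b; apply: itgD.
Qed.

Lemma locintZ c d : locint d -> locint (fun x => c * d x).
Proof.
move=> [md id]; split; first exact: measurable_funM.
by move=> a b; exact: itgZ.
Qed.

Lemma locintB d w : locint d -> locint w -> locint (fun x => d x - w x).
Proof.
move=> ld lw; apply: locintD => //.
by have := locintZ (-1) lw; under eq_fun do rewrite mulN1r.
Qed.

Lemma locint_norm d : locint d -> locint (fun x => `|d x|).
Proof.
move=> [md id]; split; first exact: measurableT_comp.
by move=> a b; exact: itg_norm.
Qed.

Lemma L2_locint d : L2 d -> locint d.
Proof. by move=> Ld; split; [case: Ld|move=> a b; exact: L2_itg_itv]. Qed.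

Lemma itg_locint d : itg setT d -> locint d.
Proof.
move=> id; split; first exact: itg_measurable.
by move=> a b; exact: itgS id.
Qed.

Lemma locint_cst c : locint (fun=> c).
Proof.
split=> [|a b]; first exact: measurable_cst.
apply: measurable_bounded_integrable => //.
  by rewrite /= lebesgue_measure_itv /=; case: ifP => // _; rewrite -EFinB ltry.
exact: bounded_cst.
Qed.

Lemma incr_cst c a b : a <= b -> incr (fun=> c) a b = c * (b - a).
Proof.
move=> ab; rewrite /incr Rintegral_cst// /= lebesgue_measure_itv /= lte_fin.
by case: ltgtP ab => // -> _; rewrite subrr mulr0.
Qed.

Lemma incr_split d a c b : locint d -> a <= c -> c <= b ->
  incr d a b = incr d a c + incr d c b.
Proof.
move=> [md id] ac cb; rewrite /incr.
have := @Rintegral_itvB _ d (BLeft a) (BRight b) c (id a b).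
rewrite !bnd_simp => /(_ ac cb) H.
have := @Rintegral_itv_obnd_cbnd _ c (BRight b) d.
have ic : mu.-integrable `]c, b] (EFin \o d).
  by apply: integrableS (id c b) => //; exact: subset_itv_oc_cc.
by move=> /(_ ic) <-; rewrite -H addrC subrK.
Qed.

Lemma incr_self d a : incr d a a = 0.
Proof. by rewrite /incr set_itv1 Rintegral_set1. Qed.

Lemma incr_ge0 d a b : (forall x, 0 <= d x) -> 0 <= incr d a b.
Proof. by move=> d0; exact: Rintegral_ge0. Qed.

Lemma incrD d w a b : locint d -> locint w ->
  incr (fun x => d x + w x) a b = incr d a b + incr w a b.
Proof.
by move=> [_ id] [_ iw]; rewrite /incr RintegralD//; [exact: id|exact: iw].
Qed.

Lemma incrB d w a b : locint d -> locint w ->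
  incr (fun x => d x - w x) a b = incr d a b - incr w a b.
Proof.
by move=> [_ id] [_ iw]; rewrite /incr RintegralB//; [exact: id|exact: iw].
Qed.

Lemma incrZ d c a b : locint d -> incr (fun x => c * d x) a b = c * incr d a b.
Proof. by move=> [_ id]; rewrite /incr RintegralZl//; exact: id. Qed.

Lemma incr_norm d a b : locint d -> `|incr d a b| <= incr (fun x => `|d x|) a b.
Proof. by move=> [_ id]; apply: le_normr_Rintegral => //; exact: id. Qed.

Lemma incr_le d w a b : locint d -> locint w ->
  (forall x, a <= x -> x <= b -> d x <= w x) -> incr d a b <= incr w a b.
Proof.
move=> [_ id] [_ iw] dw; apply: le_Rintegral => //; [exact: id|exact: iw|].
move=> x /=; by rewrite in_itv /= => /andP[]; exact: dw.
Qed.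

Lemma incr_sub d a b c e : locint d -> (forall x, 0 <= d x) ->
  c <= a -> a <= b -> b <= e -> incr d a b <= incr d c e.
Proof.
move=> ld d0 ca ab be.
rewrite (@incr_split d c a e)// ?(le_trans ab)// (@incr_split d a b e)//.
have := @incr_ge0 d c a d0; have := @incr_ge0 d b e d0; lra.
Qed.

(** Absolute continuity of the integral. *)
Lemma incr_small d x e : locint d -> 0 < e ->
  exists2 eta : R, 0 < eta & forall y z, x - eta < y -> y <= z -> z < x + eta ->
    incr (fun t => `|d t|) y z < e.
Proof.
move=> [md id] e0.
pose dx := d \_ `[x - 1, x + 1].
have idx : mu.-integrable setT (EFin \o dx).
  rewrite -restrict_EFin; apply/integrable_restrict => //=.
  by rewrite setTI; exact: id.
have [k [k0 Hk]] := integral_normr_continuous idx e0.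
exists (Num.min 1 (k / 2)); first by rewrite lt_min ltr01 divr_gt0.
move=> y z xy yz zx.
have : x - y < Num.min 1 (k / 2) by lra.
rewrite lt_min => /andP[y1 yk].
have : z - x < Num.min 1 (k / 2) by lra.
rewrite lt_min => /andP[z1 zk].
have := Hk [set` `[y, z]] (measurable_itv _).
rewrite /= lebesgue_measure_itv /= lte_fin.
have -> : (if y < z then (z%:E - y%:E)%E else 0%E) = (z - y)%:E.
  by case: ltgtP yz => // -> _; rewrite subrr.
rewrite lte_fin => H; apply: le_lt_trans (H _); last by lra.
rewrite le_eqVlt; apply/orP; left; apply/eqP; apply: eq_Rintegral => t; rewrite inE /= in_itv /= => /andP[yt tz].
by rewrite /dx patchE mem_set//= in_itv /=; apply/andP; split; lra.
Qed.

(** Differentiability of f at x, measured on the intervals that contain x, with the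
integral of d in place of a linear increment and the integral of a weight w in place
of the length.  The weight makes the notion usable for unbounded d. *)
Definition straddle_derivable f d w x := forall e, 0 < e ->
  exists2 eta : R, 0 < eta & forall y z, x - eta < y -> y <= x -> x <= z ->
    z < x + eta -> `|f z - f y - incr d y z| <= e * incr w y z.

(** Local to global: let c be the supremum of the t for which the error on [a, t] is at
most e int w.  Such a t just before c, followed by an interval that contains c, gives
another one beyond c, unless c = b. *)
Lemma straddle_derivable_incr f d w a b : locint d -> locint w ->
  (forall x, 0 <= w x) -> (forall x, straddle_derivable f d w x) ->
  a <= b -> f b - f a = incr d a b.
Proof.
move=> ld lw w0 fd ab; apply/eqP; rewrite -subr_eq0 -normr_eq0 eq_le normr_ge0.
rewrite andbT.
suff H e : 0 < e -> `|f b - f a - incr d a b| <= e * incr w a b.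
  set W := incr w a b in H; have W0 : 0 <= W by exact: incr_ge0.
  apply/ler_addgt0Pr => e e0; rewrite add0r.
  apply: le_trans (H (e / (W + 1)) _) _; first by rewrite divr_gt0// ltr_wpDl.
  rewrite mulrAC ler_pdivrMr ?ltr_wpDl// ler_wpM2l ?(ltW e0)//.
  by rewrite lerDl.
move=> e0.
pose S := [set t | a <= t <= b /\ `|f t - f a - incr d a t| <= e * incr w a t].
have Sa : S a.
  rewrite /S /= lexx ab; split=> //.
  by rewrite !incr_self !subrr ?subr0 normr0 mulr0.
have uS : has_ubound S by exists b => t [/andP[]].
have sS : has_sup S by split; [exists a|].
set c := sup S.
have ac : a <= c by exact: (ub_le_sup uS).
have cb : c <= b by apply: ge_sup; [exists a|move=> t [/andP[]]].
have [eta eta0 He] := fd c e e0.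
have [y Sy cy] := sup_adherent eta0 sS.
have yc : y <= c by exact: (ub_le_sup uS).
have [/andP[ay yb] Hy] := Sy.
(* z lies beyond c unless c = b, and [y, z] contains c *)
pose z := Num.min b (c + eta / 2).
have cz : c <= z by rewrite /z le_min cb lerDl ltW// divr_gt0.
have zb : z <= b by rewrite /z ge_min lexx.
have ze : z < c + eta.
  by rewrite /z gt_min; apply/orP; right; rewrite ltrD2l; lra.
have Hz := He y z cy yc cz ze.
have Sz : S z.
  split; first by rewrite zb (le_trans ac).
  have yz := le_trans yc cz.
  rewrite (incr_split ld ay yz) (incr_split lw ay yz) mulrDr.
  apply: le_trans (lerD Hy Hz); apply: le_trans (ler_normD _ _).
  by rewrite le_eqVlt; apply/orP; left; apply/eqP; congr `|_|; ring.
have zc : z <= c by exact: (ub_le_sup uS).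
have zE : z = b.
  rewrite /z /Num.min; case: ifP => // /negbT; rewrite -leNgt => cb'.
  move: zc; rewrite /z min_r// gerDl => H; exfalso; lra.
by case: Sz; rewrite zE.
Qed.

(** The absolutely continuous functions, given together with a density.  The density is
part of the data because all later computations are carried out on it. *)
Definition abscont f d := locint d /\
  forall a b, a <= b -> f b - f a = incr d a b.

Lemma abscont_dist f d a b : abscont f d -> a <= b ->
  `|f b - f a| <= incr (fun x => `|d x|) a b.
Proof. by move=> [ld H] ab; rewrite H//; exact: incr_norm. Qed.

Lemma abscont_near f d x e : abscont f d -> 0 < e ->
  exists2 eta : R, 0 < eta & forall t, `|t - x| < eta -> `|f t - f x| < e.
Proof.
move=> fd e0; have [eta eta0 H] := incr_small x fd.1 e0.
exists eta => // t; rewrite ltr_norml => /andP[t1 t2].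
have [xt|tx] := leP x t.
  by apply: le_lt_trans (abscont_dist fd xt) _; apply: H => //; lra.
rewrite distrC; apply: le_lt_trans (abscont_dist fd (ltW tx)) _.
by apply: H => //; lra.
Qed.

Lemma abscont_continuous f d : abscont f d -> continuous f.
Proof.
move=> fd x; apply/cvgrPdist_lt => e e0.
have [eta eta0 H] := abscont_near x fd e0.
by exists eta => //= t; rewrite /= distrC => /H; rewrite distrC.
Qed.

Lemma abscont_measurable f d : abscont f d -> measurable_fun setT f.
Proof. by move=> /abscont_continuous; exact: continuous_measurable_fun. Qed.

Lemma continuous_locint f : continuous f -> locint f.
Proof.
move=> cf; split; first exact: continuous_measurable_fun.
move=> a b; apply: continuous_compact_integrable; first exact: segment_compact.
exact: continuous_subspaceT.
Qed.

Lemma locintM f d : continuous f -> locint d -> locint (fun x => f x * d x).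
Proof.
move=> cf [md id]; have [mf _] := continuous_locint cf.
split; first exact: measurable_funM.
move=> a b.
have [ab|ba] := leP a b; last first.
  by rewrite set_itv_ge -?leNgt ?bnd_simp ?leNgt//; exact: integrable_set0.
have [M [_ HM]] := @compact_bounded _ _ _ (continuous_compact (continuous_subspaceT cf) (@segment_compact _ a b)).
apply: (@itg_le _ _ _ (fun x => (M + 1) * `|d x|)) => //.
- exact/measurable_funTS/measurable_funM.
- move=> x xab; rewrite normrM ler_wpM2r//.
  by apply: (HM (M + 1)); [rewrite ltrDl|exists x].
- by apply: itgZ => //; exact: itg_norm.
Qed.

Lemma abscont_C1 f d : (forall x : R, is_derive x 1 f (d x)) -> continuous d ->
  abscont f d.
Proof.
move=> fd cd; have ld := continuous_locint cd; split=> // a b ab.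
apply: (@straddle_derivable_incr _ _ (fun=> 1)) ab => //; first exact: locint_cst.
move=> x e e0.
have e20 : 0 < e / 2 by rewrite divr_gt0.
have [eta1 eta10 H1] := (has_slopeP _ _ _).2 (fd x) _ e20.
have [eta2 /= eta20 H2] := (cvgrPdist_le _ _).1 (cd x) _ e20.
exists (Num.min eta1 eta2); first by rewrite lt_min eta10.
move=> y z xy yx xz zx.
have : x - y < Num.min eta1 eta2 by lra.
rewrite lt_min => /andP[y1 y2].
have : z - x < Num.min eta1 eta2 by lra.
rewrite lt_min => /andP[z1 z2].
have yz := le_trans yx xz.
have Hz : `|f z - f x - (z - x) * d x| <= e / 2 * (z - x).
  have zx0 : 0 <= z - x by rewrite subr_ge0.
  by rewrite -{2}(ger0_norm zx0) H1// ger0_norm.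
have Hy : `|f y - f x - (y - x) * d x| <= e / 2 * (x - y).
  have xy0 : 0 <= x - y by rewrite subr_ge0.
  have -> : x - y = `|y - x| by rewrite distrC ger0_norm.
  by apply: H1; rewrite distrC ger0_norm.
have Hd : `|incr d y z - (z - y) * d x| <= e / 2 * (z - y).
  have lc : locint (fun=> d x) by exact: locint_cst.
  rewrite (mulrC (z - y) (d x)) -(incr_cst (d x) yz) -incrB//.
  apply: le_trans (incr_norm _ _ _) _; first exact: locintB.
  rewrite -(incr_cst (e / 2) yz); apply: incr_le; first exact/locint_norm/locintB.
    exact: locint_cst.
  move=> t yt tz; rewrite distrC; apply: H2; rewrite /= distrC.
  by rewrite ltr_norml; apply/andP; split; lra.
rewrite incr_cst// mul1r.
rewrite (_ : _ - _ = (f z - f x - (z - x) * d x) - (f y - f x - (y - x) * d x)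
   - (incr d y z - (z - y) * d x)); last by ring.
apply: le_trans (ler_normB _ _) _.
apply: le_trans (lerD (ler_normB _ _) (lexx _)) _.
by apply: le_trans (lerD (lerD Hz Hy) Hd) _; lra.
Qed.

(** Continuously differentiable functions of two variables, in a form with one radius
for the linear approximation and for the continuity of the partial derivatives F1, F2. *)
Definition C1_2 (F F1 F2 : R -> R -> R) := forall u0 v0 e, 0 < e ->
  exists2 eta : R, 0 < eta & forall u v, `|u - u0| < eta -> `|v - v0| < eta ->
    [/\ `|F u v - F u0 v0 - (F1 u0 v0 * (u - u0) + F2 u0 v0 * (v - v0))| <=
          e * (`|u - u0| + `|v - v0|),
        `|F1 u v - F1 u0 v0| <= e & `|F2 u v - F2 u0 v0| <= e].

(** Near a point x the composite is linear in (u, v) up to e (|du| + |dv|), so it satisfies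
the local condition with weight |du| + |dv|. *)
Lemma abscont_chain F F1 F2 u du v dv : C1_2 F F1 F2 ->
  abscont u du -> abscont v dv ->
  abscont (fun x => F (u x) (v x))
          (fun x => F1 (u x) (v x) * du x + F2 (u x) (v x) * dv x).
Proof.
move=> CF au av.
have cont (G : R -> R -> R) : (forall x e : R, 0 < e -> exists2 eta : R, 0 < eta & forall u' v',
    `|u' - u x| < eta -> `|v' - v x| < eta ->
    `|G u' v' - G (u x) (v x)| <= e) -> continuous (fun x => G (u x) (v x)).
  move=> HG x; apply/cvgrPdist_le => e e0; have [eta eta0 H] := HG x e e0.
  have [eu eu0 Hu] := abscont_near x au eta0.
  have [ev ev0 Hv] := abscont_near x av eta0.
  exists (Num.min eu ev) => /=; first by rewrite lt_min eu0.
  move=> t /=; rewrite distrC lt_min => /andP[/Hu tu /Hv tv].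
  by rewrite distrC; exact: H.
have c1 : continuous (fun x => F1 (u x) (v x)).
  apply: cont => x e e0; have [eta eta0 H] := CF (u x) (v x) e e0.
  by exists eta => // u' v' Hu Hv; have [] := H _ _ Hu Hv.
have c2 : continuous (fun x => F2 (u x) (v x)).
  apply: cont => x e e0; have [eta eta0 H] := CF (u x) (v x) e e0.
  by exists eta => // u' v' Hu Hv; have [] := H _ _ Hu Hv.
have [lu _] := au; have [lv _] := av.
have nlu := locint_norm lu; have nlv := locint_norm lv.
set D := fun x => _ + _; have lD : locint D by apply: locintD; exact: locintM.
split=> // a b ab.
apply: (@straddle_derivable_incr (fun x => F (u x) (v x)) D (fun x => `|du x| + `|dv x|)) ab => //.
- exact: locintD.
move=> x e e0.
have e30 : 0 < e / 3 by rewrite divr_gt0.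
have [k k0 Hk] := CF (u x) (v x) _ e30.
have [eu eu0 Hu] := abscont_near x au k0.
have [ev ev0 Hv] := abscont_near x av k0.
exists (Num.min eu ev); first by rewrite lt_min eu0.
move=> y z xy yx xz zx.
have : x - y < Num.min eu ev by lra.
rewrite lt_min => /andP[yu yv].
have : z - x < Num.min eu ev by lra.
rewrite lt_min => /andP[zu zv].
have yz := le_trans yx xz.
have near_ok t : y <= t -> t <= z -> `|u t - u x| < k /\ `|v t - v x| < k.
  move=> yt tz; split; [apply: Hu|apply: Hv]; rewrite ltr_norml;
    by apply/andP; split; lra.
set W := incr (fun x => `|du x| + `|dv x|) y z.
have Wz : `|u z - u x| + `|v z - v x| <= incr (fun x => `|du x| + `|dv x|) x z.
  by rewrite incrD//; apply: lerD; exact: abscont_dist.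
have Wy : `|u y - u x| + `|v y - v x| <= incr (fun x => `|du x| + `|dv x|) y x.
  by rewrite incrD//; apply: lerD; rewrite distrC; exact: abscont_dist.
have Wsplit : W = incr (fun x => `|du x| + `|dv x|) y x +
                  incr (fun x => `|du x| + `|dv x|) x z.
  by apply: incr_split => //; exact: locintD.
have [uz vz] := near_ok z yz (lexx _).
have [uy vy] := near_ok y (lexx _) yz.
have [Fz _ _] := Hk _ _ uz vz.
have [Fy _ _] := Hk _ _ uy vy.
have ID : `|incr D y z - (F1 (u x) (v x) * (u z - u y) + F2 (u x) (v x) * (v z - v y))|
    <= e / 3 * W.
  rewrite (au.2 _ _ yz) (av.2 _ _ yz) -(incrZ (F1 (u x) (v x)) y z lu)
    -(incrZ (F2 (u x) (v x)) y z lv) -incrD; [|exact: locintZ..].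
  rewrite -incrB//; last by apply: locintD; exact: locintZ.
  have lE : locint (fun t => D t - (F1 (u x) (v x) * du t + F2 (u x) (v x) * dv t)).
    by apply: locintB => //; apply: locintD; exact: locintZ.
  apply: le_trans (incr_norm _ _ lE) _.
  have lW : locint (fun x => `|du x| + `|dv x|) by exact: locintD.
  rewrite /W -incrZ//; apply: incr_le; [exact: locint_norm|exact: locintZ|].
  move=> t yt tz; have [ut vt] := near_ok t yt tz.
  have [_ G1 G2] := Hk _ _ ut vt.
  rewrite /D (_ : _ - _ = (F1 (u t) (v t) - F1 (u x) (v x)) * du t +
     (F2 (u t) (v t) - F2 (u x) (v x)) * dv t); last by ring.
  by apply: le_trans (ler_normD _ _) _; rewrite !normrM mulrDr lerD// ler_wpM2r.
have Fz' := le_trans Fz (ler_wpM2l (ltW e30) Wz).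
have Fy' := le_trans Fy (ler_wpM2l (ltW e30) Wy).
set A := F1 (u x) (v x) in Fz' Fy' ID *; set B := F2 (u x) (v x) in Fz' Fy' ID *.
rewrite (_ : _ - _ =
  (F (u z) (v z) - F (u x) (v x) - (A * (u z - u x) + B * (v z - v x)))
  - (F (u y) (v y) - F (u x) (v x) - (A * (u y - u x) + B * (v y - v x)))
  - (incr D y z - (A * (u z - u y) + B * (v z - v y)))); last by ring.
apply: le_trans (ler_normB _ _) _.
apply: le_trans (lerD (ler_normB _ _) (lexx _)) _.
apply: le_trans (lerD (lerD Fz' Fy') ID) _.
rewrite Wsplit; set X := incr _ y x; set Y := incr _ x z.
have X0 : 0 <= e * X by rewrite mulr_ge0 ?(ltW e0)// incr_ge0// => t; rewrite addr_ge0.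
have Y0 : 0 <= e * Y by rewrite mulr_ge0 ?(ltW e0)// incr_ge0// => t; rewrite addr_ge0.
lra.
Qed.

Lemma C1_2_mul : C1_2 (fun u v => u * v) (fun u v => v) (fun u v => u).
Proof.
move=> u0 v0 e e0; exists e => // u v ue ve.
split; [|exact: ltW..].
rewrite (_ : _ - _ = (u - u0) * (v - v0)); last by ring.
rewrite normrM mulrC.
by have := normr_ge0 (u - u0); have := normr_ge0 (v - v0); nra.
Qed.

Lemma abscontM u du v dv : abscont u du -> abscont v dv ->
  abscont (fun x => u x * v x) (fun x => v x * du x + u x * dv x).
Proof. by move=> au av; exact: (abscont_chain C1_2_mul). Qed.

Lemma abscontD u du v dv : abscont u du -> abscont v dv ->
  abscont (fun x => u x + v x) (fun x => du x + dv x).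
Proof.
move=> [lu Hu] [lv Hv]; split; first exact: locintD.
by move=> a b ab; rewrite incrD// -Hu// -Hv//; ring.
Qed.

End AbsolutelyContinuous.

(** * Weak derivatives on the line *)

Section WeakDerivative.
Context {R : realType}.
Local Notation mu := (@lebesgue_measure R).
Implicit Types (f g d p q : R -> R) (a b c e k : R).

Lemma Rintegral_supp f a b : (forall x, ~ (a <= x <= b) -> f x = 0) ->
  \int[mu]_x f x = incr f a b.
Proof.
move=> f0; rewrite /incr [RHS]Rintegral_mkcond; apply: eq_Rintegral => x _.
rewrite patchE; case: ifPn => //; rewrite notin_setE /= in_itv /= => H.
exact: f0.
Qed.

Lemma itg_supp f a b : locint f -> (forall x, ~ (a <= x <= b) -> f x = 0) ->
  itg setT f.
Proof.
move=> [mf lf] f0.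
have -> : f = f \_ `[a, b].
  apply/funext => x; rewrite patchE; case: ifPn => //.
  by rewrite notin_setE /= in_itv /= => H; exact: f0.
rewrite /itg -restrict_EFin; apply/integrable_restrict => //=.
by rewrite setTI; exact: lf.
Qed.

(** The line is not negligible. *)
Lemma ae_ex (P : R -> Prop) : {ae mu, forall x, P x} -> exists x, P x.
Proof.
move=> [A [mA A0 HA]]; apply/not_existsP => nP.
have : mu setT = 0%E.
  apply/eqP; rewrite -measure_le0 -A0 le_measure ?inE//.
  by move=> x _; apply: HA => /=; exact: nP.
move=> mT; have : (mu `[0%R, 1%R] <= mu setT)%E by rewrite le_measure ?inE.
by rewrite mT /= lebesgue_measure_itv /= lte_fin ltr01 oppr0 adde0 lee_fin ler10.
Qed.

Definition hump_mass : R := incr hump (-1) 1.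
(** A smooth transition from 0 to 1, constant outside [0, 1]. *)
Definition step (x : R) : R := incr hump (-1) x / hump_mass.

Lemma hump_derivable (x : R) : derivable (@hump R) x 1.
Proof. exact: (ntimes_derivable_hump 1).1. Qed.

Lemma hump_continuous : continuous (@hump R).
Proof.
move=> x; apply/differentiable_continuous/derivable1_diffP.
exact: hump_derivable.
Qed.

Lemma hump_locint : locint (@hump R).
Proof. exact/continuous_locint/hump_continuous. Qed.

(** On [1/4, 3/4] both factors of the hump are at least exp(-4). *)
Lemma hump_mass_gt0 : 0 < hump_mass.
Proof.
(* 1/x <= 4 on [1/4, 3/4], for x and for 1 - x *)
pose c := expR (- 4) * expR (- 4) : R.
have c0 : 0 < c by rewrite mulr_gt0 ?expR_gt0.
have h4 : 4^-1 <= 1 - 4^-1 :> R by lra.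
apply: lt_le_trans (_ : incr (fun=> c) (4^-1) (1 - 4^-1) <= _).
  by rewrite incr_cst// mulr_gt0//; lra.
apply: (@le_trans _ _ (incr hump (4^-1) (1 - 4^-1))).
  apply: incr_le; [exact: locint_cst|exact: hump_locint|].
  have F (y : R) : 4^-1 <= y -> expR (- 4) <= flat 0 y.
    move=> y4; have y0 : 0 < y by apply: lt_le_trans y4; rewrite invr_gt0.
    by rewrite flatE// expr0 mul1r ler_expR lerN2 invf_ple ?posrE.
  move=> x x1 x2; rewrite /hump ler_pM ?expR_ge0//; apply: F; lra.
by apply: incr_sub; [exact: hump_locint|exact: hump_ge0|lra..].
Qed.

Lemma incr_hump_le0 (x : R) : x <= 0 -> incr hump (-1) x = 0.
Proof.
move=> x0; rewrite /incr (@eq_Rintegral _ _ _ _ _ (fun=> 0)).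
  by rewrite Rintegral_cst// mul0r.
move=> y; rewrite inE /= in_itv /= => /andP[_ yx].
by rewrite hump_le0// (le_trans yx).
Qed.

Lemma step_le0 x : x <= 0 -> step x = 0.
Proof. by move=> x0; rewrite /step incr_hump_le0// mul0r. Qed.

Lemma step_ge1 x : 1 <= x -> step x = 1.
Proof.
have h10 : -1 <= 1 :> R by lra.
move=> x1; rewrite /step (incr_split hump_locint h10 x1).
rewrite [X in _ + X](_ : _ = 0) ?addr0 ?divff ?gt_eqF ?hump_mass_gt0//.
rewrite /incr (@eq_Rintegral _ _ _ _ _ (fun=> 0)).
  by rewrite Rintegral_cst// mul0r.
move=> y; rewrite inE /= in_itv /= => /andP[y1 _].
by rewrite hump_ge1.
Qed.

Lemma step_ge0 x : 0 <= step x.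
Proof.
by rewrite /step divr_ge0// ?(ltW hump_mass_gt0)// incr_ge0//; exact: hump_ge0.
Qed.

Lemma step_le1 x : step x <= 1.
Proof.
rewrite /step ler_pdivrMr ?hump_mass_gt0// mul1r.
have [x1|x1] := leP x (-1).
  by rewrite incr_hump_le0 ?(ltW hump_mass_gt0)//; lra.
have [x2|/ltW x2] := leP x 1.
  by apply: incr_sub => //; [exact: hump_locint|exact: hump_ge0|exact: ltW].
have := step_ge1 x2; rewrite /step => /(congr1 ( *%R^~ hump_mass)).
by rewrite mul1r divfK ?gt_eqF ?hump_mass_gt0// => ->.
Qed.

Definition unit_hump (x : R) : R := hump_mass^-1 * hump x.

Lemma is_derive_step (x : R) : is_derive x 1 step (unit_hump x).
Proof.
suff H : is_derive x 1 (fun y => incr hump (-1) y) (hump x).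
  have -> : step = (fun y => hump_mass^-1 *: incr hump (-1) y).
    by apply/funext => y; rewrite /step /GRing.scale /= mulrC.
  exact: is_deriveZ.
have [x1|x1] := ltP (-1) x.
  have [] := @continuous_FTC1_closed R hump (-1) x (x + 1) _ _ x1 _.
  - by rewrite ltrDl.
  - by case: hump_locint => _; apply.
  - exact: hump_continuous.
  move=> d1 d2; split; first exact: d1.
  by rewrite -derive1E; exact: d2.
rewrite hump_le0; last by lra.
apply: (@near_eq_is_derive R R R (fun=> 0) _ _ _ _ _ (is_derive_cst _ _ _)).
near=> y; rewrite incr_hump_le0//.
have : y < 0 by near: y; apply: lt_nbhsl; lra.
exact: ltW.
Unshelve. all: by end_near. Qed.

Lemma ntimes_derivable_step n : ntimes_derivable n step.
Proof.
apply: ntimes_derivableS; apply: (ntimes_derivable_of is_derive_step).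
apply: ntimes_derivableM; first exact: ntimes_derivable_cst.
exact: ntimes_derivable_hump.
Qed.

Lemma unit_hump_ge0 x : 0 <= unit_hump x.
Proof. by rewrite mulr_ge0 ?hump_ge0// invr_ge0 ltW ?hump_mass_gt0. Qed.

Lemma unit_hump_le x : unit_hump x <= hump_mass^-1.
Proof. by rewrite ler_piMr ?hump_le1// invr_ge0 ltW ?hump_mass_gt0. Qed.

Lemma unit_hump_supp x : ~ (0 <= x <= 1) -> unit_hump x = 0.
Proof.
move=> /negP; rewrite negb_and -!ltNge => /orP[/ltW x0|/ltW x1].
  by rewrite /unit_hump hump_le0// mulr0.
by rewrite /unit_hump hump_ge1// mulr0.
Qed.

Lemma unit_hump_continuous : continuous unit_hump.
Proof.
by move=> x; apply: cvgM; [exact: cvg_cst|exact: hump_continuous].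
Qed.

(** The transition moved to [a, a + 1/k]; differences of two of them are test functions
and approximate indicator functions of intervals. *)
Definition ramp a k (x : R) := step (k * x + - (k * a)).
Definition ramp' a k (x : R) := k * unit_hump (k * x + - (k * a)).

Lemma is_derive_ramp a k (x : R) : is_derive x 1 (ramp a k) (ramp' a k x).
Proof.
rewrite /ramp' mulrC.
apply: (@is_derive1_comp R step (fun x => k * x + - (k * a))).
  exact: is_derive_step.
apply/has_slopeP => e e0; exists 1 => // t _.
by rewrite (_ : _ - _ = 0) ?normr0 ?mulr_ge0 ?(ltW e0)//; ring.
Qed.

Lemma ramp'_continuous a k : continuous (ramp' a k).
Proof.
move=> x; apply: cvgM; first exact: cvg_cst.
apply: (@continuous_comp _ _ _ (fun x => k * x + - (k * a)) unit_hump); last exact: unit_hump_continuous.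
by apply: cvgD; [apply: cvgM; [exact: cvg_cst|exact: cvg_id]|exact: cvg_cst].
Qed.

Lemma ramp_le a k x : 0 < k -> x <= a -> ramp a k x = 0.
Proof. by move=> k0 xa; rewrite /ramp step_le0//; nra. Qed.

Lemma ramp_ge a k x : 0 < k -> a + k^-1 <= x -> ramp a k x = 1.
Proof.
move=> k0 xa; rewrite /ramp step_ge1//.
have : k * (a + k^-1) <= k * x by rewrite ler_pM2l.
by rewrite mulrDr divff ?gt_eqF//; lra.
Qed.

Lemma ramp'_supp a k x : 0 < k -> ~ (a <= x <= a + k^-1) -> ramp' a k x = 0.
Proof.
move=> k0 nx; rewrite /ramp' unit_hump_supp ?mulr0// => /andP[x1 x2]; apply: nx.
apply/andP; split.
  by rewrite -(ler_pM2l k0); lra.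
by rewrite -(ler_pM2l k0) mulrDr divff ?gt_eqF//; lra.
Qed.

Lemma abscont_ramp a k : abscont (ramp a k) (ramp' a k).
Proof.
by apply: abscont_C1; [exact: is_derive_ramp|exact: ramp'_continuous].
Qed.

Lemma test_function_ramp a b k : 0 < k ->
  test_function (fun x => ramp a k x - ramp b k x).
Proof.
move=> k0; split.
  apply: ntimes_derivable1n => n; apply: ntimes_derivableD.
    by apply: ntimes_derivable_affine; exact: ntimes_derivable_step.
  under eq_fun do rewrite -mulN1r.
  apply: ntimes_derivableM; first exact: ntimes_derivable_cst.
  by apply: ntimes_derivable_affine; exact: ntimes_derivable_step.
exists (`|a| + `|b| + k^-1) => x.
have ki : 0 < k^-1 by rewrite invr_gt0.
rewrite lter_normr => /orP[x1|x1].
  rewrite !ramp_ge ?subrr//.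
    by have := ler_norm b; have := normr_ge0 a; lra.
  by have := ler_norm a; have := normr_ge0 b; lra.
rewrite !ramp_le ?subrr//.
  by have := ler_norm (- b); have := normr_ge0 a; rewrite normrN; lra.
by have := ler_norm (- a); have := normr_ge0 b; rewrite normrN; lra.
Qed.

(** The one-sided form of the notion that the ramps need, as their derivatives are
supported on the right of a. *)
Definition right_lebesgue_pt f x := forall e, 0 < e ->
  exists2 eta : R, 0 < eta & forall h, 0 < h -> h < eta ->
    incr (fun t => `|f t - f x|) x (x + h) <= e * h.

Lemma locint_locally_integrable f : locint f -> locally_integrable setT f.
Proof.
move=> [mf lf]; split=> //; first exact: openT.
move=> K _ cK.
have [M [_ HM]] := @compact_bounded R R K cK.
have /integrableP[_] := lf (- (M + 1)) (M + 1).
apply: le_lt_trans; apply: ge0_subset_integral => //=.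
- exact: compact_measurable.
- apply/measurable_EFinP; apply: measurableT_comp => //.
  exact: measurable_funTS.
- move=> x Kx; rewrite /= in_itv /= -ler_norml.
  by apply: HM => //; rewrite ltrDl.
Qed.

(** The interval [x, x + h] is contained in the ball of radius 2 h around x, whose
measure is comparable. *)
Lemma lebesgue_pt_right f x : locint f -> lebesgue_pt f x ->
  right_lebesgue_pt f x.
Proof.
move=> [mf lf] fx e e0.
have e40 : 0 < e / 4 by rewrite divr_gt0.
have /fine_cvgP[fin /cvgrPdist_lt/(_ _ e40)] := fx.
move=> H; near (0:R)^'+ => r0.
have : \forall r \near 0^'+, davg f x r \is a fin_num /\ `|0 - (fine \o davg f x) r| < e / 4.
  by near=> r; split; near: r.
move=> [eta /= eta0 Heta].
exists (eta / 2) => [|h h0 he]; first by rewrite divr_gt0.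
have h20 : 0 < 2 * h by rewrite mulr_gt0.
have := Heta (2 * h).
have h2e : `|0 - 2 * h| < eta by rewrite sub0r normrN gtr0_norm//; lra.
move=> /(_ h2e h20)[fd].
rewrite sub0r normrN => /(le_lt_trans (ler_norm _)) /=.
rewrite -lte_fin fineK//.
rewrite /davg /iavg lebesgue_measure_ball ?(ltW h20)//.
rewrite inver mulrn_eq0 /= gt_eqF// => Hd.
have {}Hd : (\int[mu]_(y in ball x (2 * h)) `|((center (f x) \o f) y)%:E| < (e * h)%:E)%E.
  have : ((2 * h *+ 2)%:E * ((((2 * h) *+ 2)^-1)%:E * \int[mu]_(y in ball x (2 * h)) `|((center (f x) \o f) y)%:E|) < ((2 * h) *+ 2)%:E * (e / 4)%:E)%E.
    by rewrite lte_pmul2l// lte_fin pmulrn_lgt0.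
  rewrite muleA -EFinM divff ?mul1e ?mulrn_eq0 ?gt_eqF// -EFinM.
  by rewrite (_ : 2 * h *+ 2 * (e / 4) = e * h)//; rewrite -mulr_natr; field.
have lc : locint (fun t => f t - f x).
  by apply: locintB; [split|exact: locint_cst].
rewrite -lee_fin; apply: ltW; apply: le_lt_trans Hd.
rewrite /incr /Rintegral fineK; last first.
  by apply: integrable_fin_num => //; case: (locint_norm lc) => _; apply.
apply: ge0_subset_integral => //=.
- exact: measurable_ball.
- apply/measurable_EFinP; apply: measurableT_comp => //.
  by apply: measurable_funTS; apply: measurable_funB.
- move=> t; rewrite /= in_itv /= => /andP[xt th].
  by rewrite /ball /= ltr_norml; apply/andP; split; lra.
Unshelve. all: by end_near. Qed.

Lemma locint_ae_right_lebesgue_pt f : locint f ->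
  {ae mu, forall x, right_lebesgue_pt f x}.
Proof.
move=> lf; have := lebesgue_differentiation (locint_locally_integrable lf).
by apply: ae_impl => x; exact: lebesgue_pt_right.
Qed.

(** The derivative of the ramp is a nonnegative function of mass 1 on [a, a + 1/k],
bounded by a multiple of k: integrating f against it averages f at the right of a. *)
Lemma ramp'_approx f a e : locint f -> right_lebesgue_pt f a -> 0 < e ->
  exists2 k0 : R, 0 < k0 & forall k, k0 < k ->
    `|\int[mu]_x (f x * ramp' a k x) - f a| <= e.
Proof.
move=> lf fa e0.
have [eta eta0 H] := fa (e * hump_mass) (mulr_gt0 e0 hump_mass_gt0).
exists eta^-1; first by rewrite invr_gt0.
move=> k ek; have k0 : 0 < k by rewrite (lt_trans _ ek)// invr_gt0.
have ki0 : 0 < k^-1 by rewrite invr_gt0.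
have ke : k^-1 < eta by rewrite invf_plt ?posrE.
have ak : a <= a + k^-1 by rewrite lerDl ltW.
rewrite (@Rintegral_supp _ a (a + k^-1)); last first.
  by move=> x nx; rewrite ramp'_supp// mulr0.
have lr : locint (ramp' a k) by exact/continuous_locint/ramp'_continuous.
have -> : f a = incr (fun x => f a * ramp' a k x) a (a + k^-1).
  rewrite incrZ// -(abscont_ramp a k).2// ramp_ge// ramp_le// subr0 mulr1//.
have l1 : locint (fun x => f x * ramp' a k x).
  by under eq_fun do rewrite mulrC; apply: locintM => //; exact: ramp'_continuous.
have l2 : locint (fun x => f a * ramp' a k x) by exact: locintZ.
rewrite -incrB//.
apply: le_trans (incr_norm _ _ (locintB l1 l2)) _.
have lfa : locint (fun t => `|f t - f a|).
  by apply: locint_norm; apply: locintB => //; exact: locint_cst.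
apply: (@le_trans _ _ (incr (fun t => k * hump_mass^-1 * `|f t - f a|) a (a + k^-1))).
  apply: incr_le; [exact/locint_norm/locintB|exact: locintZ|].
  move=> x _ _; rewrite -mulrBl normrM mulrC ler_wpM2r//.
  rewrite ger0_norm; last by rewrite mulr_ge0 ?unit_hump_ge0// ltW.
  by rewrite ler_wpM2l ?unit_hump_le// ltW.
rewrite incrZ//.
apply: (@le_trans _ _ (k * hump_mass^-1 * (e * hump_mass * k^-1))).
  by rewrite ler_wpM2l ?H// mulr_ge0 ?(ltW k0)// invr_ge0 (ltW hump_mass_gt0).
rewrite le_eqVlt; apply/orP; left; apply/eqP; field.
by rewrite !gt_eqF// hump_mass_gt0.
Qed.

Definition rweak_derivative p q := forall theta, test_function theta ->
  \int[mu]_x (p x * derive1 theta x) = - \int[mu]_x (q x * theta x).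

(** The weak derivative is tested against the difference of the ramps at a and at b.  For
large slopes its derivative evaluates f at both Lebesgue points, and the function itself
tends to the indicator function of [a, b]. *)
Lemma rweak_derivative_incr f g a b : locint f -> locint g ->
  rweak_derivative f g -> right_lebesgue_pt f a -> right_lebesgue_pt f b ->
  a <= b -> f b - f a = incr g a b.
Proof.
move=> lf lg fg fa fb ab.
have [->|nab] := eqVneq a b; first by rewrite incr_self subrr.
have {nab} ab' : a < b by rewrite lt_def eq_sym nab.
apply/eqP; rewrite -subr_eq0 -normr_eq0 eq_le normr_ge0 andbT.
apply/ler_addgt0Pr => e e0; rewrite add0r.
have e40 : 0 < e / 4 by rewrite divr_gt0.
have [ka ka0 Ha] := ramp'_approx lf fa e40.
have [kb kb0 Hb] := ramp'_approx lf fb e40.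
have [ea ea0 Hga] := incr_small a lg e40.
have [eb eb0 Hgb] := incr_small b lg e40.
(* steep enough for the averages at a and b, for the mass of g near a and b, and for
   the ramps to be disjoint *)
pose k := ka + kb + ea^-1 + eb^-1 + (b - a)^-1 + 1.
have ba0 : 0 < b - a by rewrite subr_gt0.
have iea0 : 0 < ea^-1 by rewrite invr_gt0.
have ieb0 : 0 < eb^-1 by rewrite invr_gt0.
have iba0 : 0 < (b - a)^-1 by rewrite invr_gt0.
have k0 : 0 < k by rewrite /k; lra.
have h0 : 0 < k^-1 by rewrite invr_gt0.
have hea : k^-1 < ea by rewrite invf_plt ?posrE// /k; lra.
have heb : k^-1 < eb by rewrite invf_plt ?posrE// /k; lra.
have hab : k^-1 < b - a by rewrite invf_plt ?posrE// /k; lra.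
have {}Ha : `|\int[mu]_x (f x * ramp' a k x) - f a| <= e / 4 by apply: Ha; rewrite /k; lra.
have {}Hb : `|\int[mu]_x (f x * ramp' b k x) - f b| <= e / 4 by apply: Hb; rewrite /k; lra.
set h := k^-1 in h0 hea heb hab.
pose th x := ramp a k x - ramp b k x.
have dth : derive1 th = (fun x => ramp' a k x - ramp' b k x).
  apply: derive1_funE => x; apply: is_deriveB; exact: is_derive_ramp.
have lfr c : locint (fun x => f x * ramp' c k x).
  by under eq_fun do rewrite mulrC; apply: locintM => //; exact: ramp'_continuous.
have ifr c : itg setT (fun x => f x * ramp' c k x).
  apply: (@itg_supp _ c (c + k^-1)); first exact: lfr.
  by move=> x nx; rewrite ramp'_supp// mulr0.
have := fg th (test_function_ramp a b k0).
rewrite dth; under eq_Rintegral do rewrite mulrBr.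
rewrite RintegralB//; [|exact: ifr..].
set Ia := \int[mu]_x _; set Ib := \int[mu]_x _ => E1.
have cth : continuous th.
  by move=> x; apply: cvgB; exact: (abscont_continuous (abscont_ramp _ k)).
have lgt : locint (fun x => g x * th x).
  by under eq_fun do rewrite mulrC; exact: locintM.
have th01 x : b <= x -> `|th x| <= 1.
  move=> bx; rewrite /th ramp_ge//; last by rewrite -/h; lra.
  by rewrite ger0_norm ?subr_ge0 ?gerBl ?step_ge0 ?step_le1.
have {}E1 : Ib - Ia = incr (fun x => g x * th x) a b + incr (fun x => g x * th x) b (b + h).
  rewrite -incr_split//; last by rewrite lerDl ltW.
  rewrite -Rintegral_supp; first by rewrite -opprB E1 opprK.
  move=> x /negP; rewrite negb_and -!ltNge => /orP[xa|xb].
    by rewrite /th !ramp_le ?subrr ?mulr0//; lra.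
  by rewrite /th !ramp_ge ?subrr ?mulr0//; rewrite -/h; lra.
have E2 : `|incr (fun x => g x * th x) b (b + h)| <= e / 4.
  apply: le_trans (incr_norm _ _ lgt) _.
  apply: le_trans (ltW (Hgb b (b + h) _ _ _)); [|lra..].
  apply: incr_le; [exact: locint_norm..|].
  by move=> x bx _; rewrite normrM ler_piMr// th01.
have E3 : `|incr (fun x => g x * th x) a b - incr g a b| <= e / 4.
  rewrite -incrB//.
  have lD : locint (fun x => g x * th x - g x) by exact: locintB.
  apply: le_trans (incr_norm _ _ lD) _.
  rewrite (@incr_split _ _ a (a + h)); [|exact: locint_norm|lra..].
  rewrite [X in _ + X](_ : _ = 0) ?addr0; last first.
    rewrite /incr (@eq_Rintegral _ _ _ _ _ (fun=> 0)).
      by rewrite Rintegral_cst// mul0r.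
    move=> x; rewrite inE /= in_itv /= => /andP[ax xb].
    by rewrite /th ramp_ge// (@ramp_le b)// subr0 mulr1 subrr normr0.
  apply: le_trans (ltW (Hga a (a + h) _ _ _)); [|lra..].
  apply: incr_le; [exact: locint_norm..|].
  move=> x ax xh; rewrite /th (@ramp_le b)//; last by lra.
  rewrite subr0 -[X in _ - X]mulr1 -mulrBr normrM ler_piMr//.
  by rewrite distrC ger0_norm ?subr_ge0 ?gerBl ?step_ge0 ?step_le1.
rewrite (_ : _ - _ = (Ib - Ia - incr (fun x => g x * th x) a b
     - incr (fun x => g x * th x) b (b + h)) - (Ib - f b) + (Ia - f a)
     + (incr (fun x => g x * th x) a b - incr g a b)
     + incr (fun x => g x * th x) b (b + h)); last by ring.
rewrite E1 [X in X - (Ib - f b)](_ : _ = 0); last by ring.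
rewrite sub0r.
apply: le_trans (ler_normD _ _) _.
apply: le_trans (lerD (ler_normD _ _) (lexx _)) _.
apply: le_trans (lerD (lerD (ler_normD _ _) (lexx _)) (lexx _)) _.
by rewrite normrN; lra.
Qed.

(** The representative is the primitive of g that agrees with f at one Lebesgue point. *)
Lemma rweak_derivative_abscont f g : locint f -> locint g ->
  rweak_derivative f g ->
  exists2 P, abscont P g & {ae mu, forall x, f x = P x}.
Proof.
move=> lf lg fg; have ae := locint_ae_right_lebesgue_pt lf.
have [c fc] := ae_ex ae.
pose P x := f c + (if c <= x then incr g c x else - incr g x c).
exists P; last first.
  apply: ae_impl ae => x fx; rewrite /P; case: leP => [cx|/ltW xc].
    by rewrite -(rweak_derivative_incr lf lg fg)//; ring.
  by rewrite -(rweak_derivative_incr lf lg fg)//; ring.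
split=> // a b ab; rewrite /P.
have [ca|ac] := leP c a.
  by rewrite (le_trans ca ab) (incr_split lg ca ab); ring.
have [cb|bc] := leP c b.
  by rewrite (incr_split lg (ltW ac) cb); ring.
by rewrite (incr_split lg ab (ltW bc)); ring.
Qed.

(** Integration by parts: the product with a test function is absolutely continuous and
vanishes at both ends of a large interval. *)
Lemma abscont_rweak_derivative P g : abscont P g -> rweak_derivative P g.
Proof.
move=> Pg th [dth [M HM]].
have dth1 : forall x : R, is_derive x 1 th (derive1 th x).
  by move=> x; split; [exact: (dth 0%N)|rewrite derive1E].
have cth' : continuous (derive1 th).
  by move=> x; apply/differentiable_continuous/derivable1_diffP; exact: (dth 1%N).
have ath : abscont th (derive1 th) by exact: abscont_C1.
have dM x : M < `|x| -> derive1 th x = 0.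
  move=> Mx; rewrite derive1E.
  have : is_derive x 1 th 0.
    apply: (@near_eq_is_derive R R R (fun=> 0) _ _ _ _ _ (is_derive_cst _ _ _)).
    have cn : {for x, continuous (fun y : R => `|y|)} by exact: norm_continuous.
    have : \forall y \near x, M < `|y| by exact: (cvgr_gt _ cn).
    by apply: filterS => y /HM.
  by case.
pose N := `|M| + 1.
have N0 : - N <= N.
  by rewrite /N; have := normr_ge0 M; lra.
have out x : ~ (- N <= x <= N) -> M < `|x|.
  move=> nx; have : N < `|x|.
    by rewrite ltNge; apply/negP; rewrite ler_norml.
  by rewrite /N; have := ler_norm M; lra.
have tN : th N = 0 /\ th (- N) = 0.
  have ? : M < `|N| by rewrite /N ger0_norm; have := ler_norm M; have := normr_ge0 M; lra.
  by split; apply: HM => //; rewrite normrN.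
have [lP prod] := abscontM Pg ath.
have := prod _ _ N0; rewrite tN.1 tN.2 !mulr0 subrr.
have cP := abscont_continuous Pg.
have cth := abscont_continuous ath.
have l1 : locint (fun x => th x * g x) by apply: locintM => //; exact: Pg.1.
have l2 : locint (fun x => P x * derive1 th x).
  by apply: locintM => //; exact: continuous_locint.
rewrite incrD//.
have -> : \int[mu]_x (P x * derive1 th x) = incr (fun x => P x * derive1 th x) (- N) N.
  by apply: Rintegral_supp => x /out Mx; rewrite dM// mulr0.
have -> : \int[mu]_x (g x * th x) = incr (fun x => th x * g x) (- N) N.
  under eq_Rintegral do rewrite mulrC.
  by apply: Rintegral_supp => x /out Mx; rewrite HM// mul0r.
by move=> /esym/eqP; rewrite addrC addr_eq0 => /eqP.
Qed.

(** A density is the derivative of its primitive at the Lebesgue points. *)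
Lemma abscont0_ae d : abscont (fun=> 0) d -> {ae mu, forall x, d x = 0}.
Proof.
move=> [ld H]; have := lebesgue_differentiation (locint_locally_integrable ld).
apply: ae_impl => x dx.
have xu : x < x + 1 by rewrite ltrDl.
have ax : (BLeft (x - 1)%R < BRight x)%E by rewrite /= lte_fin gtrBl.
have [d1 d2] := FTC1_lebesgue_pt xu (ld.2 (x - 1) (x + 1)) ax dx.
rewrite -d2; set F := fun y : R => _.
have FE : {near x, F =1 (fun=> 0)}.
  near=> y; rewrite /F -/(incr d (x - 1) y) -H ?subrr//.
  have : x - 1 < y by near: y; apply: lt_nbhsr; lra.
  exact: ltW.
rewrite derive1E (near_eq_derive _ FE).
exact: derive_cst.
Unshelve. all: by end_near. Qed.

(** P^2 has density 2 P g, so P(x)^2 <= P(y)^2 + 2 |P| |g| for all y <= x.  If P(x)^2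
exceeded the bound, P^2 would be bounded below by a positive constant on a half-line,
against its integrability. *)
Lemma abscont_sup P g : abscont P g -> L2 P -> L2 g -> forall x,
  P x ^+ 2 <= 2 * (Num.sqrt (\int[mu]_x (P x ^+ 2)) * Num.sqrt (\int[mu]_x (g x ^+ 2))).
Proof.
move=> Pg LP Lg x; set N := _ * Num.sqrt _.
have PP := abscontM Pg Pg.
have iPg := L2_itgM LP Lg.
have step2 y : y <= x -> P x ^+ 2 - P y ^+ 2 <= 2 * N.
  move=> yx; rewrite !expr2 PP.2//.
  have lPg : locint (fun x => P x * g x) by exact: itg_locint.
  rewrite incrD//; apply: (@le_trans _ _ (2 * `|incr (fun x => P x * g x) y x|)).
    by have := ler_norm (incr (fun x => P x * g x) y x); lra.
  rewrite ler_pM2l//; apply: le_trans (incr_norm _ _ lPg) _.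
  apply: le_trans (Rintegral_sub_le _ (itg_norm measurableT iPg) _) _ => //.
  have := L2_CS_sqrt (L2_norm LP) (L2_norm Lg).
  have sqE (r : R -> R) : \int[mu]_x (`|r x| ^+ 2) = \int[mu]_x (r x ^+ 2).
    by apply: eq_Rintegral => t _; rewrite real_normK ?num_real.
  rewrite !sqE -/N; apply: le_trans; apply: le_trans (ler_norm _).
  by apply: le_Rintegral => //; [exact: itg_norm|apply: L2_itgM; exact: L2_norm|move=> t _; rewrite normrM].
rewrite leNgt; apply/negP => lt.
pose k := P x ^+ 2 - 2 * N.
have k0 : 0 < k by rewrite subr_gt0.
have Hk y : y <= x -> k <= P y ^+ 2 by move=> /step2; rewrite /k; lra.
pose I := \int[mu]_x (P x ^+ 2).
have I0 : 0 <= I by apply: Rintegral_ge0 => t _; exact: sqr_ge0.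
(* on [x - n, x] the integral of the constant k already exceeds I *)
pose n := (I + 1) / k.
have n0 : 0 <= n by rewrite divr_ge0 ?(ltW k0)// addr_ge0.
have : incr (fun=> k) (x - n) x <= I.
  apply: (@le_trans _ _ (incr (fun x => P x ^+ 2) (x - n) x)).
    apply: incr_le; [exact: locint_cst|exact: (itg_locint LP.2)|].
    by move=> y _; exact: Hk.
  by apply: Rintegral_sub_le => //; [exact: LP.2|move=> t; exact: sqr_ge0].
rewrite incr_cst ?gerBl// opprB addrC subrK /n mulrC divfK ?gt_eqF//; lra.
Qed.

End WeakDerivative.

(** * Real Sobolev functions and powers of the modulus *)

Section ModulusPower.
Context {R : realType}.
Local Notation mu := (@lebesgue_measure R).
Implicit Types (u v s e : R).

Lemma powR_lt_root s e : 0 < s -> 0 < e ->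
  exists2 eta : R, 0 < eta & forall r, 0 <= r -> r < eta -> r `^ s <= e.
Proof.
move=> s0 e0; exists (e `^ s^-1); first exact: powR_gt0.
move=> r r0 re; rewrite -[leRHS]powRr1 ?(ltW e0)// -(mulVf (lt0r_neq0 s0)) powRrM.
by rewrite ge0_ler_powR// ?nnegrE ?powR_ge0 ?(ltW s0)// ltW.
Qed.

(** This bounds the partial derivatives of (u^2 + v^2)^s by a positive power of
u^2 + v^2: they are bounded on bounded sets, and continuous at the origin, since
s > 1/2. *)
Lemma mul_powR_le s u v : 2^-1 < s ->
  `|u| * (u ^+ 2 + v ^+ 2) `^ (s - 1) <= (u ^+ 2 + v ^+ 2) `^ (s - 2^-1).
Proof.
move=> s2; set q := _ + _.
have q0 : 0 <= q by rewrite addr_ge0// sqr_ge0.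
have -> : q `^ (s - 2^-1) = q `^ (2^-1) * q `^ (s - 1).
  rewrite -powRD; first by congr powR; lra.
  by apply/implyP => /eqP H; exfalso; lra.
rewrite ler_wpM2r ?powR_ge0// powR12_sqrt// -sqrtr_sqr ler_wsqrtr//.
by rewrite lerDl sqr_ge0.
Qed.

Lemma powR_sqr_le s u v : 0 <= s ->
  (u ^+ 2 + v ^+ 2) `^ s <= (`|u| + `|v|) `^ (2 * s).
Proof.
move=> s0; have r0 : 0 <= `|u| + `|v| by rewrite addr_ge0.
rewrite powRrM powR_mulrn// ge0_ler_powR// ?nnegrE ?sqr_ge0 ?addr_ge0 ?sqr_ge0//.
rewrite -(real_normK (num_real u)) -(real_normK (num_real v)).
by have := normr_ge0 u; have := normr_ge0 v; nra.
Qed.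

(** Away from the origin this is the derivative of r^s.  At the origin the
function is of order 2 s > 1, so that it has slope 0 there. *)
Lemma C1_2_powR s : 2^-1 < s ->
  C1_2 (fun u v => (u ^+ 2 + v ^+ 2) `^ s)
       (fun u v => 2 * s * (u * (u ^+ 2 + v ^+ 2) `^ (s - 1)))
       (fun u v => 2 * s * (v * (u ^+ 2 + v ^+ 2) `^ (s - 1))).
Proof.
move=> s2 u0 v0 e e0.
have s0 : 0 < s by lra.
pose q0 := u0 ^+ 2 + v0 ^+ 2.
have q00 : 0 <= q0 by rewrite addr_ge0// sqr_ge0.
(* the origin comes first *)
move: q00; rewrite le_eqVlt => /orP[/eqP/esym q00|q0p].
  have [u00 v00] : u0 = 0 /\ v0 = 0.
    have := q00; rewrite /q0 => /eqP; rewrite paddr_eq0 ?sqr_ge0// !sqrf_eq0.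
    by move=> /andP[/eqP -> /eqP ->].
  have e'0 : 0 < e / (2 * s + 1) by rewrite divr_gt0//; lra.
  have [eta eta0 H] := @powR_lt_root (2 * s - 1) _ ltac:(lra) e'0.
  exists (eta / 2); first by rewrite divr_gt0.
  move=> u v; rewrite u00 v00 !subr0 => ue ve.
  have r0 : 0 <= `|u| + `|v| by rewrite addr_ge0.
  have Hr : (`|u| + `|v|) `^ (2 * s - 1) <= e / (2 * s + 1) by apply: H => //; lra.
  have e'e : e / (2 * s + 1) <= e by rewrite ler_pdivrMr; nra.
  have se : 2 * s * (e / (2 * s + 1)) <= e.
    rewrite mulrA ler_pdivrMr; last lra.
    nra.
  rewrite (_ : 0 ^+ 2 + 0 ^+ 2 = 0 :> R); last by rewrite expr0n addr0.
  rewrite powR0 ?gt_eqF// !mul0r !mulr0 !mul0r addr0 !subr0.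
  have part a b : `|a| + `|b| = `|u| + `|v| ->
      `|2 * s * (a * (a ^+ 2 + b ^+ 2) `^ (s - 1))| <= e.
    move=> abE; rewrite !normrM (ger0_norm (powR_ge0 _ _)).
    rewrite (ger0_norm (ltW s0)) (ger0_norm (ler0n _ 2)).
    apply: le_trans se; rewrite ler_wpM2l//; first lra.
    apply: le_trans (mul_powR_le a b s2) _; apply: le_trans Hr.
    apply: le_trans (powR_sqr_le a b _) _; first lra.
    by rewrite abE (_ : 2 * (s - 2^-1) = 2 * s - 1)//; lra.
  split; [|exact: part|by rewrite [u ^+ 2 + _]addrC; apply: part; rewrite addrC].
  rewrite ger0_norm ?powR_ge0//.
  apply: le_trans (powR_sqr_le u v (ltW s0)) _.
  rewrite -mulr_powRB1//; last lra.
  by rewrite mulrC ler_wpM2r// (le_trans Hr).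
have sq0 : 0 < q0 `^ (s - 1) by rewrite powR_gt0.
pose K := `|u0| + `|v0| + 1.
have K1 : 1 <= K by rewrite /K lerDr addr_ge0.
have K0 : 0 < K by lra.
pose D := s * q0 `^ (s - 1).
have D0 : 0 < D by rewrite mulr_gt0.
(* K bounds |u| and |v| near (u0, v0), so that q varies by at most 2 K (|a| + |b|) *)
pose e1 := e / (4 * K * (1 + s)).
have e10 : 0 < e1 by rewrite divr_gt0// !mulr_gt0//; lra.
have Ke1 : 4 * K * e1 * (1 + s) = e by rewrite /e1; field; rewrite !gt_eqF//; lra.
have [eta1 eta10 H1] := (has_slopeP _ _ _).2 (is_derive1_powR s q0p) _ e10.
have /cvgrPdist_le/(_ _ e10)[eta2 /= eta20 H2] :=
  has_slope_continuous ((has_slopeP _ _ _).2 (is_derive1_powR (s - 1) q0p)).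
pose eta := Num.min 1 (Num.min (eta1 / (4 * K)) (Num.min (eta2 / (4 * K)) (e / (4 * (D + 1))))).
have d1 : 0 < eta1 / (4 * K) by rewrite divr_gt0// mulr_gt0.
have d2 : 0 < eta2 / (4 * K) by rewrite divr_gt0// mulr_gt0.
have d3 : 0 < e / (4 * (D + 1)) by rewrite divr_gt0// mulr_gt0//; lra.
exists eta; first by rewrite /eta !lt_min ltr01 d1 d2 d3.
move=> u v; rewrite /eta !lt_min => /and4P[u1 u2 u3 u4] /and4P[v1 v2 v3 v4].
pose a := u - u0; pose b := v - v0.
rewrite -/a -/b in u1 u2 u3 u4 v1 v2 v3 v4 *.
have uE : u = u0 + a by rewrite /a addrC subrK.
have vE : v = v0 + b by rewrite /b addrC subrK.
pose q := u ^+ 2 + v ^+ 2; rewrite -/q -/q0.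
have a0 := normr_ge0 a; have b0 := normr_ge0 b.
have qq0 : `|q - q0| <= 2 * K * (`|a| + `|b|).
  have -> : q - q0 = a * (2 * u0 + a) + b * (2 * v0 + b) by rewrite /q /q0 uE vE; ring.
  apply: le_trans (ler_normD _ _) _; rewrite !normrM.
  have k1 : `|2 * u0 + a| <= 2 * K.
    apply: le_trans (ler_normD _ _) _; rewrite normrM (ger0_norm (ler0n _ 2)).
    by rewrite /K; have := normr_ge0 v0; have := normr_ge0 u0; lra.
  have k2 : `|2 * v0 + b| <= 2 * K.
    apply: le_trans (ler_normD _ _) _; rewrite normrM (ger0_norm (ler0n _ 2)).
    by rewrite /K; have := normr_ge0 u0; have := normr_ge0 v0; lra.
  by have := ler_wpM2l a0 k1; have := ler_wpM2l b0 k2; lra.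
have K40 : 0 < 4 * K by rewrite mulr_gt0.
have near1 : `|q - q0| < eta1.
  apply: le_lt_trans qq0 _.
  move: u2 v2; rewrite !ltr_pdivlMr// => u2 v2; lra.
have near2 : `|q - q0| < eta2.
  apply: le_lt_trans qq0 _.
  move: u3 v3; rewrite !ltr_pdivlMr// => u3 v3; lra.
have D40 : 0 < 4 * (D + 1) by rewrite mulr_gt0//; lra.
have aD : `|a| * D <= e / 4 by move: u4; rewrite ltr_pdivlMr//; nra.
have bD : `|b| * D <= e / 4 by move: v4; rewrite ltr_pdivlMr//; nra.
have S1 := H1 _ near1; rewrite -/D in S1.
have S2 : `|q `^ (s - 1) - q0 `^ (s - 1)| <= e1.
  by rewrite distrC; apply: H2; rewrite /= distrC.
have part x x0 y : x = x0 + y -> `|x0| + 1 <= K -> `|y| < 1 -> `|y| * D <= e / 4 ->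
    `|2 * s * (x * q `^ (s - 1)) - 2 * s * (x0 * q0 `^ (s - 1))| <= e.
  move=> xE x0K y1 yD.
  have -> : 2 * s * (x * q `^ (s - 1)) - 2 * s * (x0 * q0 `^ (s - 1)) =
     2 * s * (x * (q `^ (s - 1) - q0 `^ (s - 1))) + 2 * (y * D).
    by rewrite /D xE; ring.
  apply: le_trans (ler_normD _ _) _.
  rewrite (normrM 2 (y * D)) (normrM y D) (normrM (2 * s)) (normrM 2 s) (normrM x).
  rewrite (ger0_norm (ltW s0)) (ger0_norm (ltW D0)) (ger0_norm (ler0n _ 2)).
  have xK : `|x| <= K by rewrite xE; apply: le_trans (ler_normD _ _) _; lra.
  have : `|x| * `|q `^ (s - 1) - q0 `^ (s - 1)| <= K * e1 by rewrite ler_pM.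
  move=> /(ler_wpM2l (ltW s0)).
  have : 0 < K * e1 by rewrite mulr_gt0.
  rewrite mulrA; nra.
split.
- rewrite (_ : _ - _ = (q `^ s - q0 `^ s - (q - q0) * D) + D * (a ^+ 2 + b ^+ 2)); last first.
    by rewrite /D /q /q0 uE vE; ring.
  apply: le_trans (ler_normD _ _) _.
  have T1 := le_trans S1 (ler_wpM2l (ltW e10) qq0).
  apply: le_trans (lerD T1 (lexx _)) _.
  rewrite (ger0_norm (_ : 0 <= D * (a ^+ 2 + b ^+ 2))); last first.
    by apply: mulr_ge0; [exact: ltW|rewrite addr_ge0// sqr_ge0].
  rewrite -(real_normK (num_real a)) -(real_normK (num_real b)).
  set A := `|a| in a0 b0 aD bD u1 v1 *; set B := `|b| in b0 bD v1 *.
  have X1 : A * (A * D) <= A * (e / 4) by rewrite ler_wpM2l.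
  have X2 : B * (B * D) <= B * (e / 4) by rewrite ler_wpM2l.
  have X3 : 4 * K * e1 <= e by have := mulr_gt0 (mulr_gt0 K0 e10) s0; rewrite -[leRHS]Ke1; lra.
  have X4 : (A + B) * (4 * K * e1) <= (A + B) * e by rewrite ler_wpM2l// addr_ge0.
  by have := mulr_ge0 a0 (ltW e0); have := mulr_ge0 b0 (ltW e0); rewrite !expr2; nra.
- by apply: (part _ _ a) => //; rewrite /K; have := normr_ge0 v0; lra.
- by apply: (part _ _ b) => //; rewrite /K; have := normr_ge0 u0; lra.
Qed.

(** The pair is given with an absolutely continuous representative of p with density d;
[sobolevP] shows that this is the weak formulation. *)
Definition sobolev (p d : R -> R) :=
  [/\ L2 p, L2 d & exists2 P, abscont P d & {ae mu, forall x, p x = P x}].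

Lemma abscont_ae_density (P d1 d2 : R -> R) : measurable_fun setT d2 ->
  {ae mu, forall x, d1 x = d2 x} -> abscont P d1 -> abscont P d2.
Proof.
move=> md2 d12 [[md1 id1] H]; split; first split => //.
  move=> a b; apply: (ae_eq_itg _ _ d12) => //; exact: measurable_funTS.
move=> a b ab; rewrite H// /incr; apply: ae_eq_Rintegral => //;
  exact: measurable_funTS.
Qed.

Lemma sobolevP p d : sobolev p d <->
  [/\ L2 p, L2 d & rweak_derivative p d].
Proof.
split=> [[Lp Ld [P aP pP]]|[Lp Ld pd]]; split=> //.
  move=> th tth; rewrite -(abscont_rweak_derivative aP tth).
  have [dth _] := tth.
  have mth' : measurable_fun setT (derive1 th).
    apply: continuous_measurable_fun => x.
    by apply/differentiable_continuous/derivable1_diffP; exact: (dth 1%N).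
  apply: ae_eq_Rintegral => //.
  - by apply: measurable_funM => //; case: Lp.
  - by apply: measurable_funM => //; exact: (abscont_measurable aP).
  - by apply: ae_impl pP => x ->.
by apply: rweak_derivative_abscont => //; exact: L2_locint.
Qed.

Lemma sobolevD p dp q dq : sobolev p dp -> sobolev q dq ->
  sobolev (fun x => p x + q x) (fun x => dp x + dq x).
Proof.
move=> [Lp Ldp [P aP pP]] [Lq Ldq [Q aQ qQ]]; split; [exact: L2D..|].
exists (fun x => P x + Q x); first exact: abscontD.
by apply: ae_impl2 pP qQ => x -> ->.
Qed.

Lemma sobolevZ c p dp : sobolev p dp ->
  sobolev (fun x => c * p x) (fun x => c * dp x).
Proof.
move=> [Lp Ldp [P aP pP]]; split; [exact: L2Z..|].
exists (fun x => c * P x); last by apply: ae_impl pP => x ->.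
split; first exact: locintZ aP.1.
by move=> a b ab; rewrite (incrZ _ _ _ aP.1) -aP.2//; ring.
Qed.

Lemma sobolevN p dp : sobolev p dp -> sobolev (fun x => - p x) (fun x => - dp x).
Proof.
move=> H; have := sobolevZ (-1) H.
by congr sobolev; apply/funext => x; rewrite mulN1r.
Qed.

(** The sup bound turns almost everywhere 0 into 0 everywhere. *)
Lemma abscont_ae0 P d : abscont P d -> L2 P -> {ae mu, forall x, P x = 0} -> L2 d ->
  {ae mu, forall x, d x = 0}.
Proof.
move=> aP LP P0 Ld.
have I0 : \int[mu]_x (P x ^+ 2) = 0.
  rewrite (@ae_eq_Rintegral _ _ _ (fun=> 0)) ?Rintegral_cst ?mul0r//.
    by case: LP => mP _; exact: measurable_funX.
  by apply: ae_impl P0 => x ->; rewrite expr0n.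
have Pz x : P x = 0.
  have := abscont_sup aP LP Ld x.
  rewrite I0 sqrtr0 mul0r mulr0 => H; apply/eqP.
  by rewrite -sqrf_eq0 eq_le H sqr_ge0.
apply: abscont0_ae; have -> : (fun=> 0) = P by apply/funext => x; rewrite Pz.
exact: aP.
Qed.

Lemma sobolev_unique p q d1 d2 : {ae mu, forall x, p x = q x} ->
  sobolev p d1 -> sobolev q d2 -> {ae mu, forall x, d1 x = d2 x}.
Proof.
move=> pq H1 H2; have [Lp L1 [P aP pP]] := sobolevD H1 (sobolevN H2).
have LP : L2 P.
  by apply: ae_eq_L2 pP Lp; exact: abscont_measurable aP.
have : {ae mu, forall x, d1 x - d2 x = 0}.
  by apply: abscont_ae0 aP LP _ L1; apply: ae_impl2 pP pq => x <- ->; rewrite subrr.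
by apply: ae_impl => x /subr0_eq.
Qed.

Lemma sobolev_sup p d : sobolev p d -> {ae mu, forall x,
  p x ^+ 2 <= 2 * (Num.sqrt (\int[mu]_x (p x ^+ 2)) * Num.sqrt (\int[mu]_x (d x ^+ 2)))}.
Proof.
move=> [Lp Ld [P aP pP]].
have LP : L2 P by apply: ae_eq_L2 pP Lp; exact: abscont_measurable aP.
have -> : \int[mu]_x (p x ^+ 2) = \int[mu]_x (P x ^+ 2).
  apply: ae_eq_Rintegral => //; [apply: measurable_funX..|].
  - by case: Lp.
  - by case: LP.
  - by apply: ae_impl pP => x ->.
by apply: ae_impl pP => x ->; exact: abscont_sup.
Qed.

Lemma sobolev_bounded_rep p d : sobolev p d ->
  exists P, [/\ abscont P d, {ae mu, forall x, p x = P x} &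
    exists M, forall x, `|P x| <= M].
Proof.
move=> [Lp Ld [P aP pP]]; exists P; split=> //.
have LP : L2 P by apply: ae_eq_L2 pP Lp; exact: abscont_measurable aP.
set N := 2 * (Num.sqrt (\int[mu]_x (P x ^+ 2)) * Num.sqrt (\int[mu]_x (d x ^+ 2))).
exists (Num.sqrt N) => x; rewrite -sqrtr_sqr ler_wsqrtr//.
exact: abscont_sup.
Qed.

(** Products are computed on the continuous representative of p, which is bounded; hence
the term m' p is square integrable. *)
Lemma sobolevM m m' M p d : abscont m m' -> (forall x, `|m x| <= M) -> L2 m' ->
  sobolev p d -> sobolev (fun x => m x * p x) (fun x => m x * d x + m' x * p x).
Proof.
move=> am mM Lm' Hp; have [Lp Ld _] := Hp.
have [P [aP pP [N PN]]] := sobolev_bounded_rep Hp.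
have mm := abscont_measurable am.
have L1 : L2 (fun x => m x * d x + P x * m' x).
  apply: L2D; first exact: L2Mb Ld.
  by apply: L2Mb Lm'; [exact: abscont_measurable aP|exact: PN].
have mD : measurable_fun setT (fun x => m x * d x + m' x * p x).
  apply: measurable_funD; apply: measurable_funM => //.
  - by case: Ld.
  - by case: Lm'.
  - by case: Lp.
have DE : {ae mu, forall x, m x * d x + P x * m' x = m x * d x + m' x * p x}.
  by apply: ae_impl pP => x ->; rewrite mulrC [P x * _]mulrC mulrC.
split; [exact: L2Mb Lp|exact: ae_eq_L2 DE L1|].
exists (fun x => m x * P x); last by apply: ae_impl pP => x ->.
apply: (abscont_ae_density mD _ (abscontM am aP)).
by apply: ae_impl pP => x ->; ring.
Qed.

(** The chain rule for the bounded representatives P, Q.  The bound on the density m' has a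
finite constant because the partial derivatives of (u^2 + v^2)^s are bounded on bounded
sets when s > 1/2. *)
Lemma sobolev_powR s p dp q dq : 2^-1 < s -> sobolev p dp -> sobolev q dq ->
  exists P Q m' : R -> R, exists M C : R,
   [/\ {ae mu, forall x, p x = P x} /\ {ae mu, forall x, q x = Q x},
       measurable_fun setT P /\ measurable_fun setT Q,
       abscont (fun x => (P x ^+ 2 + Q x ^+ 2) `^ s) m' /\ L2 m',
       forall x, (P x ^+ 2 + Q x ^+ 2) `^ s <= M &
       0 <= C /\ forall x, `|m' x| <= C * (`|dp x| + `|dq x|)].
Proof.
move=> s2 Hp Hq; have [_ Ldp _] := Hp; have [_ Ldq _] := Hq.
have [P [aP pP [N1 PN]]] := sobolev_bounded_rep Hp.
have [Q [aQ qQ [N2 QN]]] := sobolev_bounded_rep Hq.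
have am := abscont_chain (C1_2_powR s2) aP aQ.
pose N := N1 ^+ 2 + N2 ^+ 2.
have sqle (r n : R) : `|r| <= n -> r ^+ 2 <= n ^+ 2.
  by move=> rn; rewrite -[r ^+ 2]real_normK ?num_real// lerXn2r ?nnegrE// (le_trans _ rn).
have qN x : P x ^+ 2 + Q x ^+ 2 <= N by apply: lerD; exact: sqle.
have q0 x : 0 <= P x ^+ 2 + Q x ^+ 2 by rewrite addr_ge0// sqr_ge0.
have N0 : 0 <= N by rewrite addr_ge0 ?sqr_ge0.
pose C := 2 * s * N `^ (s - 2^-1).
have C0 : 0 <= C by rewrite !mulr_ge0 ?powR_ge0//; lra.
set m := (X in abscont X _) in am; set m' := (X in abscont _ X) in am.
have m'C x : `|m' x| <= C * (`|dp x| + `|dq x|).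
  have part a b : a ^+ 2 + b ^+ 2 <= N ->
      `|2 * s * (a * (a ^+ 2 + b ^+ 2) `^ (s - 1))| <= C.
    move=> abN; rewrite !normrM (ger0_norm (powR_ge0 _ _)).
    rewrite (ger0_norm (ler0n _ 2)) (ger0_norm (_ : 0 <= s)); last lra.
    rewrite /C ler_wpM2l//; first lra.
    apply: le_trans (mul_powR_le a b s2) _.
    have sp : 0 <= s - 2^-1 by lra.
    by apply: (ge0_ler_powR sp) => //; rewrite nnegrE// addr_ge0 ?sqr_ge0.
  rewrite /m'; apply: le_trans (ler_normD _ _) _; rewrite mulrDr.
  apply: lerD; rewrite normrM ler_wpM2r//; first exact: part.
  by rewrite [P x ^+ 2 + _]addrC; apply: part; rewrite addrC.
exists P, Q, m', (N `^ s), C; split => //.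
- by split; [exact: abscont_measurable aP|exact: abscont_measurable aQ].
- split=> //; have mm' : measurable_fun setT m' by exact: am.1.1.
  have L1 : L2 (fun x => C * (`|dp x| + `|dq x|)) by apply/L2Z/L2D; exact: L2_norm.
  split=> //; apply: (@itg_le _ _ _ (fun x => (C * (`|dp x| + `|dq x|)) ^+ 2)) => //.
  + exact: measurable_funX.
  + by move=> x _; rewrite ger0_norm ?sqr_ge0//; exact: sqle.
  + exact: L1.2.
- move=> x; have s0 : 0 <= s by lra.
  by apply: (ge0_ler_powR s0) => //; rewrite nnegrE.
Qed.
End ModulusPower.

(** * Complex Sobolev functions *)

Section ComplexSobolev.
Context {R : realType}.
Local Notation mu := (@lebesgue_measure R).
Local Notation C := R[i].
Local Notation re := (@complex.Re R).
Local Notation im := (@complex.Im R).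
Implicit Types (f g h : R -> C) (z w : C) (c : R).

Lemma reD z w : re (z + w) = re z + re w. Proof. by case: z; case: w. Qed.
Lemma imD z w : im (z + w) = im z + im w. Proof. by case: z; case: w. Qed.
Lemma reN z : re (- z) = - re z. Proof. by case: z. Qed.
Lemma imN z : im (- z) = - im z. Proof. by case: z. Qed.
Lemma reM z w : re (z * w) = re z * re w - im z * im w.
Proof. by case: z; case: w. Qed.
Lemma imM z w : im (z * w) = re z * im w + im z * re w.
Proof. by case: z => a b; case: w => c d /=; ring. Qed.
Lemma re_real c : re c%:C = c. Proof. by []. Qed.
Lemma im_real c : im c%:C = 0. Proof. by []. Qed.
Lemma re_conj z : re z^*%C = re z. Proof. by case: z. Qed.
Lemma im_conj z : im z^*%C = - im z. Proof. by case: z. Qed.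

Lemma re_iM z : re ('i%C * z) = - im z.
Proof. by case: z => a b /=; rewrite mul0r mul1r sub0r. Qed.
Lemma im_iM z : im ('i%C * z) = re z.
Proof. by case: z => a b /=; rewrite mul0r mul1r add0r. Qed.

Definition reimE := (re_iM, im_iM, reD, imD, reN, imN, reM, imM, re_conj, im_conj,
  re_real, im_real).

Lemma complex_eq z w : re z = re w -> im z = im w -> z = w.
Proof. by case: z => a b; case: w => c d /= -> ->. Qed.

Lemma normc_sqr z : normc z ^+ 2 = re z ^+ 2 + im z ^+ 2.
Proof. by case: z => a b; rewrite /= sqr_sqrtr// addr_ge0 ?sqr_ge0. Qed.

Lemma normc_ge0 z : 0 <= normc z.
Proof. by case: z => a b; exact: sqrtr_ge0. Qed.

Lemma normc_sqrt z : normc z = Num.sqrt (re z ^+ 2 + im z ^+ 2).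
Proof. by case: z. Qed.

Lemma re_le_normc z : `|re z| <= normc z.
Proof. by rewrite normc_sqrt -sqrtr_sqr ler_wsqrtr// lerDl sqr_ge0. Qed.

Lemma im_le_normc z : `|im z| <= normc z.
Proof. by rewrite normc_sqrt -sqrtr_sqr ler_wsqrtr// lerDr sqr_ge0. Qed.

Definition L2c f := L2 (fun x => re (f x)) /\ L2 (fun x => im (f x)).

(** The real part of the complex inner product.  The equation is only real-linear, so all
energy computations use this real form. *)
Definition ip f g := \int[mu]_x (re (f x) * re (g x) + im (f x) * im (g x)).

Lemma L2c_itg f g : L2c f -> L2c g ->
  itg setT (fun x => re (f x) * re (g x) + im (f x) * im (g x)).
Proof. by move=> [f1 f2] [g1 g2]; apply: itgD => //; exact: L2_itgM. Qed.

Lemma L2cD f g : L2c f -> L2c g -> L2c (fun x => f x + g x).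
Proof.
move=> [f1 f2] [g1 g2]; split.
  by under eq_fun do rewrite reD; exact: L2D.
by under eq_fun do rewrite imD; exact: L2D.
Qed.

Lemma L2cN f : L2c f -> L2c (fun x => - f x).
Proof.
move=> [f1 f2]; split.
  by under eq_fun do rewrite reN; exact: L2N.
by under eq_fun do rewrite imN; exact: L2N.
Qed.

Lemma L2cB f g : L2c f -> L2c g -> L2c (fun x => f x - g x).
Proof. by move=> Lf Lg; apply: L2cD => //; exact: L2cN. Qed.

Lemma L2cM (b f : R -> C) (M : R) : measurable_fun setT (fun x => re (b x)) ->
  measurable_fun setT (fun x => im (b x)) ->
  (forall x, normc (b x) <= M) -> L2c f -> L2c (fun x => b x * f x).
Proof.
move=> m1 m2 bM [f1 f2].
have b1 x : `|re (b x)| <= M by exact: le_trans (re_le_normc _) (bM x).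
have b2 x : `|im (b x)| <= M by exact: le_trans (im_le_normc _) (bM x).
split.
  under eq_fun do rewrite reM; apply: L2B; first exact: L2Mb f1.
  exact: L2Mb f2.
under eq_fun do rewrite imM; apply: L2D; first exact: L2Mb f2.
exact: L2Mb f1.
Qed.

Lemma L2cR (b : R -> R) f (M : R) : measurable_fun setT b ->
  (forall x, `|b x| <= M) -> L2c f -> L2c (fun x => (b x)%:C * f x).
Proof.
move=> mb bM; apply: (@L2cM (fun x => (b x)%:C) _ M) => //.
by move=> x; rewrite normc_sqrt /= expr0n addr0 sqrtr_sqr.
Qed.

Lemma L2cZ (k : C) f : L2c f -> L2c (fun x => k * f x).
Proof. by apply: (@L2cM (fun=> k) f (normc k)) => //; exact: measurable_cst. Qed.

Lemma L2c_conj f : L2c f -> L2c (fun x => (f x)^*%C).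
Proof.
move=> [f1 f2]; split; first by under eq_fun do rewrite re_conj.
by under eq_fun do rewrite im_conj; exact: L2N.
Qed.

Lemma measurable_normc f : measurable_fun setT (fun x => re (f x)) ->
  measurable_fun setT (fun x => im (f x)) ->
  measurable_fun setT (fun x => normc (f x)).
Proof.
move=> m1 m2; under eq_fun do rewrite normc_sqrt.
apply: (@measurableT_comp _ _ _ _ _ _ (@Num.sqrt R)).
  by apply: continuous_measurable_fun; exact: sqrt_continuous.
by apply: measurable_funD; exact: measurable_funX.
Qed.

(** |f|^2 is integrable exactly when the squares of the real and imaginary parts are. *)
Lemma Lp2P f : Lp 2%:E f <-> L2c f.
Proof.
split=> [[m1 m2 fn]|[[m1 i1] [m2 i2]]].
  have : (fun x => normc (f x)) \in Lfun mu 2%:E.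
    by rewrite inE; apply/andP; split; rewrite inE //=; exact: measurable_normc.
  move=> /Lfun2_integrable_sqr i12.
  split; split=> //.
    apply: (itg_le _ _ _ i12) => //; first exact: measurable_funX.
    by move=> x _; rewrite ger0_norm ?sqr_ge0// normc_sqr lerDl sqr_ge0.
  apply: (itg_le _ _ _ i12) => //; first exact: measurable_funX.
  by move=> x _; rewrite ger0_norm ?sqr_ge0// normc_sqr lerDr sqr_ge0.
split=> //; rewrite /finite_norm unlock /Lnorm poweR_lty//.
have /integrableP[_] := itgD measurableT i1 i2.
apply: le_lt_trans; rewrite le_eqVlt; apply/orP; left; apply/eqP.
apply: eq_integral => x _ /=; rewrite powR_mulrn//.
by rewrite real_normK ?num_real// normc_sqr ger0_norm// addr_ge0 ?sqr_ge0.
Qed.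

Lemma ip_ge0 f : 0 <= ip f f.
Proof. by apply: Rintegral_ge0 => x _; rewrite -!expr2 addr_ge0 ?sqr_ge0. Qed.

Lemma norm2E f : L2c f -> norm2 f = Num.sqrt (ip f f).
Proof.
move=> [[m1 i1] [m2 i2]]; rewrite /norm2 unlock /Lnorm.
have -> : (\int[mu]_x (`|(normc (f x))%:E| `^ 2)%E = (ip f f)%:E)%E.
  rewrite /ip /Rintegral fineK; last first.
    by apply: integrable_fin_num => //; apply: L2c_itg; split.
  apply: eq_integral => x _ /=; rewrite powR_mulrn//.
  by rewrite real_normK ?num_real// normc_sqr -!expr2.
by rewrite poweR_EFin /= powR12_sqrt// ip_ge0.
Qed.

Lemma norm2_sqr f : L2c f -> norm2 f ^+ 2 = ip f f.
Proof. by move=> Lf; rewrite norm2E// sqr_sqrtr// ip_ge0. Qed.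

Lemma norm2_ge0 f : L2c f -> 0 <= norm2 f.
Proof. by move=> Lf; rewrite norm2E// sqrtr_ge0. Qed.

Lemma ip_ae f g f' g' : L2c f -> L2c g -> L2c f' -> L2c g' ->
  {ae mu, forall x, f x = f' x} -> {ae mu, forall x, g x = g' x} ->
  ip f g = ip f' g'.
Proof.
move=> Lf Lg Lf' Lg' ff' gg'; apply: ae_eq_Rintegral => //.
- exact: itg_measurable (L2c_itg Lf Lg).
- exact: itg_measurable (L2c_itg Lf' Lg').
- by apply: ae_impl2 ff' gg' => x -> ->.
Qed.

Lemma ipC f g : ip f g = ip g f.
Proof. by apply: eq_Rintegral => x _; rewrite mulrC [im _ * _]mulrC. Qed.

Lemma ipDl f g h : L2c f -> L2c g -> L2c h ->
  ip (fun x => f x + g x) h = ip f h + ip g h.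
Proof.
move=> Lf Lg Lh; rewrite /ip -RintegralD//; try exact: L2c_itg.
by apply: eq_Rintegral => x _; rewrite !reimE; ring.
Qed.

Lemma ipBl f g h : L2c f -> L2c g -> L2c h ->
  ip (fun x => f x - g x) h = ip f h - ip g h.
Proof.
move=> Lf Lg Lh; rewrite /ip -RintegralB//; try exact: L2c_itg.
by apply: eq_Rintegral => x _; rewrite !reimE; ring.
Qed.

Lemma ipDr f g h : L2c f -> L2c g -> L2c h ->
  ip f (fun x => g x + h x) = ip f g + ip f h.
Proof. by move=> Lf Lg Lh; rewrite ipC ipDl// ipC [ip h f]ipC. Qed.

Lemma ipBr f g h : L2c f -> L2c g -> L2c h ->
  ip f (fun x => g x - h x) = ip f g - ip f h.
Proof. by move=> Lf Lg Lh; rewrite ipC ipBl// ipC [ip h f]ipC. Qed.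

Lemma ipZl c f g : L2c f -> L2c g -> ip (fun x => c%:C * f x) g = c * ip f g.
Proof.
move=> Lf Lg; rewrite /ip -RintegralZl//; last exact: L2c_itg.
by apply: eq_Rintegral => x _; rewrite !reimE; ring.
Qed.

Lemma ipNl f g : L2c f -> L2c g -> ip (fun x => - f x) g = - ip f g.
Proof.
move=> Lf Lg; rewrite -mulN1r -ipZl//.
by apply: eq_Rintegral => x _; rewrite !reimE; ring.
Qed.

Lemma ip_il f g : L2c f -> L2c g ->
  ip (fun x => 'i%C * f x) g = - ip f (fun x => 'i%C * g x).
Proof.
move=> Lf Lg; rewrite -ipNl//; last exact: L2cZ.
by apply: eq_Rintegral => x _; rewrite !reimE; ring.
Qed.

Lemma ip_ii f g : ip (fun x => 'i%C * f x) (fun x => 'i%C * g x) = ip f g.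
Proof. by apply: eq_Rintegral => x _; rewrite !reimE; ring. Qed.

Lemma ip_i_self f : ip f (fun x => 'i%C * f x) = 0.
Proof.
rewrite /ip (@eq_Rintegral _ _ _ _ _ (fun=> 0)).
  by rewrite Rintegral_cst// mul0r.
by move=> x _; rewrite !reimE; ring.
Qed.

Lemma ip_realM (m : R -> R) f g :
  ip (fun x => (m x)%:C * f x) g = ip f (fun x => (m x)%:C * g x).
Proof. by apply: eq_Rintegral => x _; rewrite !reimE; ring. Qed.

Lemma ip_CS f g : L2c f -> L2c g -> `|ip f g| <= norm2 f * norm2 g.
Proof.
move=> Lf Lg; rewrite !norm2E//.
set A := ip f f; set Cc := ip g g; set B := ip f g.
have A0 : 0 <= A by exact: ip_ge0.
have C0 : 0 <= Cc by exact: ip_ge0.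
rewrite -sqrtrM// -sqrtr_sqr ler_wsqrtr//.
have H t : 0 <= A - 2 * t * B + t ^+ 2 * Cc.
  have Ltg : L2c (fun x => t%:C * g x) by exact: L2cZ.
  have -> : A - 2 * t * B + t ^+ 2 * Cc =
     ip (fun x => f x - t%:C * g x) (fun x => f x - t%:C * g x).
    rewrite ipBl ?ipBr// ?ipZl// ?(ipC _ (fun x => t%:C * g x)) ?ipZl//; last exact: L2cB.
    by rewrite (ipC g f) -/A -/B -/Cc; ring.
  exact: ip_ge0.
have [C00|Cn0] := eqVneq Cc 0.
  have [->|Bn0] := eqVneq B 0; first by rewrite expr0n mulr_ge0.
  have := H ((A + 1) / (2 * B)); rewrite C00 mulr0 addr0.
  have -> : A - 2 * ((A + 1) / (2 * B)) * B = -1 by field.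
  by rewrite ler0N1.
have Cp : 0 < Cc by rewrite lt_def Cn0.
have := H (B / Cc).
have -> : A - 2 * (B / Cc) * B + (B / Cc) ^+ 2 * Cc = (A * Cc - B ^+ 2) / Cc by field.
by rewrite pmulr_lge0 ?invr_gt0// subr_ge0.
Qed.

(** The imaginary part is recovered by testing against i g. *)
Lemma dual_ofE f g : dual_of f g = ip f g +i* ip f (fun x => 'i%C * g x).
Proof.
by congr (_ +i* _); apply: eq_Rintegral => x _; rewrite !reimE; ring.
Qed.

(** Weak derivatives are tested against real functions, so they act separately on the real
and the imaginary part. *)
Definition csobolev f g :=
  sobolev (fun x => re (f x)) (fun x => re (g x)) /\
  sobolev (fun x => im (f x)) (fun x => im (g x)).

Lemma weak_derivativeP f g : weak_derivative f g <->
  rweak_derivative (fun x => re (f x)) (fun x => re (g x)) /\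
  rweak_derivative (fun x => im (f x)) (fun x => im (g x)).
Proof.
have E h (t : R -> R) : cint (fun x => h x * (t x)%:C) =
   (\int[mu]_x (re (h x) * t x)) +i* (\int[mu]_x (im (h x) * t x)).
  congr (_ +i* _); apply: eq_Rintegral => x _; rewrite !reimE; ring.
split=> [H|[H1 H2]].
  by split=> th /H; rewrite !E => -[].
by move=> th tth; rewrite !E H1// H2.
Qed.

Lemma csobolevP f g : csobolev f g <-> [/\ L2c f, L2c g & weak_derivative f g].
Proof.
split=> [[/sobolevP[L1 L2 H1] /sobolevP[L3 L4 H2]]|[[L1 L2] [L3 L4]]].
  by split; [split|split|apply/weak_derivativeP; split].
by move=> /weak_derivativeP[H1 H2]; split; apply/sobolevP.
Qed.

Lemma H1_csobolev f : H1 f -> csobolev f (grad f).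
Proof.
move=> [Lf [g0 Hg]].
have := @xgetPex _ (fun=> 0) [set g | Lp 2%:E g /\ weak_derivative f g] (ex_intro _ g0 Hg).
rewrite -/(grad f) => -[Lg wd].
by apply/csobolevP; split=> //; apply/Lp2P.
Qed.

Lemma csobolev_H1 f g : csobolev f g -> H1 f.
Proof.
move=> /csobolevP[Lf Lg wd]; split; first exact/Lp2P.
by exists g; split=> //; exact/Lp2P.
Qed.

Lemma csobolev_unique f g d e : {ae mu, forall x, f x = g x} ->
  csobolev f d -> csobolev g e -> {ae mu, forall x, d x = e x}.
Proof.
move=> fg [H1 H2] [H3 H4].
have E1 : {ae mu, forall x, re (f x) = re (g x)} by apply: ae_impl fg => x ->.
have E2 : {ae mu, forall x, im (f x) = im (g x)} by apply: ae_impl fg => x ->.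
have := sobolev_unique E1 H1 H3; have := sobolev_unique E2 H2 H4.
by apply: ae_impl2 => x Eim Ere; exact: complex_eq.
Qed.

Lemma csobolev_grad f g : csobolev f g -> {ae mu, forall x, grad f x = g x}.
Proof.
move=> fg; apply: csobolev_unique (H1_csobolev (csobolev_H1 fg)) fg.
by apply: aeW.
Qed.

Lemma H1_L2c f : H1 f -> L2c f.
Proof. by case=> /Lp2P. Qed.

Lemma grad_L2c f : H1 f -> L2c (grad f).
Proof. by move=> /H1_csobolev /csobolevP[]. Qed.

Lemma csobolevD f df g dg : csobolev f df -> csobolev g dg ->
  csobolev (fun x => f x + g x) (fun x => df x + dg x).
Proof.
move=> [H1 H2] [H3 H4]; split.
  have := sobolevD H1 H3.
  by congr sobolev; apply/funext => x; rewrite reD.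
have := sobolevD H2 H4.
by congr sobolev; apply/funext => x; rewrite imD.
Qed.

Lemma csobolevN f df : csobolev f df ->
  csobolev (fun x => - f x) (fun x => - df x).
Proof.
move=> [H1 H2]; split.
  have := sobolevN H1.
  by congr sobolev; apply/funext => x; rewrite reN.
have := sobolevN H2.
by congr sobolev; apply/funext => x; rewrite imN.
Qed.

Lemma csobolevB f df g dg : csobolev f df -> csobolev g dg ->
  csobolev (fun x => f x - g x) (fun x => df x - dg x).
Proof. by move=> Hf Hg; apply: csobolevD => //; exact: csobolevN. Qed.

Lemma csobolev_i f df : csobolev f df ->
  csobolev (fun x => 'i%C * f x) (fun x => 'i%C * df x).
Proof.
move=> [H1 H2]; split.
  have := sobolevN H2.
  by congr sobolev; apply/funext => x; rewrite !reimE; ring.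
move: H1; congr sobolev; apply/funext => x; rewrite !reimE; ring.
Qed.

Lemma csobolev_conj f df : csobolev f df ->
  csobolev (fun x => (f x)^*%C) (fun x => (df x)^*%C).
Proof.
move=> [H1 H2]; split.
  by move: H1; congr sobolev; apply/funext => x; rewrite re_conj.
have := sobolevN H2.
by congr sobolev; apply/funext => x; rewrite im_conj.
Qed.

Lemma csobolevM (m m' : R -> R) M f df : abscont m m' ->
  (forall x, `|m x| <= M) -> L2 m' -> csobolev f df ->
  csobolev (fun x => (m x)%:C * f x) (fun x => (m x)%:C * df x + (m' x)%:C * f x).
Proof.
move=> am mM Lm' [H1 H2]; split.
  have := sobolevM am mM Lm' H1.
  by congr sobolev; apply/funext => x; rewrite !reimE; ring.
have := sobolevM am mM Lm' H2.
by congr sobolev; apply/funext => x; rewrite !reimE; ring.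
Qed.

Lemma normH1_ge0 f : 0 <= normH1 f. Proof. exact: sqrtr_ge0. Qed.

Lemma norm2_le_normH1 f : H1 f -> norm2 f <= normH1 f.
Proof.
move=> Hf; rewrite norm2E; last exact: H1_L2c.
rewrite /normH1 ler_wsqrtr// norm2_sqr; last exact: H1_L2c.
by rewrite lerDl sqr_ge0.
Qed.

Lemma norm2_grad_le_normH1 f : H1 f -> norm2 (grad f) <= normH1 f.
Proof.
move=> Hf; rewrite norm2E; last exact: grad_L2c.
rewrite /normH1 ler_wsqrtr// (norm2_sqr (grad_L2c Hf)).
by rewrite lerDr sqr_ge0.
Qed.

Lemma normH1_le f A B : H1 f -> norm2 f <= A -> norm2 (grad f) <= B ->
  normH1 f <= A + B.
Proof.
move=> Hf fA gB.
have f0 := norm2_ge0 (H1_L2c Hf); have g0 := norm2_ge0 (grad_L2c Hf).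
have AB : 0 <= A + B by lra.
rewrite -[leRHS]ger0_norm// -sqrtr_sqr ler_wsqrtr//; nra.
Qed.

Lemma normH1_csobolev f g : csobolev f g ->
  normH1 f = Num.sqrt (ip f f + ip g g).
Proof.
move=> fg; have Hf := csobolev_H1 fg; have /csobolevP[Lf Lg _] := fg.
rewrite /normH1 !norm2_sqr//; last exact: grad_L2c.
have Lgf := grad_L2c Hf; have E := csobolev_grad fg.
by rewrite (ip_ae Lgf Lgf Lg Lg E E).
Qed.

(** The sup bounds of the real and the imaginary part, added. *)
Lemma H1_sup f : H1 f -> {ae mu, forall x,
  re (f x) ^+ 2 + im (f x) ^+ 2 <= 4 * (norm2 f * norm2 (grad f))}.
Proof.
move=> Hf; have [S1 S2] := H1_csobolev Hf.
have Lf := H1_L2c Hf; have Lg := grad_L2c Hf.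
have part (p d : R -> R) A B : 0 <= B -> \int[mu]_x (p x ^+ 2) <= A -> \int[mu]_x (d x ^+ 2) <= B ->
   Num.sqrt (\int[mu]_x (p x ^+ 2)) * Num.sqrt (\int[mu]_x (d x ^+ 2)) <= Num.sqrt A * Num.sqrt B.
  by move=> B0 pA dB; rewrite ler_pM ?sqrtr_ge0// ler_wsqrtr.
have rle h : L2c h -> \int[mu]_x (re (h x) ^+ 2) <= ip h h.
  move=> Lh; apply: le_Rintegral => //; [by case: Lh => -[]|exact: L2c_itg|].
  by move=> x _; rewrite -!expr2 lerDl sqr_ge0.
have ile h : L2c h -> \int[mu]_x (im (h x) ^+ 2) <= ip h h.
  move=> Lh; apply: le_Rintegral => //; [by case: Lh => _ []|exact: L2c_itg|].
  by move=> x _; rewrite -!expr2 lerDr sqr_ge0.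
have := sobolev_sup S1; have := sobolev_sup S2.
apply: ae_impl2 => x X2 X1; rewrite !norm2E//.
have Y1 := part _ _ _ _ (ip_ge0 _) (rle _ Lf) (rle _ Lg).
have Y2 := part _ _ _ _ (ip_ge0 _) (ile _ Lf) (ile _ Lg).
lra.
Qed.

Lemma grad_ae_eq f g : H1 f -> H1 g -> {ae mu, forall x, f x = g x} ->
  {ae mu, forall x, grad f x = grad g x}.
Proof. by move=> Hf Hg fg; apply: csobolev_unique fg _ _; exact: H1_csobolev. Qed.

End ComplexSobolev.

(** * Curves in H^1 driven by a Schroedinger equation *)

Section Evolution.
Context {R : realType}.
Local Notation mu := (@lebesgue_measure R).
Local Notation C := R[i].
Local Notation re := (@complex.Re R).
Local Notation im := (@complex.Im R).
Implicit Types (f g : R -> C) (s t e : R) (u v : R -> R -> C) (l : (R -> C) -> R).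

Lemma H1_i f : H1 f -> H1 (fun x => 'i%C * f x).
Proof. by move=> /H1_csobolev/csobolev_i/csobolev_H1. Qed.

Lemma H1_conj f : H1 f -> H1 (fun x => (f x)^*%C).
Proof. by move=> /H1_csobolev/csobolev_conj/csobolev_H1. Qed.

Lemma H1B f g : H1 f -> H1 g -> H1 (fun x => f x - g x).
Proof. by move=> /H1_csobolev Hf /H1_csobolev Hg; exact: csobolev_H1 (csobolevB Hf Hg). Qed.

Lemma grad_i f : H1 f -> {ae mu, forall x, grad (fun x => 'i%C * f x) x = 'i%C * grad f x}.
Proof. by move=> /H1_csobolev/csobolev_i/csobolev_grad. Qed.

Lemma normH1_i f : H1 f -> normH1 (fun x => 'i%C * f x) = normH1 f.
Proof.
move=> /H1_csobolev Hf; rewrite (normH1_csobolev (csobolev_i Hf)).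
by rewrite !ip_ii (normH1_csobolev Hf).
Qed.

Lemma normH1_conj f : H1 f -> normH1 (fun x => (f x)^*%C) = normH1 f.
Proof.
move=> /H1_csobolev Hf; rewrite (normH1_csobolev (csobolev_conj Hf)).
rewrite (normH1_csobolev Hf); congr (Num.sqrt (_ + _));
  by apply: eq_Rintegral => x _; rewrite !reimE; ring.
Qed.

(** The regularity of a solution at a time: continuous in H^1, differentiable in H^-1 with
derivative the real functional l.  Only real parts of pairings are recorded. *)
Definition curve_at u s l :=
  [/\ H1 (u s),
      forall e, 0 < e -> exists2 eta : R, 0 < eta & forall t, `|t - s| < eta ->
        H1 (u t) /\ normH1 (fun x => u t x - u s x) <= e,
      (exists2 K : R, 0 <= K & forall z, H1 z -> `|l z| <= K * normH1 z) &
      forall e, 0 < e -> exists2 eta : R, 0 < eta & forall t, `|t - s| < eta ->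
        forall z, H1 z ->
          `|ip (fun x => u t x - u s x) z - (t - s) * l z| <= e * `|t - s| * normH1 z].

Lemma curve_at_i u s l : curve_at u s l ->
  curve_at (fun t x => 'i%C * u t x) s (fun z => - l (fun x => 'i%C * z x)).
Proof.
move=> [Hs cont [K K0 bnd] slope].
have subE t : (fun x => 'i%C * u t x - 'i%C * u s x) = (fun x => 'i%C * (u t x - u s x)).
  by apply/funext => x; rewrite mulrBr.
split.
- exact: H1_i.
- move=> e e0; have [eta eta0 H] := cont e e0; exists eta; first exact: eta0.
  move=> t /H[Ht He]; by split; [exact: H1_i|rewrite subE normH1_i//; exact: H1B].
- exists K => // z Hz; rewrite normrN -(normH1_i Hz); apply: bnd; exact: H1_i.
- move=> e e0; have [eta1 eta10 H1'] := slope e e0.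
  have [eta2 eta20 H2] := cont _ ltr01.
  exists (Num.min eta1 eta2); first by rewrite lt_min eta10.
  move=> t; rewrite lt_min => /andP[t1 t2] z Hz.
  have [Ht _] := H2 t t2.
  rewrite subE ip_il; [|exact/H1_L2c/H1B|exact: H1_L2c].
  rewrite mulrN opprK addrC -normrN opprD opprK addrC -(normH1_i Hz).
  exact: H1' (H1_i Hz).
Qed.

Lemma curve_at_shift u s h l : curve_at u (s + h) l ->
  curve_at (fun t => u (t + h)) s l.
Proof.
move=> [Hs cont bnd slope]; split=> //.
  move=> e /cont[eta eta0 H]; exists eta; first exact: eta0.
  move=> t ts; apply: H.
  by rewrite (_ : t + h - (s + h) = t - s)//; ring.
move=> e /slope[eta eta0 H]; exists eta; first exact: eta0.
move=> t ts z Hz.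
have E : t + h - (s + h) = t - s by ring.
by have := H (t + h); rewrite E => /(_ ts z Hz).
Qed.

Lemma curve_atM (m : R -> R) (M K0 : R) u s l : measurable_fun setT m ->
  (forall x, `|m x| <= M) -> 0 <= K0 ->
  (forall z, H1 z -> H1 (fun x => (m x)%:C * z x) /\
     normH1 (fun x => (m x)%:C * z x) <= K0 * normH1 z) ->
  curve_at u s l ->
  curve_at (fun t x => (m x)%:C * u t x) s (fun z => l (fun x => (m x)%:C * z x)).
Proof.
move=> mm mM K00 Hm [Hs cont [K Kge0 bnd] slope].
have subE t : (fun x => (m x)%:C * u t x - (m x)%:C * u s x) =
    (fun x => (m x)%:C * (u t x - u s x)).
  by apply/funext => x; rewrite mulrBr.
have K1 : 0 < K0 + 1 by lra.
split.
- exact: (Hm _ Hs).1.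
- move=> e e0; have eK : 0 < e / (K0 + 1) by rewrite divr_gt0.
  have [eta eta0 H] := cont _ eK; exists eta; first exact: eta0.
  move=> t /H[Ht He].
  split; first exact: (Hm _ Ht).1.
  rewrite subE; apply: le_trans (Hm _ (H1B Ht Hs)).2 _.
  apply: le_trans (ler_wpM2l K00 He) _.
  by rewrite mulrCA ler_piMr ?(ltW e0)// ler_pdivrMr//; lra.
- exists (K * K0); first exact: mulr_ge0.
  move=> z Hz; apply: le_trans (bnd _ (Hm _ Hz).1) _.
  by rewrite -mulrA ler_wpM2l// (Hm _ Hz).2.
- move=> e e0; have eK : 0 < e / (K0 + 1) by rewrite divr_gt0.
  have [eta eta0 H] := slope _ eK.
  exists eta; first exact: eta0.
  move=> t ts z Hz; rewrite subE ip_realM; apply: le_trans (H t ts _ (Hm _ Hz).1) _.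
  apply: (@le_trans _ _ (e / (K0 + 1) * `|t - s| * (K0 * normH1 z))).
    by apply: (ler_wpM2l _ (Hm _ Hz).2); rewrite mulr_ge0// ltW.
  rewrite (_ : _ * _ * _ = e * `|t - s| * normH1 z * (K0 / (K0 + 1))); last by ring.
  rewrite ler_piMr ?mulr_ge0 ?(ltW e0) ?normH1_ge0//.
  by rewrite ler_pdivrMr//; lra.
Qed.

Lemma pairing_le (I L d n K q : R) : 0 <= K -> `|I - d * L| <= 1 * `|d| * n ->
  `|L| <= K * n -> n <= q -> `|I| <= (K + 1) * `|d| * q.
Proof.
move=> K0 H1 H2 nq.
have : `|I| <= `|I - d * L| + `|d| * `|L|.
  by rewrite -normrM -{1}[I](subrK (d * L)); exact: ler_normD.
move=> T1; apply: le_trans T1 _.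
have d0 := normr_ge0 d.
have T3 := ler_wpM2l d0 H2.
have K1 : 0 <= (K + 1) * `|d| by rewrite mulr_ge0// addr_ge0.
have T4 := ler_wpM2l K1 nq; lra.
Qed.

(** The product rule.  The increment is
<u(t) - u(s), v(t)> + <u(s), v(t) - v(s)>; the slope in H^-1 applies to both terms, and
the H^1 continuity of v moves the first one to time s. *)
Lemma curve_at_ip u v s lu lv : curve_at u s lu -> curve_at v s lv ->
  has_slope (fun t => ip (u t) (v t)) s (lu (v s) + lv (u s)).
Proof.
move=> [Hu cu [K K0 bu] su] [Hv cv _ sv] e e0.
set A := normH1 (v s); set B := normH1 (u s).
have A0 : 0 <= A by exact: normH1_ge0. have B0 : 0 <= B by exact: normH1_ge0.
pose D := A + B + K + 2.
have D0 : 0 < D by rewrite /D; lra.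
have eD : 0 < e / D by rewrite divr_gt0.
have [n1 n10 N1] := su _ eD.
have [n2 n20 N2] := sv _ eD.
have [n3 n30 N3] := cu _ ltr01.
have [n4 n40 N4] := cv _ eD.
have [n5 n50 N5] := su _ ltr01.
exists (Num.min n1 (Num.min n2 (Num.min n3 (Num.min n4 n5)))).
  by rewrite !lt_min n10 n20 n30 n40 n50.
move=> t; rewrite !lt_min => /and5P[t1 t2 t3 t4 t5].
have [Hut _] := N3 _ t3.
have [Hvt Hdv] := N4 _ t4.
have Hdu := H1B Hut Hu. have Hdv' := H1B Hvt Hv.
have S1 := N1 t t1 _ Hv; have S2 := N2 t t2 _ Hu; have S5 := N5 t t5 _ Hdv'.
have Lu := H1_L2c Hu; have Lv := H1_L2c Hv; have Lut := H1_L2c Hut; have Lvt := H1_L2c Hvt.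
have Ldu := H1_L2c Hdu; have Ldv := H1_L2c Hdv'.
set du := fun x => u t x - u s x in S1 S5 Ldu.
set dv := fun x => v t x - v s x in S2 S5 Ldv Hdv Hdv'.
have E1 : ip (u t) (v t) - ip (u s) (v s) = ip du (v s) + ip dv (u s) + ip du dv.
  rewrite /dv (ipBr Ldu Lvt Lv) /du !ipBl// (ipC (v t)) (ipC (v s)); ring.
have S5' : `|ip du dv| <= (K + 1) * `|t - s| * (e / D).
  exact: pairing_le K0 S5 (bu _ Hdv') Hdv.
rewrite E1.
rewrite (_ : _ - _ = (ip du (v s) - (t - s) * lu (v s)) + (ip dv (u s) - (t - s) * lv (u s))
   + ip du dv); last by ring.
apply: le_trans (ler_normD _ _) _; apply: le_trans (lerD (ler_normD _ _) (lexx _)) _.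
apply: le_trans (lerD (lerD S1 S2) S5') _; rewrite -/A -/B.
have -> : e / D * `|t - s| * A + e / D * `|t - s| * B + (K + 1) * `|t - s| * (e / D) =
   (A + B + K + 1) / D * (e * `|t - s|) by ring.
apply: ler_piMl; first by rewrite mulr_ge0 ?(ltW e0).
by rewrite ler_pdivrMr// mul1r /D lerD2l ler1n.
Qed.

(** The bounded real-linear operators that occur in the equation satisfied by one component
of a conjugation symmetric pair. *)
Definition action (a : R -> R) (b : R -> C) f x : C :=
  (a x)%:C * f x + b x * (f x)^*%C.

Definition bounded_coef (a : R -> R) (b : R -> C) (M : R) :=
  [/\ measurable_fun setT a, measurable_fun setT (fun x => re (b x)),
      measurable_fun setT (fun x => im (b x)) &
      forall x, `|a x| <= M /\ normc (b x) <= M].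

Lemma action_L2c a b M f : bounded_coef a b M -> L2c f -> L2c (action a b f).
Proof.
move=> [ma mb1 mb2 bM] Lf; apply: L2cD.
  by apply: (L2cR ma) Lf => x; exact: (bM x).1.
by apply: (L2cM mb1 mb2) (L2c_conj Lf) => x; exact: (bM x).2.
Qed.

(** A real-linear operator of this kind is symmetric for the real inner product. *)
Lemma action_sym a b f g : ip (action a b f) g = ip (action a b g) f.
Proof. by apply: eq_Rintegral => x _; rewrite /action !reimE; ring. Qed.

Lemma norm2_le f g (k : R) : 0 <= k -> L2c f -> L2c g ->
  (forall x, normc (f x) <= k * normc (g x)) -> norm2 f <= k * norm2 g.
Proof.
move=> k0 Lf Lg fg; rewrite !norm2E// -{1}(ger0_norm k0) -sqrtr_sqr -sqrtrM ?sqr_ge0//.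
rewrite ler_wsqrtr// /ip -RintegralZl//; last exact: L2c_itg.
apply: le_Rintegral => //; [exact: L2c_itg| |].
  by apply: itgZ => //; exact: L2c_itg.
move=> x _; rewrite -!expr2 -!normc_sqr -exprMn lerXn2r ?nnegrE ?mulr_ge0 ?normc_ge0//.
Qed.

Lemma action_bound a b M f : bounded_coef a b M -> 0 <= M -> L2c f ->
  norm2 (action a b f) <= 2 * M * norm2 f.
Proof.
move=> bc M0 Lf; apply: norm2_le => //; [by rewrite mulr_ge0|exact: action_L2c bc Lf|].
move=> x; have [_ _ _ /(_ x)[aM bM]] := bc.
apply: le_trans (le_normcD _ _) _; rewrite !normcM.
have -> : normc (f x)^*%C = normc (f x).
  by rewrite !normc_sqrt re_conj im_conj sqrrN.
have -> : normc (a x)%:C = `|a x| by rewrite normc_sqrt /= expr0n addr0 sqrtr_sqr.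
have n0 := normc_ge0 (f x).
have := ler_wpM2r n0 aM; have := ler_wpM2r n0 bM; lra.
Qed.

Lemma action_ip_bound a b M f g : bounded_coef a b M -> 0 <= M -> L2c f -> L2c g ->
  `|ip (action a b f) g| <= 2 * M * norm2 f * norm2 g.
Proof.
move=> bc M0 Lf Lg; apply: le_trans (ip_CS (action_L2c bc Lf) Lg) _.
by rewrite ler_wpM2r ?norm2_ge0// (action_bound bc).
Qed.

Lemma actionB a b f g : action a b (fun x => f x - g x) =
  (fun x => action a b f x - action a b g x).
Proof.
by apply/funext => x; rewrite /action; apply: complex_eq; rewrite !reimE; ring.
Qed.

Lemma norm2_triangle f g : L2c f -> L2c g ->
  norm2 f <= norm2 g + norm2 (fun x => f x - g x).
Proof.
move=> Lf Lg; have Lh := L2cB Lf Lg; set h := fun x => _ in Lh *.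
have n0 := norm2_ge0 Lg; have h0 := norm2_ge0 Lh; have f0 := norm2_ge0 Lf.
rewrite -[leLHS]ger0_norm// -[leRHS]ger0_norm ?addr_ge0// -!sqrtr_sqr ler_wsqrtr//.
have -> : f = (fun x => g x + h x) by apply/funext => x; rewrite /h addrC subrK.
rewrite norm2_sqr; last exact: L2cD.
rewrite (ipDl Lg Lh (L2cD Lg Lh)) (ipDr Lg Lg Lh) (ipDr Lh Lg Lh).
have := ip_CS Lg Lh; move=> /ler_normlP[_ H].
have := norm2_sqr Lg; have := norm2_sqr Lh; rewrite (ipC h g) !expr2; nra.
Qed.

(** The slope in H^-1 of a solution of i w' = - w''/2 + a w + b conj w, that is the real part
of the pairing of - i H w with z. *)
Definition ham_slope (a : R -> R) (b : R -> C) (w z : R -> C) : R :=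
  2^-1 * ip (grad w) (fun x => 'i%C * grad z x) +
  ip (action a b w) (fun x => 'i%C * z x).

Lemma ham_slope_i a b w z M : bounded_coef a b M -> H1 w -> H1 z ->
  ham_slope a b w (fun x => 'i%C * z x) =
  - (2^-1 * ip (grad w) (grad z) + ip (action a b w) z).
Proof.
move=> bc Hw Hz; rewrite /ham_slope.
have Lw := grad_L2c Hw; have Lz := grad_L2c Hz.
have iiE (h : R -> C) : (fun x => 'i%C * ('i%C * h x)) = (fun x => - h x).
  by apply/funext => x; apply: complex_eq; rewrite !reimE.
rewrite iiE.
have giz : {ae mu, forall x, 'i%C * grad (fun x => 'i%C * z x) x = 'i%C * ('i%C * grad z x)}.
  by apply: ae_impl (grad_i Hz) => x ->.
rewrite (ip_ae Lw (L2cZ _ (grad_L2c (H1_i Hz))) Lw (L2cZ _ (L2cZ _ Lz)) (aeW _ (fun=> erefl)) giz).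
have Lz' := H1_L2c Hz; have La := action_L2c bc (H1_L2c Hw).
rewrite iiE !(ipC _ (fun x => - _)) !ipNl// (ipC z) (ipC (grad z)); ring.
Qed.

(** Formally the energy of i u' = L(t) u changes only through the time dependence of L,
but its gradient term is not differentiable along a curve that has a derivative in
H^-1 only.  The pairing G of u(t + h) with i u(t) avoids the difficulty: its slope in t
is <(L(t) - L(t + h)) u(t + h), u(t)>, in which the Laplacian cancels, while G = - h (energy)
+ o(h) as h tends to 0.  Integrating the slope over [t1, t2], dividing by h and letting h
tend to 0 gives the increment of the energy. *)
Lemma energy_slope (a : R -> R -> R) (b : R -> R -> C) (a' : R -> R) (b' : R -> C)
    u s (d M' : R) (M : R -> R) :
  0 < d -> 0 <= M' -> bounded_coef a' b' M' ->
  (forall t, `|t - s| < d -> bounded_coef (a t) (b t) (M t)) ->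
  (forall t, `|t - s| < d -> curve_at u t (ham_slope (a t) (b t) (u t))) ->
  (forall e, 0 < e -> exists2 eta : R, 0 < eta & forall t h, `|t - s| < eta ->
     0 < h -> h < eta -> forall x,
       `|a (t + h) x - a t x - h * a' x| <= e * h /\
       normc (b (t + h) x - b t x - h%:C * b' x) <= e * h) ->
  has_slope (fun t => 2^-1 * ip (grad (u t)) (grad (u t)) + ip (action (a t) (b t) (u t)) (u t))
    s (ip (action a' b' (u s)) (u s)).
Proof.
move=> d0 M'0 bc' bc cu coef e e0.
pose En t := 2^-1 * ip (grad (u t)) (grad (u t)) + ip (action (a t) (b t) (u t)) (u t).
rewrite -/En; set K := ip (action a' b' (u s)) (u s).
have ss : `|s - s| < d by rewrite subrr normr0.
have [Hs cont _ _] := cu s ss.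
pose B := norm2 (u s) + 1.
have ns0 : 0 <= norm2 (u s) by exact/norm2_ge0/H1_L2c.
have B0 : 0 < B by rewrite /B; lra.
pose D := 2 * B * B + 4 * M' * B + 1.
have MB : 0 <= M' * B by rewrite mulr_ge0// ltW.
have BB : 0 < B * B by exact: mulr_gt0.
have D0 : 0 < D by rewrite /D; nra.
have eD : 0 < e / D by rewrite divr_gt0.
have [n1 n10 N1] := coef _ eD.
pose e2 := Num.min 1 (e / D).
have e20 : 0 < e2 by rewrite /e2 lt_min ltr01.
have [n2 n20 N2] := cont _ e20.
pose eta := Num.min d (Num.min n1 n2).
have eta0 : 0 < eta by rewrite !lt_min d0 n10 n20.
have etaP t : `|t - s| < eta -> [/\ `|t - s| < d, `|t - s| < n1 & `|t - s| < n2].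
  by rewrite !lt_min => /and3P.
have near_u t : `|t - s| < eta -> [/\ H1 (u t), norm2 (u t) <= B &
    norm2 (fun x => u t x - u s x) <= e / D].
  move=> /etaP[_ _ /N2[Ht He]].
  have Hd := H1B Ht Hs.
  have le2 : norm2 (fun x => u t x - u s x) <= e2.
    exact: le_trans (norm2_le_normH1 Hd) He.
  have [e21 e2D] : e2 <= 1 /\ e2 <= e / D by rewrite /e2 !ge_min !lexx orbT.
  split=> //; last by exact: le_trans le2 e2D.
  by have := norm2_triangle (H1_L2c Ht) (H1_L2c Hs); rewrite /B; lra.
(* the pairing of u with its translate in time *)
pose G h t := ip (u (t + h)) (fun x => 'i%C * u t x).
have Gslope h t : 0 < h -> `|t - s| < eta -> `|t + h - s| < eta -> h < n1 ->
    has_slope (G h) t (- ip (fun x => action (a (t + h)) (b (t + h)) (u (t + h)) x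
                                      - action (a t) (b t) (u (t + h)) x) (u t)).
  move=> h0 t1 t2 hn.
  have [td _ _] := etaP _ t1; have [thd _ _] := etaP _ t2.
  have Hslope := curve_at_ip (curve_at_shift (cu _ thd)) (curve_at_i (cu _ td)).
  have [Ht _ _] := near_u _ t1; have [Hth _ _] := near_u _ t2.
  move: Hslope; rewrite (ham_slope_i (bc _ thd) Hth Ht).
  rewrite (ham_slope_i (bc _ td) Ht Hth).
  rewrite (action_sym (a t) (b t) (u t)) (ipC (grad (u t))).
  rewrite ipBl; [|exact: action_L2c (bc _ thd) (H1_L2c Hth)|exact: action_L2c (bc _ td) (H1_L2c Hth)|exact: H1_L2c].
  rewrite (_ : _ + - - _ = - (ip (action (a (t + h)) (b (t + h)) (u (t + h))) (u t) -
     ip (action (a t) (b t) (u (t + h))) (u t))) //; ring.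
have Gapprox h t : 0 < h -> `|t - s| < eta -> `|t + h - s| < eta -> h < n1 ->
    `|- ip (fun x => action (a (t + h)) (b (t + h)) (u (t + h)) x
             - action (a t) (b t) (u (t + h)) x) (u t) - - (h * K)| <= h * e.
  move=> h0 t1 t2 hn.
  have [td tn1 _] := etaP _ t1; have [thd _ _] := etaP _ t2.
  have [Ht Bt dt] := near_u _ t1; have [Hth Bth dth] := near_u _ t2.
  have Lt := H1_L2c Ht; have Lth := H1_L2c Hth; have Ls := H1_L2c Hs.
  set X := fun x => action (a (t + h)) _ _ x - _.
  have LX : L2c X by apply: L2cB; [exact: action_L2c (bc _ thd) Lth|exact: action_L2c (bc _ td) Lth].
  have LL w : L2c w -> L2c (action a' b' w) by exact: action_L2c bc'.
  pose Y x := X x - h%:C * action a' b' (u (t + h)) x.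
  have LY : L2c Y by apply: L2cB => //; exact/L2cZ/LL.
  have XE : ip X (u t) = ip Y (u t) + h * ip (action a' b' (u (t + h))) (u t).
    by rewrite /Y (ipBl LX (L2cZ _ (LL _ Lth)) Lt) (ipZl _ (LL _ Lth) Lt) subrK.
  have Q : 0 <= 2 * (e / D) * h.
    by apply: mulr_ge0; [apply: mulr_ge0 => //; exact: ltW|exact: ltW].
  have Ybound : norm2 Y <= (2 * (e / D) * h) * norm2 (u (t + h)).
    apply: (norm2_le Q LY Lth) => x.
    have [Ha Hb] := N1 t h tn1 h0 hn x.
    have -> : Y x = (a (t + h) x - a t x - h * a' x)%:C * u (t + h) x +
        (b (t + h) x - b t x - h%:C * b' x) * (u (t + h) x)^*%C.
      by rewrite /Y /X /action; apply: complex_eq; rewrite !reimE; ring.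
    apply: le_trans (le_normcD _ _) _; rewrite !normcM.
    have -> : normc (u (t + h) x)^*%C = normc (u (t + h) x).
      by rewrite !normc_sqrt re_conj im_conj sqrrN.
    rewrite [X in X * _ + _]normc_sqrt /= expr0n addr0 sqrtr_sqr.
    have n0 := normc_ge0 (u (t + h) x).
    by have := ler_wpM2r n0 Ha; have := ler_wpM2r n0 Hb; lra.
  have ntn0 := norm2_ge0 Lt; have nth0 := norm2_ge0 Lth.
  have Y1 : `|ip Y (u t)| <= h * (e / D) * (2 * B * B).
    apply: le_trans (ip_CS LY Lt) _.
    apply: le_trans (ler_pM (norm2_ge0 LY) ntn0 Ybound Bt) _.
    have P : norm2 (u (t + h)) * B <= B * B by rewrite ler_wpM2r// ltW.
    apply: le_trans (_ : 2 * (e / D) * h * (B * B) <= _).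
      by rewrite -[leLHS]mulrA; exact: (ler_wpM2l Q P).
    by rewrite le_eqVlt; apply/orP; left; apply/eqP; ring.
  have K1 : `|ip (action a' b' (u (t + h))) (u t) - K| <= 4 * M' * B * (e / D).
    have -> : ip (action a' b' (u (t + h))) (u t) - K =
        ip (action a' b' (fun x => u (t + h) x - u s x)) (u t) +
        ip (action a' b' (u s)) (fun x => u t x - u s x).
      rewrite actionB (ipBl (LL _ Lth) (LL _ Ls) Lt) (ipBr (LL _ Ls) Lt Ls) /K.
      by rewrite addrA subrK.
    apply: le_trans (ler_normD _ _) _.
    have M20 : 0 <= 2 * M' by rewrite mulr_ge0.
    have T1 := action_ip_bound bc' M'0 (L2cB Lth Ls) Lt.
    have T2 := action_ip_bound bc' M'0 Ls (L2cB Lt Ls).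
    have Bs : norm2 (u s) <= B by rewrite /B; lra.
    have T3 : norm2 (fun x => u (t + h) x - u s x) * norm2 (u t) <= e / D * B.
      by rewrite ler_pM// norm2_ge0//; exact: L2cB.
    have T4 : norm2 (u s) * norm2 (fun x => u t x - u s x) <= B * (e / D).
      by rewrite ler_pM// norm2_ge0//; exact: L2cB.
    have := ler_wpM2l M20 T3; have := ler_wpM2l M20 T4; lra.
  rewrite XE (_ : _ - _ = - (ip Y (u t) + h * (ip (action a' b' (u (t + h))) (u t) - K))); last by ring.
  rewrite normrN; apply: le_trans (ler_normD _ _) _.
  rewrite normrM (gtr0_norm h0).
  have K2 := ler_wpM2l (ltW h0) K1.
  apply: le_trans (lerD Y1 K2) _.
  have -> : h * (e / D) * (2 * B * B) + h * (4 * M' * B * (e / D)) =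
     (h * e) * ((2 * B * B + 4 * M' * B) / D) by ring.
  rewrite ler_piMr ?mulr_ge0 ?(ltW h0) ?(ltW e0)// ler_pdivrMr// /D; lra.
(* testing the slope of u at t against i u(t) produces minus the energy *)
have Glim t : `|t - s| < eta -> forall k, 0 < k -> exists2 h0 : R, 0 < h0 &
    forall h, 0 < h -> h < h0 -> `|G h t + h * En t| <= h * k.
  move=> t1 k k0; have [td _ _] := etaP _ t1.
  have [Ht _ _ slope] := cu t td.
  pose N := normH1 (u t) + 1.
  have N0 : 0 < N by have := normH1_ge0 (u t); rewrite /N; lra.
  have kN : 0 < k / N by rewrite divr_gt0.
  have [n n0 Hn] := slope _ kN.
  have [_ cont' _ _] := cu t td.
  have [n' n'0 Hn'] := cont' _ ltr01.
  exists (Num.min n n'); first by rewrite lt_min n0.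
  move=> h h0; rewrite lt_min => /andP[hn hn'].
  have hE : t + h - t = h by ring.
  have := Hn (t + h); rewrite hE (gtr0_norm h0) => /(_ hn _ (H1_i Ht)).
  rewrite (ham_slope_i (bc _ td) Ht Ht) -/(En t) mulrN opprK (normH1_i Ht).
  have [Hth _] : H1 (u (t + h)) /\ normH1 (fun x => u (t + h) x - u t x) <= 1.
    by apply: Hn'; rewrite hE gtr0_norm.
  rewrite ipBl; [|exact: H1_L2c..|exact/L2cZ/H1_L2c].
  rewrite ip_i_self subr0 -/(G h t) => H; apply: le_trans H _.
  rewrite (_ : _ * _ * _ = h * k * (normH1 (u t) / N)); last by ring.
  rewrite ler_piMr ?mulr_ge0 ?(ltW h0) ?(ltW k0)// ler_pdivrMr// /N; lra.
have main t1 t2 : t1 <= t2 -> `|t1 - s| < eta -> `|t2 - s| < eta ->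
    `|En t2 - En t1 - (t2 - t1) * K| <= e * (t2 - t1).
  move=> t12 h1 h2; apply/ler_addgt0Pr => k k0.
  have k20 : 0 < k / 2 by rewrite divr_gt0.
  have [a1 a10 A1] := Glim t1 h1 _ k20.
  have [a2 a20 A2] := Glim t2 h2 _ k20.
  pose g := Num.min n1 (Num.min a1 (Num.min a2 (eta - (t2 - s)))).
  have t2s : t2 - s < eta by apply: le_lt_trans h2; exact: ler_norm.
  have g0 : 0 < g by rewrite !lt_min n10 a10 a20 subr_gt0.
  pose h := g / 2.
  have h0 : 0 < h by rewrite divr_gt0.
  have : h < g by rewrite /h ltr_pdivrMr//; lra.
  rewrite !lt_min => /and4P[hn1 ha1 ha2 heta].
  have itv t : t \in `[t1, t2]%R -> `|t - s| < eta /\ `|t + h - s| < eta.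
    rewrite in_itv /= => /andP[tt1 tt2].
    move: h1; rewrite ltr_norml => /andP[h1a h1b].
    move: h h0 hn1 ha1 ha2 heta => h h0 _ _ _ heta.
    rewrite !ltr_norml; split; apply/andP; split; clear -tt1 tt2 h1a h1b t2s heta h0; lra.
  have := @slope_approx R (G h) _ t1 t2 (- (h * K)) (h * e) t12 _ _.
  move=> /(_ _ (fun t tt => Gslope h t h0 (itv t tt).1 (itv t tt).2 hn1)).
  move=> /(_ (fun t tt => Gapprox h t h0 (itv t tt).1 (itv t tt).2 hn1)) SA.
  have B1 := A1 h h0 ha1; have B2 := A2 h h0 ha2.
  rewrite -(ler_pM2l h0) -{1}(gtr0_norm h0) -normrM.
  rewrite (_ : h * _ = (G h t2 + h * En t2) - (G h t1 + h * En t1)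
     - (G h t2 - G h t1 - (t2 - t1) * - (h * K))); last by ring.
  apply: le_trans (ler_normB _ _) _; apply: le_trans (lerD (ler_normB _ _) (lexx _)) _.
  apply: le_trans (lerD (lerD B2 B1) SA) _; lra.
exists eta => // t ts.
change (`|En t - En s - (t - s) * K| <= e * `|t - s|).
have ss' : `|s - s| < eta by rewrite subrr normr0.
have [st|/ltW ts'] := leP s t.
  by rewrite (ger0_norm (_ : 0 <= t - s)) ?subr_ge0//; exact: main.
rewrite (ler0_norm (_ : t - s <= 0)) ?subr_le0// opprB -normrN.
have := main t s ts' ts ss'.
by move: (En t) (En s) K {main Gapprox} => x y K; congr (`|_| <= _); ring.
Qed.

End Evolution.

(** * Slopes of the time factors of the coefficients *)

Section Coefficients.
Context {R : realType}.
Local Notation C := R[i].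
Local Notation re := (@complex.Re R).
Local Notation im := (@complex.Im R).
Variables (lambda sigma : R).
Implicit Types (s t h p e M : R).

(** The primitive of lambda t^(sigma-2), so that vp = phi exp(- i |phi|^(2 sigma) phase). *)
Definition phase t : R :=
  if sigma < 1 then lambda * (t `^ (sigma - 1) / (sigma - 1)) else lambda * ln t.

Lemma phase_slope s : sigma <= 1 -> 0 < s ->
  has_slope phase s (lambda * s `^ (sigma - 2)).
Proof.
move=> s1 s0; apply/has_slopeP; rewrite /phase.
have [sl|sl] := ltP sigma 1.
  have := is_deriveZ (lambda / (sigma - 1)) (is_derive1_powR (sigma - 1) s0).
  have -> : lambda / (sigma - 1) *: ((sigma - 1) * s `^ (sigma - 1 - 1)) = lambda * s `^ (sigma - 2).
    rewrite (_ : sigma - 1 - 1 = sigma - 2); last by lra.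
    by rewrite /GRing.scale /=; field; rewrite subr_eq0 lt_eqF.
  by congr is_derive; apply/funext => t /=; rewrite /GRing.scale /=; ring.
have -> : sigma = 1 by apply/eqP; rewrite eq_le s1.
have := is_deriveZ lambda (is_derive1_ln s0).
rewrite (_ : 1 - 2 = -1 :> R); last by lra.
by rewrite powR_inv1 ?(ltW s0).
Qed.

(** The time factors of t^(sigma-2) vp^2 at a point where |phi|^(2 sigma) = p. *)
Definition qcos p t := t `^ (sigma - 2) * cos (2 * p * phase t).
Definition qsin p t := t `^ (sigma - 2) * sin (2 * p * phase t).
Definition qcos' p t := (sigma - 2) * t `^ (sigma - 3) * cos (2 * p * phase t)
  - 2 * p * lambda * (t `^ (sigma - 2)) ^+ 2 * sin (2 * p * phase t).
Definition qsin' p t := (sigma - 2) * t `^ (sigma - 3) * sin (2 * p * phase t)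
  + 2 * p * lambda * (t `^ (sigma - 2)) ^+ 2 * cos (2 * p * phase t).

Lemma powR_slope k s : 0 < s ->
  has_slope (fun t => t `^ k) s (k * s `^ (k - 1)).
Proof. by move=> s0; apply/has_slopeP; exact: is_derive1_powR. Qed.

Lemma has_slopeM (f g : R -> R) s df dg : has_slope f s df -> has_slope g s dg ->
  has_slope (fun t => f t * g t) s (f s * dg + g s * df).
Proof. by move=> /has_slopeP Hf /has_slopeP Hg; apply/has_slopeP. Qed.

Lemma has_slopeD (f g : R -> R) s df dg : has_slope f s df -> has_slope g s dg ->
  has_slope (fun t => f t + g t) s (df + dg).
Proof. by move=> /has_slopeP Hf /has_slopeP Hg; apply/has_slopeP. Qed.

Lemma has_slopeZ (f : R -> R) s df k : has_slope f s df ->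
  has_slope (fun t => k * f t) s (k * df).
Proof. by move=> /has_slopeP Hf; apply/has_slopeP; exact: is_deriveZ. Qed.

Lemma has_slope_comp (f g : R -> R) s df dg : has_slope f (g s) df ->
  has_slope g s dg -> has_slope (fun t => f (g t)) s (df * dg).
Proof. by move=> /has_slopeP Hf /has_slopeP Hg; apply/has_slopeP. Qed.

Lemma cos_slope (x : R) : has_slope cos x (- sin x).
Proof. by apply/has_slopeP; exact: is_derive_cos. Qed.

Lemma sin_slope (x : R) : has_slope sin x (cos x).
Proof. by apply/has_slopeP; exact: is_derive_sin. Qed.

Lemma qcos_slope p s : sigma <= 1 -> 0 < s -> has_slope (qcos p) s (qcos' p s).
Proof.
move=> s1 s0.
have := has_slopeM (powR_slope (sigma - 2) s0)
  (has_slope_comp (cos_slope _) (has_slopeZ (2 * p) (phase_slope s1 s0))).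
rewrite (_ : sigma - 2 - 1 = sigma - 3); last by lra.
by congr has_slope; rewrite /qcos'; ring.
Qed.

Lemma qsin_slope p s : sigma <= 1 -> 0 < s -> has_slope (qsin p) s (qsin' p s).
Proof.
move=> s1 s0.
have := has_slopeM (powR_slope (sigma - 2) s0)
  (has_slope_comp (sin_slope _) (has_slopeZ (2 * p) (phase_slope s1 s0))).
rewrite (_ : sigma - 2 - 1 = sigma - 3); last by lra.
by congr has_slope; rewrite /qsin'; ring.
Qed.

Lemma cos_lip (x y : R) : `|cos y - cos x| <= `|y - x|.
Proof.
wlog xy : x y / x <= y.
  by move=> H; have [/H//|/ltW/H] := leP x y; rewrite distrC [X in _ <= X]distrC.
have := @slope_approx R cos (fun t => - sin t) x y 0 1 xy (fun t _ => cos_slope t).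
rewrite mulr0 subr0 mul1r (ger0_norm (_ : 0 <= y - x)) ?subr_ge0//; apply.
by move=> t _; rewrite subr0 normrN ler_norml sin_geN1 sin_le1.
Qed.

Lemma sin_lip (x y : R) : `|sin y - sin x| <= `|y - x|.
Proof.
wlog xy : x y / x <= y.
  by move=> H; have [/H//|/ltW/H] := leP x y; rewrite distrC [X in _ <= X]distrC.
have := @slope_approx R sin cos x y 0 1 xy (fun t _ => sin_slope t).
rewrite mulr0 subr0 mul1r (ger0_norm (_ : 0 <= y - x)) ?subr_ge0//; apply.
by move=> t _; rewrite subr0 ler_norml cos_geN1 cos_le1.
Qed.

Lemma has_slope_near (f : R -> R) s df e : has_slope f s df -> 0 < e ->
  exists2 eta : R, 0 < eta & forall t, `|t - s| < eta -> `|f t - f s| <= e.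
Proof.
move=> /has_slope_continuous/cvgrPdist_le H e0.
have [eta /= eta0 Heta] := H _ e0; exists eta => // t ts.
by rewrite distrC; apply: Heta; rewrite /= distrC.
Qed.

(** Oscillation of a product whose second factor is a sine or a cosine. *)
Lemma prod_osc (x y x0 y0 k l : R) : `|x - x0| <= k -> `|y - y0| <= l -> `|y| <= 1 ->
  `|x * y - x0 * y0| <= k + `|x0| * l.
Proof.
move=> xk yl y1.
rewrite (_ : _ - _ = (x - x0) * y + x0 * (y - y0)); last by ring.
apply: le_trans (ler_normD _ _) _; rewrite !normrM; apply: lerD.
  by apply: le_trans (ler_piMr _ y1) xk.
by rewrite ler_wpM2l.
Qed.

(** The radius is uniform in the amplitude p, which ranges over the values of the bounded
function |phi|^(2 sigma); this gives uniformity in the space variable below. *)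
Lemma qcs'_osc s M e : sigma <= 1 -> 0 < s -> 0 <= M -> 0 < e ->
  exists2 eta : R, 0 < eta & forall t p, `|t - s| < eta -> 0 <= p <= M ->
    `|qcos' p t - qcos' p s| <= e /\ `|qsin' p t - qsin' p s| <= e.
Proof.
move=> s1 s0 M0 e0.
pose A := `|(sigma - 2) * s `^ (sigma - 3)|.
pose L := `|lambda|.
pose B := `|(s `^ (sigma - 2)) ^+ 2|.
pose D := 1 + A * (2 * M) + 2 * M * L * (1 + B * (2 * M)).
have A0 : 0 <= A by exact: normr_ge0.
have L0 : 0 <= L by exact: normr_ge0.
have B0 : 0 <= B by exact: normr_ge0.
have D0 : 0 < D.
  have X1 : 0 <= A * (2 * M) by rewrite !mulr_ge0.
  have X2 : 0 <= 2 * M * L * (1 + B * (2 * M)).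
    by rewrite !mulr_ge0// addr_ge0// !mulr_ge0.
  by rewrite /D; lra.
have eD : 0 < e / D by rewrite divr_gt0.
have [n1 n10 N1] := has_slope_near (has_slopeZ (sigma - 2) (powR_slope (sigma - 3) s0)) eD.
have [n2 n20 N2] := has_slope_near (has_slopeM (powR_slope (sigma - 2) s0) (powR_slope (sigma - 2) s0)) eD.
have [n3 n30 N3] := has_slope_near (phase_slope s1 s0) eD.
exists (Num.min n1 (Num.min n2 n3)); first by rewrite !lt_min n10 n20.
move=> t p; rewrite !lt_min => /and3P[t1 t2 t3] /andP[p0 pM].
have E1 := N1 t t1; have E2 := N2 t t2; have E3 := N3 t t3.
rewrite -!expr2 in E2.
have Hph : `|2 * p * phase t - 2 * p * phase s| <= 2 * M * (e / D).
  rewrite -mulrBr normrM (ger0_norm (_ : 0 <= 2 * p)) ?mulr_ge0//.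
  by apply: ler_pM => //; [rewrite mulr_ge0|rewrite ler_wpM2l].
have c1 (x : R) : `|cos x| <= 1 by rewrite ler_norml cos_geN1 cos_le1.
have sn1 (x : R) : `|sin x| <= 1 by rewrite ler_norml sin_geN1 sin_le1.
have Hc := le_trans (cos_lip _ _) Hph.
have Hs := le_trans (sin_lip _ _) Hph.
have pl : `|2 * p * lambda| <= 2 * M * L.
  rewrite normrM (ger0_norm (_ : 0 <= 2 * p)) ?mulr_ge0//.
  by apply: ler_pM => //; [rewrite mulr_ge0|rewrite ler_wpM2l].
have fin (x y : R) : `|x| <= e / D + A * (2 * M * (e / D)) ->
   `|y| <= e / D + B * (2 * M * (e / D)) -> `|x| + `|2 * p * lambda| * `|y| <= e.
  move=> Hx Hy.
  have : `|2 * p * lambda| * `|y| <= 2 * M * L * (e / D + B * (2 * M * (e / D))).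
    exact: ler_pM.
  move=> Hy'; apply: le_trans (lerD Hx Hy') _.
  have : e = e / D * D by rewrite divfK ?gt_eqF.
  move: (e / D) => q ->; rewrite le_eqVlt; apply/orP; left; apply/eqP.
  by rewrite /D; ring.
split.
  rewrite /qcos' (_ : _ - _ = ((sigma - 2) * t `^ (sigma - 3) * cos (2 * p * phase t) -
     (sigma - 2) * s `^ (sigma - 3) * cos (2 * p * phase s)) - 2 * p * lambda *
     ((t `^ (sigma - 2)) ^+ 2 * sin (2 * p * phase t) - (s `^ (sigma - 2)) ^+ 2 * sin (2 * p * phase s))); last by ring.
  apply: le_trans (ler_normB _ _) _; rewrite [X in _ + X]normrM.
  by apply: fin; apply: prod_osc.
rewrite /qsin' (_ : _ - _ = ((sigma - 2) * t `^ (sigma - 3) * sin (2 * p * phase t) -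
     (sigma - 2) * s `^ (sigma - 3) * sin (2 * p * phase s)) + 2 * p * lambda *
     ((t `^ (sigma - 2)) ^+ 2 * cos (2 * p * phase t) - (s `^ (sigma - 2)) ^+ 2 * cos (2 * p * phase s))); last by ring.
apply: le_trans (ler_normD _ _) _; rewrite [X in _ + X]normrM.
by apply: fin; apply: prod_osc.
Qed.

Lemma incr_approx (f f' : R -> R) s eta e : (forall t, `|t - s| < eta -> has_slope f t (f' t)) ->
  (forall t, `|t - s| < eta -> `|f' t - f' s| <= e) ->
  forall t h, `|t - s| < eta / 2 -> 0 < h -> h < eta / 2 ->
    `|f (t + h) - f t - h * f' s| <= e * h.
Proof.
move=> Hf Hf' t h ts h0 heta.
have tt : t <= t + h by rewrite lerDl ltW.
have itv x : x \in `[t, t + h]%R -> `|x - s| < eta.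
  rewrite in_itv /= => /andP[x1 x2]; move: ts; rewrite !ltr_norml => /andP[a b].
  by apply/andP; split; lra.
have := @slope_approx R f f' t (t + h) (f' s) e tt (fun x xx => Hf x (itv x xx)) (fun x xx => Hf' x (itv x xx)).
by rewrite (_ : t + h - t = h)//; ring.
Qed.

(** The mean value theorem with the uniform modulus of continuity of the slopes.  The third
bound is the case of amplitude 0. *)
Lemma qcs_approx s M e : sigma <= 1 -> 0 < s -> 0 <= M -> 0 < e ->
  exists2 eta : R, 0 < eta & forall t h p, `|t - s| < eta -> 0 < h -> h < eta ->
    0 <= p <= M ->
    [/\ `|qcos p (t + h) - qcos p t - h * qcos' p s| <= e * h,
        `|qsin p (t + h) - qsin p t - h * qsin' p s| <= e * h &
        `|(t + h) `^ (sigma - 2) - t `^ (sigma - 2) - h * ((sigma - 2) * s `^ (sigma - 3))| <= e * h].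
Proof.
move=> s1 s0 M0 e0.
have [n n0 N] := qcs'_osc s1 s0 M0 e0.
pose eta := Num.min n s.
have eta0 : 0 < eta by rewrite lt_min n0.
exists (eta / 2); first by rewrite divr_gt0.
move=> t h p ts h0 he pM.
have pos x : `|x - s| < eta -> 0 < x /\ `|x - s| < n.
  rewrite lt_min => /andP[xn]; rewrite ltr_norml => /andP[xs _]; split=> //; lra.
have zM : 0 <= (0:R) <= M by rewrite lexx.
have ph0 (x : R) : qcos 0 x = x `^ (sigma - 2) by rewrite /qcos mulr0 mul0r cos0 mulr1.
have ph0' (x : R) : qcos' 0 x = (sigma - 2) * x `^ (sigma - 3).
  by rewrite /qcos' !(mulr0, mul0r) cos0 mulr1 subr0.
split; last rewrite -!ph0 -ph0'.
- apply: (@incr_approx (qcos p) (qcos' p) s eta e) => // x /pos[x0 xn].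
    exact: qcos_slope.
  exact: (N x p xn pM).1.
- apply: (@incr_approx (qsin p) (qsin' p) s eta e) => // x /pos[x0 xn].
    exact: qsin_slope.
  exact: (N x p xn pM).2.
- apply: (@incr_approx (qcos 0) (qcos' 0) s eta e) => // x /pos[x0 xn].
    exact: qcos_slope.
  exact: (N x 0 xn zM).1.
Qed.

End Coefficients.

(** * Coefficients of the linearised equation *)

Section Energy.
Context {R : realType}.
Local Notation mu := (@lebesgue_measure R).
Local Notation C := R[i].
Local Notation re := (@complex.Re R).
Local Notation im := (@complex.Im R).
Variables (lambda sigma : R) (phi : R -> C).

Definition density x : R := normc (phi x) `^ (2 * sigma).
(** The modulus of this function is |phi|^sigma. *)
Definition profile0 x : C := (normc (phi x) `^ (sigma - 1))%:C * phi x.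
(** The function k whose square, multiplied by lambda sigma t^(sigma-2), is the coefficient
of conj u. *)
Definition profile t x : C := (normc (phi x) `^ (sigma - 1))%:C * vp lambda sigma phi t x.
Definition diag_coef t x : R := lambda * t `^ (sigma - 2) * ((sigma + 1) * density x).
Definition conj_coef t x : C := (lambda * t `^ (sigma - 2) * sigma)%:C * profile t x ^+ 2.
Definition diag_coef' t x : R := lambda * ((sigma - 2) * t `^ (sigma - 3)) * ((sigma + 1) * density x).
(** The slope in time of the coefficient of conj u: the phase of the square of k rotates with
speed 2 m lambda t^(sigma-2). *)
Definition conj_coef' t x : C := (lambda * sigma)%:C *
  ((((sigma - 2) * t `^ (sigma - 3)) +i* (- (2 * density x * lambda * (t `^ (sigma - 2)) ^+ 2))) * profile t x ^+ 2).
(** Its real part is the quantity that the modified energy controls with weight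
t^(sigma-2). *)
Definition rotated t (f : R -> C) x : C := (profile t x)^*%C * f x.

Lemma sqr_cexpiN (t : R) : cexpi (- t) ^+ 2 = cos (2 * t) -i* sin (2 * t) :> C.
Proof.
rewrite (_ : 2 * t = t + t); last by ring.
rewrite cosD sinD expr2; apply: complex_eq; rewrite /= ?cosN ?sinN; ring.
Qed.

Lemma vp_cexpi t x : sigma <= 1 ->
  vp lambda sigma phi t x = phi x * cexpi (- (density x * phase lambda sigma t)).
Proof.
move=> s1; rewrite /vp /phase /density; congr (_ * _).
have [sl|sl] := ltP sigma 1; first by congr cexpi; ring.
have -> : sigma = 1 by apply/eqP; rewrite eq_le s1.
by rewrite mulr1 powR_mulrn ?normc_ge0//; congr cexpi; ring.
Qed.

Lemma profileE t x : sigma <= 1 ->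
  profile t x = profile0 x * cexpi (- (density x * phase lambda sigma t)).
Proof. by move=> s1; rewrite /profile vp_cexpi// /profile0 mulrA. Qed.

Lemma profile_sqr t x : sigma <= 1 -> profile t x ^+ 2 =
  profile0 x ^+ 2 * (cos (2 * density x * phase lambda sigma t) -i* sin (2 * density x * phase lambda sigma t)).
Proof. by move=> s1; rewrite profileE// exprMn sqr_cexpiN mulrA. Qed.

Lemma normc_realM (c : R) (z : C) : normc (c%:C * z) = `|c| * normc z.
Proof.
by rewrite normcM [normc _%:C]normc_sqrt re_real im_real expr0n addr0 sqrtr_sqr.
Qed.

Lemma normcX2 (z : C) : normc (z ^+ 2) = normc z ^+ 2.
Proof. by rewrite expr2 normcM -expr2. Qed.

Lemma normc_cexpi (t : R) : normc (cexpi t : C) = 1.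
Proof. by rewrite normc_sqrt /= cos2Dsin2 sqrtr1. Qed.

Lemma normc_profile0 x : 0 < sigma -> normc (profile0 x) ^+ 2 = density x.
Proof.
move=> s0; rewrite /profile0 normcM exprMn [normc _%:C]normc_sqrt /= expr0n addr0 sqrtr_sqr.
rewrite real_normK ?num_real// /density.
rewrite -(powR_mulrn 2 (powR_ge0 _ _)) -powRrM.
rewrite -(powR_mulrn 2 (normc_ge0 _)).
rewrite -powRD; last by apply/implyP => /eqP H; exfalso; lra.
by congr powR; ring.
Qed.

Lemma normc_profile t x : 0 < sigma -> sigma <= 1 -> normc (profile t x) ^+ 2 = density x.
Proof. by move=> s0 s1; rewrite profileE// normcM normc_cexpi mulr1 normc_profile0. Qed.

Lemma pot_offE t x : pot_off lambda sigma phi t x = profile t x ^+ 2.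
Proof.
rewrite /pot_off /profile [RHS]exprMn; congr (_ * _).
rewrite (_ : 2 * sigma - 2 = (sigma - 1) * 2%:R); last by ring.
rewrite powRrM powR_mulrn ?powR_ge0//.
by apply: complex_eq; rewrite expr2 !reimE; ring.
Qed.

Lemma rotated_re t f x : normc (phi x) `^ (sigma - 1) * re ((vp lambda sigma phi t x)^*%C * f x)
  = re (rotated t f x).
Proof. by rewrite /rotated /profile !reimE; ring. Qed.

Lemma conj_coef'E t x : sigma <= 1 -> conj_coef' t x = (lambda * sigma)%:C * (profile0 x ^+ 2 *
  (qcos' lambda sigma (density x) t -i* qsin' lambda sigma (density x) t)).
Proof.
move=> s1; rewrite /conj_coef' profile_sqr// /qcos' /qsin'; congr (_ * _).
set Cc := cos _; set S := sin _; set A := _ `^ _; set B := _ `^ _; set d := density x.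
rewrite mulrCA; congr (_ * _).
by apply: complex_eq; rewrite /=; ring.
Qed.

Lemma conj_coefE t x : sigma <= 1 -> conj_coef t x = (lambda * sigma)%:C * (profile0 x ^+ 2 *
  (qcos lambda sigma (density x) t -i* qsin lambda sigma (density x) t)).
Proof.
move=> s1; rewrite /conj_coef profile_sqr// /qcos /qsin.
set Cc := cos _; set S := sin _; set A := _ `^ _.
by case: (profile0 x ^+ 2) => d1 d2; apply: complex_eq; rewrite /=; ring.
Qed.

Section Bounded.
Variables (M : R).
Hypotheses (l0 : 0 < lambda) (s2 : 2^-1 < sigma) (s1 : sigma <= 1).
Hypotheses (m1 : measurable_fun setT (fun x => re (phi x)))
  (m2 : measurable_fun setT (fun x => im (phi x))).
Hypotheses (mM : forall x, density x <= M).

Let s0 : 0 < sigma. Proof. by have := s2; lra. Qed.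
Lemma density_ge0 x : 0 <= density x. Proof. exact: powR_ge0. Qed.
Let M0 : 0 <= M. Proof. exact: le_trans (density_ge0 0) (mM 0). Qed.
Let density_itv x : 0 <= density x <= M. Proof. by rewrite density_ge0 mM. Qed.

Lemma measurable_density : measurable_fun setT density.
Proof.
apply: (@measurableT_comp _ _ _ _ _ _ (@powR R ^~ (2 * sigma))).
  exact: measurable_powR.
exact: measurable_normc.
Qed.
Let mdens := measurable_density.

Lemma measurable_profile0 : measurable_fun setT (fun x => re (profile0 x)) /\
  measurable_fun setT (fun x => im (profile0 x)).
Proof.
have mn : measurable_fun setT (fun x => normc (phi x) `^ (sigma - 1)).
  apply: (@measurableT_comp _ _ _ _ _ _ (@powR R ^~ (sigma - 1))).
    exact: measurable_powR.
  exact: measurable_normc.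
split.
  under eq_fun do rewrite /profile0 reM re_real im_real mul0r subr0.
  exact: measurable_funM.
under eq_fun do rewrite /profile0 imM re_real im_real mul0r addr0.
exact: measurable_funM.
Qed.

Lemma measurable_profile t : measurable_fun setT (fun x => re (profile t x)) /\
  measurable_fun setT (fun x => im (profile t x)).
Proof.
have [k1 k2] := measurable_profile0.
have mp : measurable_fun setT (fun x => - (density x * phase lambda sigma t)).
  by apply: measurableT_comp => //; exact: measurable_funM.
have mc : measurable_fun setT (fun x => cos (- (density x * phase lambda sigma t))).
  apply: (@measurableT_comp _ _ _ _ _ _ (@cos R)) => //.
  by apply: continuous_measurable_fun; exact: continuous_cos.
have ms : measurable_fun setT (fun x => sin (- (density x * phase lambda sigma t))).
  apply: (@measurableT_comp _ _ _ _ _ _ (@sin R)) => //.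
  by apply: continuous_measurable_fun; exact: continuous_sin.
split.
  under eq_fun do rewrite profileE// reM /=.
  by apply: measurable_funB; exact: measurable_funM.
under eq_fun do rewrite profileE// imM /=.
by apply: measurable_funD; exact: measurable_funM.
Qed.

Lemma profile_bound t x : normc (profile t x) <= Num.sqrt M.
Proof.
rewrite -(ger0_norm (normc_ge0 _)) -sqrtr_sqr ler_wsqrtr// normc_profile//.
Qed.

Lemma rotated_L2c t f : L2c f -> L2c (rotated t f).
Proof.
move=> Lf; have [k1 k2] := measurable_profile t.
apply: (@L2cM _ (fun x => (profile t x)^*%C) f (Num.sqrt M)) => //.
- by under eq_fun do rewrite re_conj.
- by under eq_fun do rewrite im_conj; exact: measurableT_comp.
- move=> x; apply: le_trans (profile_bound t x).
  by rewrite !normc_sqrt re_conj im_conj sqrrN.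
Qed.

Lemma normc_profile_sqr t x : normc (profile t x ^+ 2) <= M.
Proof. by rewrite normcX2 normc_profile. Qed.

Lemma measurable_profile_sqr t : measurable_fun setT (fun x => re (profile t x ^+ 2)) /\
  measurable_fun setT (fun x => im (profile t x ^+ 2)).
Proof.
have [k1 k2] := measurable_profile t; split.
  under eq_fun do rewrite expr2 reM.
  by apply: measurable_funB; exact: measurable_funM.
under eq_fun do rewrite expr2 imM.
by apply: measurable_funD; exact: measurable_funM.
Qed.

Lemma coef_bounded t : exists2 N : R, 0 <= N & bounded_coef (diag_coef t) (conj_coef t) N.
Proof.
pose c := lambda * t `^ (sigma - 2).
have c0 : 0 <= c by rewrite mulr_ge0 ?powR_ge0// ltW.
exists (2 * c * M); first exact: mulr_ge0 (mulr_ge0 (ler0n _ 2) c0) M0.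
have [k1 k2] := measurable_profile_sqr t.
split.
- by apply: measurable_funM => //; exact: measurable_funM.
- under eq_fun do rewrite /conj_coef reM re_real im_real mul0r subr0.
  exact: measurable_funM.
- under eq_fun do rewrite /conj_coef imM re_real im_real mul0r addr0.
  exact: measurable_funM.
- move=> x; have cM : 0 <= c * M by rewrite mulr_ge0.
  split.
    have d0 : 0 <= (sigma + 1) * density x.
      by rewrite mulr_ge0 ?density_ge0// addr_ge0// ltW.
    rewrite ger0_norm; last exact: mulr_ge0.
    apply: le_trans (_ : c * (2 * M) <= _); last by rewrite mulrCA mulrA.
    rewrite ler_wpM2l//; apply: ler_pM; rewrite ?density_ge0 ?mM//; have := s1; have := s0; lra.
  rewrite normc_realM.
  rewrite ger0_norm; last by rewrite mulr_ge0// ltW.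
  have := normc_profile_sqr t x; have n0 := normc_ge0 (profile t x ^+ 2).
  move=> nM; apply: le_trans (_ : c * 1 * M <= _); last by lra.
  apply: ler_pM => //; first by rewrite mulr_ge0// ltW.
  by rewrite ler_wpM2l.
Qed.

Lemma coef'_bounded t : exists2 N : R, 0 <= N & bounded_coef (diag_coef' t) (conj_coef' t) N.
Proof.
pose z x : C := ((sigma - 2) * t `^ (sigma - 3)) +i* (- (2 * density x * lambda * (t `^ (sigma - 2)) ^+ 2)).
pose A := `|(sigma - 2) * t `^ (sigma - 3)|.
pose B := 2 * M * lambda * (t `^ (sigma - 2)) ^+ 2.
have A0 : 0 <= A by exact: normr_ge0.
have B0 : 0 <= B by rewrite !mulr_ge0 ?exprn_ge0 ?powR_ge0// ltW.
have zB x : normc (z x) <= A + B.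
  have := @le_normcD R ((sigma - 2) * t `^ (sigma - 3))%:C (0 +i* (- (2 * density x * lambda * (t `^ (sigma - 2)) ^+ 2))).
  rewrite (_ : _ + _ = z x); last by apply: complex_eq; rewrite /= ?addr0 ?add0r.
  move=> H; apply: le_trans H _; apply: lerD.
    by rewrite normc_sqrt /= expr0n addr0 sqrtr_sqr.
  rewrite normc_sqrt /= expr0n add0r sqrtr_sqr normrN ger0_norm; last first.
    by rewrite !mulr_ge0 ?exprn_ge0 ?powR_ge0 ?density_ge0// ltW.
  rewrite /B ler_wpM2r ?exprn_ge0 ?powR_ge0// ler_wpM2r ?(ltW l0)// ler_wpM2l//.
have [k1 k2] := measurable_profile_sqr t.
have mz : measurable_fun setT (fun x => im (z x)).
  rewrite /z /=; apply: measurableT_comp => //.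
  by apply: measurable_funM => //; apply: measurable_funM => //; exact: measurable_funM.
exists (2 * lambda * (A + B) * M); first by rewrite !mulr_ge0 ?addr_ge0// ltW.
split.
- by apply: measurable_funM => //; exact: measurable_funM.
- under eq_fun do rewrite /conj_coef' -/(z _) reM re_real im_real mul0r subr0 reM.
  by apply: measurable_funM => //; apply: measurable_funB; exact: measurable_funM.
- under eq_fun do rewrite /conj_coef' -/(z _) imM re_real im_real mul0r addr0 imM.
  by apply: measurable_funM => //; apply: measurable_funD; exact: measurable_funM.
- move=> x; split.
    rewrite /diag_coef' normrM normrM -/A (ger0_norm (ltW l0)).
    rewrite ger0_norm; last by rewrite mulr_ge0 ?density_ge0//; have := s0; lra.
    apply: le_trans (_ : lambda * (A + B) * (2 * M) <= _); last by lra.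
    apply: ler_pM; rewrite ?mulr_ge0 ?(ltW l0)//.
    - have := s0; lra.
    - exact: density_ge0.
    - by rewrite ler_wpM2l ?(ltW l0)// lerDl.
    - by apply: ler_pM; rewrite ?density_ge0 ?mM//; have := s1; have := s0; lra.
  rewrite /conj_coef' normc_realM (normcM (z x)).
  rewrite ger0_norm; last by rewrite mulr_ge0// ltW.
  rewrite -[leRHS]mulrA; apply: ler_pM => //.
  - by rewrite mulr_ge0// ltW.
  - by apply: mulr_ge0; exact: normc_ge0.
  - by rewrite mulrC ler_wpM2r ?(ltW l0)//; have := s1; lra.
  - by apply: ler_pM; rewrite ?normc_ge0 ?normc_profile_sqr.
Qed.

(** At each point the coefficients are time factors with amplitude m(x) <= M, multiplied by
bounded functions of x, so that the approximation is uniform in x. *)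
Lemma coef_approx s : 0 < s -> forall e, 0 < e ->
  exists2 eta : R, 0 < eta & forall t h, `|t - s| < eta ->
     0 < h -> h < eta -> forall x,
       `|diag_coef (t + h) x - diag_coef t x - h * diag_coef' s x| <= e * h /\
       normc (conj_coef (t + h) x - conj_coef t x - h%:C * conj_coef' s x) <= e * h.
Proof.
move=> sp e e0.
have D0 : 0 < 2 * lambda * (M + 1) by rewrite !mulr_gt0//; have := M0; lra.
pose e' := e / (2 * lambda * (M + 1)).
have e'0 : 0 < e' by rewrite divr_gt0.
have e'E : 2 * lambda * M * e' <= e.
  rewrite /e' mulrA ler_pdivrMr// mulrC ler_wpM2l ?(ltW e0)//.
  by rewrite ler_wpM2l ?mulr_ge0 ?(ltW l0)// lerDl.
have [eta eta0 H] := qcs_approx lambda s1 sp M0 e'0.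
exists eta => // t h ts h0 he x.
have [Hc Hs Ha] := H t h (density x) ts h0 he (density_itv x).
have e'h : 0 <= e' * h by rewrite mulr_ge0// ltW.
have fin : 2 * lambda * M * (e' * h) <= e * h by rewrite mulrA ler_wpM2r// ltW.
split.
  rewrite (_ : _ - _ = lambda * ((sigma + 1) * density x) *
    ((t + h) `^ (sigma - 2) - t `^ (sigma - 2) - h * ((sigma - 2) * s `^ (sigma - 3)))); last first.
    by rewrite /diag_coef /diag_coef'; ring.
  rewrite normrM; apply: le_trans fin; apply: ler_pM => //.
  rewrite ger0_norm; last first.
    by rewrite !mulr_ge0 ?density_ge0 ?(ltW l0)//; have := s0; lra.
  rewrite (_ : 2 * lambda * M = lambda * (2 * M)); last by ring.
  rewrite ler_wpM2l ?(ltW l0)//.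
  by apply: ler_pM; rewrite ?density_ge0 ?mM//; have := s1; have := s0; lra.
rewrite !conj_coefE// conj_coef'E//.
set dc := _ - _ - _ in Hc; set ds := _ - _ - _ in Hs.
rewrite (_ : _ - _ = (lambda * sigma)%:C * (profile0 x ^+ 2 * (dc -i* ds))); last first.
  rewrite /dc /ds; case: (profile0 x ^+ 2) => k1 k2.
  by apply: complex_eq; rewrite /=; ring.
rewrite normc_realM (normcM (profile0 x ^+ 2)) normcX2 normc_profile0//.
rewrite ger0_norm; last by rewrite mulr_ge0// ltW.
have nd : normc (dc -i* ds) <= 2 * (e' * h).
  have := @le_normcD R dc%:C (0 -i* ds).
  rewrite (_ : _ + _ = dc -i* ds); last by apply: complex_eq; rewrite /= ?addr0 ?add0r.
  move=> T; apply: le_trans T _.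
  rewrite !normc_sqrt /= expr0n addr0 add0r sqrrN !sqrtr_sqr; lra.
apply: le_trans fin.
rewrite (_ : 2 * lambda * M * (e' * h) = lambda * (M * (2 * (e' * h)))); last by ring.
apply: ler_pM.
- by rewrite mulr_ge0// ltW.
- by rewrite mulr_ge0 ?density_ge0 ?normc_ge0.
- by rewrite ler_piMr// ltW.
- by apply: ler_pM; rewrite ?density_ge0 ?normc_ge0.
Qed.

End Bounded.
End Energy.

(** * The slope of the modified energy *)

Section Multiplier.
Context {R : realType}.
Local Notation mu := (@lebesgue_measure R).
Local Notation C := R[i].
Local Notation re := (@complex.Re R).
Local Notation im := (@complex.Im R).
Variables (m m' : R -> R) (M : R).
Hypotheses (am : abscont m m') (m0 : forall x, 0 <= m x) (mM : forall x, m x <= M)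
  (Lm' : L2 m').

Let M0 : 0 <= M. Proof. exact: le_trans (m0 0) (mM 0). Qed.
Let mn x : `|m x| <= M. Proof. by rewrite ger0_norm. Qed.
Let mm : measurable_fun setT m. Proof. exact: abscont_measurable am. Qed.

Lemma csobolev_mult f : H1 f -> csobolev (fun x => (m x)%:C * f x)
  (fun x => (m x)%:C * grad f x + (m' x)%:C * f x).
Proof. by move=> /H1_csobolev; exact: csobolevM am mn Lm'. Qed.

Lemma L2c_mult f : L2c f -> L2c (fun x => (m x)%:C * f x).
Proof. exact: L2cR mm mn. Qed.

(** The product is the difference between the gradient of m f and m grad f. *)
Lemma L2c_mult' f : H1 f -> L2c (fun x => (m' x)%:C * f x).
Proof.
move=> Hf; have /csobolevP[_ LD _] := csobolev_mult Hf.
have := L2cB LD (L2c_mult (grad_L2c Hf)).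
by congr L2c; apply/funext => x; rewrite [X in X - _]addrC addrK.
Qed.

(** Here m' is square integrable and f is bounded by its H^1 norm. *)
Lemma norm2_mult' f : H1 f ->
  norm2 (fun x => (m' x)%:C * f x) <= 2 * Num.sqrt (\int[mu]_x (m' x ^+ 2)) * normH1 f.
Proof.
move=> Hf; have LD := L2c_mult' Hf.
have n0 := normH1_ge0 f.
have I0 : 0 <= \int[mu]_x (m' x ^+ 2) by apply: Rintegral_ge0 => x _; exact: sqr_ge0.
have r0 : 0 <= 2 * Num.sqrt (\int[mu]_x (m' x ^+ 2)) * normH1 f by rewrite !mulr_ge0 ?sqrtr_ge0.
rewrite norm2E// -(ger0_norm r0) -sqrtr_sqr ler_wsqrtr//.
have -> : (2 * Num.sqrt (\int[mu]_x (m' x ^+ 2)) * normH1 f) ^+ 2 =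
    4 * normH1 f ^+ 2 * \int[mu]_x (m' x ^+ 2).
  by rewrite !exprMn sqr_sqrtr//; ring.
rewrite -RintegralZl//; last exact: Lm'.2.
apply: ae_le_Rintegral; first exact: L2c_itg.
  by apply: itgZ => //; exact: Lm'.2.
apply: ae_impl (H1_sup Hf) => x Hx.
rewrite !reimE !mul0r subr0 addr0.
have -> : m' x * re (f x) * (m' x * re (f x)) + m' x * im (f x) * (m' x * im (f x)) =
  (re (f x) ^+ 2 + im (f x) ^+ 2) * m' x ^+ 2 by ring.
rewrite ler_wpM2r ?sqr_ge0//; apply: le_trans Hx _.
rewrite ler_pM2l// expr2; apply: ler_pM.
- exact/norm2_ge0/H1_L2c.
- exact/norm2_ge0/grad_L2c.
- exact: norm2_le_normH1.
- exact: norm2_grad_le_normH1.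
Qed.

(** The weighted mass is the pairing of u with m u, so that multiplication by m has to
preserve H^1. *)
Lemma H1_mult : exists2 K0 : R, 0 <= K0 & forall f, H1 f ->
  H1 (fun x => (m x)%:C * f x) /\ normH1 (fun x => (m x)%:C * f x) <= K0 * normH1 f.
Proof.
pose I := Num.sqrt (\int[mu]_x (m' x ^+ 2)).
have I0 : 0 <= I by exact: sqrtr_ge0.
exists (2 * M + 2 * I); first by rewrite addr_ge0// mulr_ge0.
move=> f Hf; have cs := csobolev_mult Hf; have Hm := csobolev_H1 cs; split=> //.
have Lf := H1_L2c Hf; have Lg := grad_L2c Hf.
have b1 : norm2 (fun x => (m x)%:C * f x) <= M * norm2 f.
  apply: norm2_le => //; first exact: L2c_mult.
  by move=> x; rewrite normc_realM ler_wpM2r ?normc_ge0.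
have b2 : norm2 (fun x => (m x)%:C * grad f x) <= M * norm2 (grad f).
  apply: norm2_le => //; first exact: L2c_mult.
  by move=> x; rewrite normc_realM ler_wpM2r ?normc_ge0.
have b3 := norm2_mult' Hf.
have b4 : norm2 (grad (fun x => (m x)%:C * f x)) <= M * norm2 (grad f) + 2 * I * normH1 f.
  have gE := csobolev_grad cs.
  have /csobolevP[_ LD _] := cs.
  rewrite norm2E ?(ip_ae (grad_L2c Hm) (grad_L2c Hm) LD LD gE gE) -?norm2E//; last exact: grad_L2c.
  apply: le_trans (norm2_triangle LD (L2c_mult Lg)) _.
  apply: lerD => //.
  have -> : (fun x => (m x)%:C * grad f x + (m' x)%:C * f x - (m x)%:C * grad f x) =
    (fun x => (m' x)%:C * f x) by apply/funext => x; rewrite addrC addKr.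
  exact: b3.
apply: le_trans (normH1_le Hm b1 b4) _.
have c1 := ler_wpM2l M0 (norm2_le_normH1 Hf).
have c2 := ler_wpM2l M0 (norm2_grad_le_normH1 Hf).
rewrite [leRHS](_ : _ = M * normH1 f + (M * normH1 f + 2 * I * normH1 f)); last by ring.
by apply: lerD; rewrite // lerD2r.
Qed.

End Multiplier.

Section EnergySlope.
Context {R : realType}.
Local Notation mu := (@lebesgue_measure R).
Local Notation C := R[i].
Local Notation re := (@complex.Re R).
Local Notation im := (@complex.Im R).
Variables (lambda sigma delta : R) (phi : R -> C).
Variables (m' : R -> R) (M : R) (u : R -> R -> C).
Hypotheses (l0 : 0 < lambda) (s2 : 2^-1 < sigma) (s1 : sigma <= 1).
Hypotheses (m1 : measurable_fun setT (fun x => re (phi x)))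
  (m2 : measurable_fun setT (fun x => im (phi x))).
Hypotheses (am : abscont (density sigma phi) m') (mM : forall x, density sigma phi x <= M)
  (Lm' : L2 m').
Local Notation m := (density sigma phi).
Local Notation T := (rotated lambda sigma phi).
Local Notation a := (diag_coef lambda sigma phi).
Local Notation b := (conj_coef lambda sigma phi).
Hypothesis cu : forall t, 0 < t -> t < 1 -> curve_at u t (ham_slope (a t) (b t) (u t)).

Let s0 : 0 < sigma. Proof. by have := s2; lra. Qed.
Let m0 x : 0 <= m x. Proof. exact: density_ge0. Qed.

Definition rotated_re2 t := \int[mu]_x (re (T t (u t) x) ^+ 2).
Definition rotated_reim t := \int[mu]_x (re (T t (u t) x) * im (T t (u t) x)).
Definition density_reim t := \int[mu]_x (m x * (re (T t (u t) x) * im (T t (u t) x))).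
(** The weighted mass int m |u|^2 is written as a pairing in order to apply the product rule
to it. *)
Definition density_mass t := ip (u t) (fun x => (m x)%:C * u t x).
(** The only trace of the Laplacian in the slope of the weighted mass: grad u paired with the
commutator i m' u. *)
Definition current t := ip (grad (u t)) (fun x => 'i%C * ((m' x)%:C * u t x)).
(** The square of the modified energy, for a representative phi with absolutely continuous
density. *)
Definition energy t := 4^-1 * ip (grad (u t)) (grad (u t)) +
  t `^ (- sigma + delta) * ip (u t) (u t) +
  sigma * lambda * t `^ (sigma - 2) * rotated_re2 t.

Let Hu t : 0 < t -> t < 1 -> H1 (u t). Proof. by move=> t0 t1; case: (cu t0 t1). Qed.

Lemma rotated_normc t f x : re (T t f x) ^+ 2 + im (T t f x) ^+ 2 =
  m x * (re (f x) ^+ 2 + im (f x) ^+ 2).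
Proof.
rewrite -(normc_profile lambda phi t x s0 s1) normc_sqr /rotated !reimE; ring.
Qed.

Lemma action_re_self c0 t (z : C) x : 
  re ((c0 * ((sigma + 1) * m x))%:C * z + (c0 * sigma)%:C * profile lambda sigma phi t x ^+ 2 * z^*%C) * re z +
  im ((c0 * ((sigma + 1) * m x))%:C * z + (c0 * sigma)%:C * profile lambda sigma phi t x ^+ 2 * z^*%C) * im z =
  c0 * (m x * (re z ^+ 2 + im z ^+ 2) + 2 * sigma * re ((profile lambda sigma phi t x)^*%C * z) ^+ 2).
Proof.
rewrite -(normc_profile lambda phi t x s0 s1) normc_sqr.
by case: (profile _ _ _ t x) => k1 k2; case: z => z1 z2 /=; ring.
Qed.

Lemma action_im_self t f x :
  re (action (a t) (b t) f x) * re ('i%C * f x) + im (action (a t) (b t) f x) * im ('i%C * f x) =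
  (- 2 * lambda * sigma * t `^ (sigma - 2)) * (re (T t f x) * im (T t f x)).
Proof.
rewrite /action /diag_coef /conj_coef /rotated re_iM im_iM.
by case: (profile _ _ _ t x) => k1 k2; case: (f x) => z1 z2 /=; ring.
Qed.

Lemma action'_re_self t f x :
  re (action (diag_coef' lambda sigma phi t) (conj_coef' lambda sigma phi t) f x) * re (f x) +
  im (action (diag_coef' lambda sigma phi t) (conj_coef' lambda sigma phi t) f x) * im (f x) =
  lambda * ((sigma - 2) * t `^ (sigma - 3)) *
    (m x * (re (f x) ^+ 2 + im (f x) ^+ 2) + 2 * sigma * re (T t f x) ^+ 2)
  + (- 4 * lambda ^+ 2 * sigma * (t `^ (sigma - 2)) ^+ 2) * (m x * (re (T t f x) * im (T t f x))).
Proof.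
rewrite /action /diag_coef' /conj_coef' /rotated.
have := normc_profile lambda phi t x s0 s1; rewrite normc_sqr.
move: (m x) (_ `^ (sigma - 3)) (_ `^ (sigma - 2)) => d A B <-.
by case: (profile _ _ _ t x) => k1 k2; case: (f x) => z1 z2 /=; ring.
Qed.

Lemma rotated_itg t : 0 < t -> t < 1 ->
  [/\ itg setT (fun x => re (T t (u t) x) ^+ 2),
      itg setT (fun x => im (T t (u t) x) ^+ 2),
      itg setT (fun x => re (T t (u t) x) * im (T t (u t) x)) &
      itg setT (fun x => m x * (re (T t (u t) x) * im (T t (u t) x)))].
Proof.
move=> t0 t1.
have [L1 L2'] := rotated_L2c lambda s2 s1 m1 m2 mM t (H1_L2c (Hu t0 t1)).
split; [exact: L1.2|exact: L2'.2|exact: L2_itgM|].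
under eq_fun do rewrite mulrA.
apply: L2_itgM => //; apply: L2Mb L1; first exact: abscont_measurable am.
by move=> x; rewrite ger0_norm; [exact: mM|].
Qed.

Lemma density_mass_itg t : 0 < t -> t < 1 ->
  itg setT (fun x => m x * (re (u t x) ^+ 2 + im (u t x) ^+ 2)).
Proof.
move=> t0 t1; have Lu := H1_L2c (Hu t0 t1).
have := L2c_itg Lu (L2c_mult am m0 mM Lu).
by apply: eq_itg => // x _; rewrite !reimE; ring.
Qed.

Lemma density_massE t : density_mass t = \int[mu]_x (m x * (re (u t x) ^+ 2 + im (u t x) ^+ 2)).
Proof. by apply: eq_Rintegral => x _; rewrite !reimE; ring. Qed.

Lemma ip_action_self t : 0 < t -> t < 1 ->
  ip (action (a t) (b t) (u t)) (u t) =
  lambda * t `^ (sigma - 2) * (density_mass t + 2 * sigma * rotated_re2 t).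
Proof.
move=> t0 t1; have [i1 i2 i3 i4] := rotated_itg t0 t1; have iw := density_mass_itg t0 t1.
rewrite density_massE /rotated_re2 -(RintegralZl _ measurableT i1) -RintegralD//; last exact: itgZ.
rewrite -RintegralZl//; last by apply: itgD => //; exact: itgZ.
by apply: eq_Rintegral => x _; rewrite /action /diag_coef /conj_coef action_re_self.
Qed.

Lemma ip_action_i t : 0 < t -> t < 1 ->
  ip (action (a t) (b t) (u t)) (fun x => 'i%C * u t x) =
  - 2 * lambda * sigma * t `^ (sigma - 2) * rotated_reim t.
Proof.
move=> t0 t1; have [i1 i2 i3 i4] := rotated_itg t0 t1.
rewrite /rotated_reim -(RintegralZl _ measurableT i3).
by apply: eq_Rintegral => x _; exact: action_im_self.
Qed.

Lemma ip_action_im t : 0 < t -> t < 1 ->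
  ip (action (a t) (b t) (u t)) (fun x => 'i%C * ((m x)%:C * u t x)) =
  - 2 * lambda * sigma * t `^ (sigma - 2) * density_reim t.
Proof.
move=> t0 t1; have [i1 i2 i3 i4] := rotated_itg t0 t1.
rewrite /density_reim -(RintegralZl _ measurableT i4).
apply: eq_Rintegral => x _; rewrite [RHS]mulrCA -action_im_self.
by rewrite !re_iM !im_iM !reM !imM re_real im_real; ring.
Qed.

Lemma ip_action' t : 0 < t -> t < 1 ->
  ip (action (diag_coef' lambda sigma phi t) (conj_coef' lambda sigma phi t) (u t)) (u t) =
  lambda * ((sigma - 2) * t `^ (sigma - 3)) * (density_mass t + 2 * sigma * rotated_re2 t)
  - 4 * lambda ^+ 2 * sigma * (t `^ (sigma - 2)) ^+ 2 * density_reim t.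
Proof.
move=> t0 t1; have [i1 i2 i3 i4] := rotated_itg t0 t1; have iw := density_mass_itg t0 t1.
rewrite -!mulNr density_massE /rotated_re2 /density_reim -(RintegralZl _ measurableT i1).
have iz := itgZ (2 * sigma) measurableT i1.
rewrite -(RintegralD measurableT iw iz) -(RintegralZl _ measurableT (itgD measurableT iw iz)).
rewrite -(RintegralZl _ measurableT i4) -RintegralD//; [|exact/itgZ/itgD|exact: itgZ].
by apply: eq_Rintegral => x _; exact: action'_re_self.
Qed.

Lemma ham_slope_self t : 0 < t -> t < 1 -> ham_slope (a t) (b t) (u t) (u t) =
  - 2 * lambda * sigma * t `^ (sigma - 2) * rotated_reim t.
Proof.
by move=> t0 t1; rewrite /ham_slope ip_i_self mulr0 add0r ip_action_i.
Qed.

(** In the pairing of grad u with i grad (m u) the part i m grad u is orthogonal to grad u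
pointwise, which leaves the current. *)
Lemma ham_slope_mult t : 0 < t -> t < 1 ->
  ham_slope (a t) (b t) (u t) (fun x => (m x)%:C * u t x) =
  2^-1 * current t - 2 * lambda * sigma * t `^ (sigma - 2) * density_reim t.
Proof.
move=> t0 t1; rewrite /ham_slope ip_action_im// -!mulNr; congr (_ * _ + _).
have H := Hu t0 t1; have Lg := grad_L2c H; have L' := L2c_mult' am m0 mM Lm' H.
have Lmg := L2c_mult am m0 mM Lg.
have gE : {ae mu, forall x, 'i%C * grad (fun x => (m x)%:C * u t x) x =
    'i%C * ((m x)%:C * grad (u t) x) + 'i%C * ((m' x)%:C * u t x)}.
  have := csobolev_grad (csobolev_mult am m0 mM Lm' H).
  by apply: ae_impl => x ->; rewrite mulrDr.
have Hm := csobolev_H1 (csobolev_mult am m0 mM Lm' H).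
have LX := L2cZ 'i%C Lmg; have LY := L2cZ 'i%C L'.
rewrite (ip_ae Lg (L2cZ 'i%C (grad_L2c Hm)) Lg (L2cD LX LY) (aeW _ (fun=> erefl)) gE).
rewrite (ipDr Lg LX LY) -/(current t) [X in X + _](_ : _ = 0) ?add0r//.
rewrite /ip (@eq_Rintegral _ _ _ _ _ (fun=> 0)) ?Rintegral_cst ?mul0r//.
by move=> x _; rewrite !re_iM !im_iM !reimE; ring.
Qed.

Lemma has_slope_local (f g : R -> R) s d df : 0 < d ->
  (forall t, `|t - s| < d -> f t = g t) -> has_slope f s df -> has_slope g s df.
Proof.
move=> d0 fg H e e0; have [eta eta0 Heta] := H e e0.
exists (Num.min eta d); first by rewrite lt_min eta0.
move=> t; rewrite lt_min => /andP[t1 t2].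
by rewrite -!fg ?subrr ?normr0//; exact: Heta.
Qed.

(** The energy is half of the quadratic form of the equation, minus half of the weighted mass
times lambda t^(sigma-2), plus the mass times t^(delta-sigma).  With Y and Z the
real and the imaginary part of conj k u, the integrals of m Y Z produced by the rotation
of k and by the slope of the weighted mass cancel, and so do the terms in the weighted
mass itself. *)
Lemma energy_has_slope s : 0 < s -> s < 1 -> has_slope energy s
  (- (lambda * sigma * (2 - sigma) * s `^ (sigma - 3) * rotated_re2 s)
   - 2^-1 * lambda * s `^ (sigma - 2) * current s
   - (sigma - delta) * s `^ (- sigma + delta - 1) * ip (u s) (u s)
   - 4 * lambda * sigma * s `^ (sigma - 2) * s `^ (- sigma + delta) * rotated_reim s).
Proof.
move=> sp sl.
pose d := Num.min s (1 - s).
have d0 : 0 < d by rewrite lt_min sp subr_gt0.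
have dP t : `|t - s| < d -> 0 < t /\ t < 1.
  rewrite lt_min => /andP[ts1 ts2].
  by move: ts1 ts2; rewrite !ltr_norml => /andP[? ?] /andP[? ?]; split; lra.
have [M' M'0 bc'] := coef'_bounded l0 s2 s1 m1 m2 mM s.
have SE : has_slope (fun t => 2^-1 * ip (grad (u t)) (grad (u t)) +
    ip (action (a t) (b t) (u t)) (u t)) s
    (ip (action (diag_coef' lambda sigma phi s) (conj_coef' lambda sigma phi s) (u s)) (u s)).
  apply: (@energy_slope _ _ _ _ _ u s d M'
    (fun t => s2val (cid2 (coef_bounded l0 s2 s1 m1 m2 mM t))) d0 M'0 bc').
  - by move=> t _; case: (cid2 _).
  - by move=> t /dP[t0 t1]; exact: cu.
  - exact: coef_approx.
have SN : has_slope (fun t => ip (u t) (u t)) s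
   (ham_slope (a s) (b s) (u s) (u s) + ham_slope (a s) (b s) (u s) (u s)).
  exact: curve_at_ip (cu sp sl) (cu sp sl).
have [K0 K00 HK] := H1_mult am m0 mM Lm'.
have mabs x : `|m x| <= M by rewrite ger0_norm; [exact: mM|].
have SW : has_slope density_mass s (ham_slope (a s) (b s) (u s) (fun x => (m x)%:C * u s x) +
   ham_slope (a s) (b s) (u s) (fun x => (m x)%:C * u s x)).
  exact: curve_at_ip (cu sp sl) (curve_atM (abscont_measurable am) mabs K00 HK (cu sp sl)).
rewrite ham_slope_self// in SN; rewrite ham_slope_mult// in SW.
rewrite ip_action'// in SE.
have P1 := powR_slope (sigma - 2) sp; have P2 := powR_slope (- sigma + delta) sp.
rewrite (_ : sigma - 2 - 1 = sigma - 3) in P1; last by lra.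
have S1 := has_slopeZ (2^-1) SE.
have S2 := has_slopeZ (- 2^-1 * lambda) (has_slopeM P1 SW).
have S3 := has_slopeM P2 SN.
have S := has_slopeD (has_slopeD S1 S2) S3.
have E t : `|t - s| < d -> 2^-1 * (2^-1 * ip (grad (u t)) (grad (u t)) +
    ip (action (a t) (b t) (u t)) (u t)) + - 2^-1 * lambda * (t `^ (sigma - 2) * density_mass t) +
    t `^ (- sigma + delta) * ip (u t) (u t) = energy t.
  move=> /dP[t0 t1]; rewrite ip_action_self// /energy.
  by move: (rotated_re2 t) (density_mass t) (ip _ _) (ip _ _) (t `^ _) (t `^ _) => *; field.
have := has_slope_local d0 E S; congr has_slope.
move: (rotated_re2 s) (density_mass s) (rotated_reim s) (density_reim s) (current s) (ip _ _) (s `^ _) (s `^ _) (s `^ _) (s `^ _).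
by move=> *; field.
Qed.

End EnergySlope.

(** * The differential inequality and its integration *)

Section Gronwall.
Context {R : realType}.
Implicit Types (t x y A B p : R).

Lemma young A B p x : 0 <= A -> 0 <= B -> 0 < p -> x ^+ 2 <= A * B ->
  x <= p * A + (4 * p)^-1 * B.
Proof.
move=> A0 B0 p0 xAB; apply: le_trans (ler_norm x) _.
have q0 : 0 <= (4 * p)^-1 by rewrite invr_ge0 mulr_ge0// ltW.
have r0 : 0 <= p * A + (4 * p)^-1 * B by rewrite addr_ge0// mulr_ge0// ltW.
rewrite -(ler_pXn2r (ltn0Sn 1)) ?nnegrE// real_normK ?num_real//.
apply: le_trans xAB _; rewrite -subr_ge0.
have -> : (p * A + (4 * p)^-1 * B) ^+ 2 - A * B = (p * A - (4 * p)^-1 * B) ^+ 2.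
  have pE : 4 * (p * (4 * p)^-1) = 1 by field; rewrite gt_eqF.
  have E : A * B = 4 * (p * (4 * p)^-1) * (A * B) by rewrite pE mul1r.
  by rewrite [X in _ - X]E; ring.
exact: sqr_ge0.
Qed.

(** The function E exp(- K t^al / al) is nonincreasing; the exponential is bounded below by a
positive constant since t^al <= 1. *)
Lemma gronwall_powR (E E' : R -> R) (al K s0 r s : R) : 0 < al -> 0 <= K -> s0 < 1 ->
  (forall t, 0 < t -> t <= s0 -> has_slope E t (E' t)) ->
  (forall t, 0 < t -> t <= s0 -> 0 <= E t) ->
  (forall t, 0 < t -> t <= s0 -> E' t <= K * t `^ (al - 1) * E t) ->
  0 < r -> r <= s -> s <= s0 -> E s <= expR (K / al) * E r.
Proof.
move=> al0 K0 s01 HE E0 HE' r0 rs ss.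
pose w t := expR (- (K / al) * t `^ al).
have rng t : t \in `[r, s]%R -> 0 < t /\ t <= s0.
  by rewrite in_itv /= => /andP[rt ts]; split; [exact: lt_le_trans rt|exact: le_trans ts ss].
have Sw t : t \in `[r, s]%R -> has_slope w t (w t * (- K * t `^ (al - 1))).
  move=> /rng[t0 _].
  have Sx : has_slope (@expR R) (- (K / al) * t `^ al) (w t).
    by apply/has_slopeP; exact: is_derive_expR.
  have := @has_slope_comp _ expR (fun t => - (K / al) * t `^ al) t _ _ Sx (has_slopeZ (- (K / al)) (powR_slope al t0)).
  congr has_slope; congr (_ * _); field; exact: lt0r_neq0.
have dec : E s * w s <= E r * w r.
  apply: (@slope_le0 _ (fun t => E t * w t) _ r s rs) => t trs.
    by have [t0 ts] := rng t trs; exact: has_slopeM (HE t t0 ts) (Sw t trs).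
  have [t0 ts] := rng t trs.
  rewrite (_ : _ + _ = w t * (E' t - K * t `^ (al - 1) * E t)); last by ring.
  by rewrite mulr_ge0_le0 ?expR_ge0// subr_le0 HE'.
have s0' : 0 < s by exact: lt_le_trans rs.
have wr : w r <= 1.
  by rewrite -expR0 ler_expR mulNr oppr_le0 mulr_ge0 ?powR_ge0 ?divr_ge0// ltW.
have ws : expR (- (K / al)) <= w s.
  rewrite ler_expR mulNr lerN2 ler_piMr ?divr_ge0 ?(ltW al0)//.
  rewrite -(powRr0 s); apply: ger_powR; last exact: ltW.
  by rewrite s0'/= (le_trans ss)// ltW.
have Er : 0 <= E r by apply: E0 => //; exact: le_trans rs ss.
have Es : 0 <= E s by apply: E0.
have : E s * expR (- (K / al)) <= E r.
  apply: le_trans (ler_wpM2l Es ws) (le_trans dec _).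
  exact: ler_piMr Er wr.
by rewrite expRN ler_pdivrMr ?expR_gt0// mulrC.
Qed.

(** With P = t^(delta-sigma), the term in X is at most the dissipative term in Y plus
C t^(delta-1) P B^2, by Young's inequality with the weight that matches the
dissipative term.  The term in J is split into t^(al-1) G^2 / 4 and C t^(2 sigma - 3 - al) S;
the two summands of S are compared with P B^2 and with the product
(P^(1/2) B) G, both controlled by the energy.  The two hypotheses on al, ell, k are what
the comparison of the powers of t requires. *)
Lemma slope_bound (lambda sigma delta M D W ell k al t G B Y X J S : R) :
  0 < lambda -> 0 < sigma -> sigma <= 1 -> delta <= sigma -> al <= delta ->
  2 * ell + 2 * al <= 3 * sigma - 2 - delta ->
  4 * al <= 5 * sigma - 4 - delta + 2 * k ->
  0 < t <= 1 -> 0 <= G -> 0 <= B -> 0 <= Y -> 0 <= M -> 0 <= D -> 0 <= W ->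
  X ^+ 2 <= Y * (M * B ^+ 2) -> 0 <= S -> J ^+ 2 <= G ^+ 2 * S ->
  S <= D * (t `^ (- (2 * ell)) * B ^+ 2 + t `^ k * (4 * (B * G)) * W) ->
  - (lambda * sigma * (2 - sigma) * t `^ (sigma - 3) * Y)
   - 2^-1 * lambda * t `^ (sigma - 2) * J
   - (sigma - delta) * t `^ (- sigma + delta - 1) * B ^+ 2
   - 4 * lambda * sigma * t `^ (sigma - 2) * t `^ (- sigma + delta) * X
  <= (1 + 4 * lambda * sigma * M + lambda ^+ 2 / 4 * D * (1 + 4 * W)) * t `^ (al - 1) *
    (4^-1 * G ^+ 2 + t `^ (- sigma + delta) * B ^+ 2).
Proof.
move=> l0 s0 s1 ds ald c1 c2 t01 G0 B0 Y0 M0 D0 W0 HX S0 HJ HS.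
have /andP[t0 t1] := t01.
pose P := t `^ (- sigma + delta); pose q := t `^ (sigma - 2).
pose c := t `^ (sigma - 3); pose b := t `^ (al - 1).
have P0 : 0 < P by exact: powR_gt0.
have q0 : 0 < q by exact: powR_gt0.
have c0 : 0 < c by exact: powR_gt0.
have b0 : 0 < b by exact: powR_gt0.
have s20 : 0 < 2 - sigma by lra.
have N0 : 0 <= B ^+ 2 by exact: sqr_ge0.
have tn0 : t != 0 by rewrite gt_eqF.
pose F := 4^-1 * G ^+ 2 + P * B ^+ 2.
have PN : 0 <= P * B ^+ 2 by rewrite mulr_ge0// ltW.
have GG : 0 <= 4^-1 * G ^+ 2 by rewrite mulr_ge0// sqr_ge0.
have PNF : P * B ^+ 2 <= F by rewrite /F lerDr.
have F0 : 0 <= F by rewrite addr_ge0.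
have bF : 0 <= b * F by rewrite mulr_ge0// ltW.
have TX : 4 * lambda * sigma * q * P * - X <=
    lambda * sigma * (2 - sigma) * c * Y + 4 * lambda * sigma * M * (b * F).
  (* this weight turns the first half into the dissipative term *)
  pose p := (2 - sigma) * c / (4 * (q * P)).
  have qP : 0 < q * P by exact: mulr_gt0.
  have p0 : 0 < p by rewrite divr_gt0 ?mulr_gt0.
  have MN : 0 <= M * B ^+ 2 by exact: mulr_ge0.
  have := young Y0 MN p0 (x := - X); rewrite sqrrN => /(_ HX) HY.
  have k0 : 0 <= 4 * lambda * sigma * q * P by rewrite !mulr_ge0// ltW.
  apply: le_trans (ler_wpM2l k0 HY) _.
  rewrite mulrDr; apply: lerD.
    by rewrite le_eqVlt; apply/orP; left; apply/eqP; rewrite /p; field; rewrite !gt_eqF.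
  have -> : 4 * lambda * sigma * q * P * ((4 * p)^-1 * (M * B ^+ 2)) =
    4 * lambda * sigma * M * (q * P * q / c * (2 - sigma)^-1 * (P * B ^+ 2)).
    by rewrite /p; field; rewrite !gt_eqF.
  apply: ler_wpM2l; first by rewrite !mulr_ge0// ltW.
  apply: ler_pM => //.
    by rewrite !mulr_ge0 ?invr_ge0// ltW.
  have cE : q * P * q / c <= b.
    rewrite -powRN /q /P /b -!powRD ?tn0 ?implybT//.
    by apply: ger_powR => //; lra.
  apply: le_trans cE; rewrite ler_piMr ?mulr_ge0 ?invr_ge0// ?(ltW P0) ?(ltW q0) ?(ltW c0)//.
  by rewrite invf_le1//; lra.
have TJ : 2^-1 * lambda * q * - J <= b * F + lambda ^+ 2 / 4 * D * (1 + 4 * W) * (b * F).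
  (* this weight turns the first half into b G^2 / 4 *)
  pose p := b / (2 * lambda * q).
  have p0 : 0 < p by rewrite divr_gt0 ?mulr_gt0.
  have := young (sqr_ge0 G) S0 p0 (x := - J); rewrite sqrrN => /(_ HJ) HY.
  have k0 : 0 <= 2^-1 * lambda * q by rewrite !mulr_ge0// ?invr_ge0// ltW.
  apply: le_trans (ler_wpM2l k0 HY) _.
  rewrite mulrDr; apply: lerD.
    rewrite (_ : 2^-1 * lambda * q * (p * G ^+ 2) = b * (4^-1 * G ^+ 2)); last by rewrite /p; field; rewrite !gt_eqF.
    by rewrite ler_wpM2l ?(ltW b0)// /F lerDl.
  have -> : 2^-1 * lambda * q * ((4 * p)^-1 * S) = lambda ^+ 2 / 4 * (q * q / b * S).
    by rewrite /p; field; rewrite !gt_eqF.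
  rewrite [leRHS](_ : _ = lambda ^+ 2 / 4 * (D * ((1 + 4 * W) * (b * F)))); last by ring.
  apply: ler_wpM2l; first by rewrite divr_ge0// sqr_ge0.
  have qb : 0 <= q * q / b by rewrite !mulr_ge0 ?invr_ge0// ltW.
  apply: le_trans (ler_wpM2l qb HS) _.
  rewrite mulrCA; apply: ler_wpM2l => //.
  rewrite [leRHS](_ : _ = b * F + 4 * W * (b * F)); last by ring.
  rewrite [leLHS]mulrDr; apply: lerD.
    rewrite mulrA; apply: le_trans (_ : b * P * B ^+ 2 <= _); last first.
      by rewrite -mulrA ler_wpM2l// ltW.
    rewrite ler_wpM2r// -powRN /q /P /b -!powRD ?tn0 ?implybT//.
    by apply: ger_powR => //; lra.
  pose h := t `^ ((delta - sigma) / 2).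
  have h0 : 0 <= h by exact: powR_ge0.
  have hBG : h * (B * G) <= F.
    have hh : h * h = P.
      by rewrite /h /P -powRD ?tn0 ?implybT//; congr powR; field.
    by rewrite -subr_ge0 /F -hh (_ : _ - _ = (2^-1 * G - h * B) ^+ 2) ?sqr_ge0//; field.
  have BG : 0 <= B * G by exact: mulr_ge0.
  rewrite (_ : q * q / b * (t `^ k * (4 * (B * G)) * W) = 4 * W * (q * q / b * t `^ k * (B * G))); last by ring.
  apply: ler_wpM2l; first exact: mulr_ge0.
  apply: le_trans (ler_wpM2l (ltW b0) hBG); rewrite [leRHS]mulrA ler_wpM2r//.
  rewrite -powRN /q /h /b -!powRD ?tn0 ?implybT//.
  by apply: ger_powR => //; lra.
have TN : 0 <= (sigma - delta) * t `^ (- sigma + delta - 1) * B ^+ 2.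
  by rewrite !mulr_ge0 ?powR_ge0// subr_ge0.
rewrite -/P -/q -/c -/b -/F.
move: TX TJ TN; move: (_ * B ^+ 2) => n TX TJ TN.
rewrite (_ : (1 + _ + _) * b * F = 4 * lambda * sigma * M * (b * F) +
  (b * F + lambda ^+ 2 / 4 * D * (1 + 4 * W) * (b * F))); last by ring.
rewrite !mulrN in TX TJ.
move: TX TJ TN; move: (4 * lambda * sigma * M * _) (b * F + _) (_ * X) (_ * J) (_ * Y).
by clear => *; lra.
Qed.

End Gronwall.

Section Bounds.
Context {R : realType}.
Local Notation mu := (@lebesgue_measure R).
Local Notation C := R[i].
Local Notation re := (@complex.Re R).
Local Notation im := (@complex.Im R).

(** Cauchy-Schwarz, where the imaginary part of conj k u is bounded by |k| |u|. *)
Lemma rotated_reim_sqr_le (lambda sigma : R) phi M u t :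
  2^-1 < sigma -> sigma <= 1 -> measurable_fun setT (fun x => re (phi x)) ->
  measurable_fun setT (fun x => im (phi x)) ->
  (forall x, density sigma phi x <= M) -> L2c (u t) ->
  rotated_reim lambda sigma phi u t ^+ 2 <= rotated_re2 lambda sigma phi u t * (M * norm2 (u t) ^+ 2).
Proof.
move=> s2 s1 m1 m2 mM Lu.
have s0 : 0 < sigma by lra.
have [L1 L2'] := rotated_L2c lambda s2 s1 m1 m2 mM t Lu.
apply: le_trans (L2_CS L1 L2') _.
apply: ler_wpM2l; first by apply: Rintegral_ge0 => x _; exact: sqr_ge0.
rewrite norm2_sqr// -RintegralZl//; last exact: L2c_itg.
apply: ae_le_Rintegral; first exact: L2'.2.
  by apply: itgZ => //; exact: L2c_itg.
apply: aeW => x; rewrite -!expr2.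
apply: le_trans (_ : density sigma phi x * (re (u t x) ^+ 2 + im (u t x) ^+ 2) <= _).
  by rewrite -(rotated_normc lambda phi s2 s1 t) lerDr sqr_ge0.
by rewrite ler_wpM2r// addr_ge0// sqr_ge0.
Qed.

(** The part of m'^2 that is only integrable meets the sup bound of |f|^2, the bounded part
meets the norm of f. *)
Lemma norm2_weighted_le (m' w : R -> R) (D p q : R) f : H1 f -> 0 <= D -> 0 <= q ->
  L2c (fun x => (m' x)%:C * f x) -> itg setT w -> (forall x, 0 <= w x) ->
  {ae mu, forall x, m' x ^+ 2 <= D * (p + q * w x)} ->
  norm2 (fun x => (m' x)%:C * f x) ^+ 2 <=
  D * (p * norm2 f ^+ 2 + q * (4 * (norm2 f * norm2 (grad f))) * \int[mu]_x w x).
Proof.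
move=> Hf D0 q0 Lm Iw w0 lev; have Lf := H1_L2c Hf; have If := L2c_itg Lf Lf.
rewrite norm2_sqr// (norm2_sqr Lf).
set BG := norm2 f * norm2 (grad f).
have Ip := itgZ p measurableT If; have Iq := itgZ (q * (4 * BG)) measurableT Iw.
rewrite -(RintegralZl p measurableT If) -(RintegralZl (q * (4 * BG)) measurableT Iw).
rewrite -(RintegralD measurableT Ip Iq) -(RintegralZl D measurableT (itgD measurableT Ip Iq)).
apply: ae_le_Rintegral; first exact: L2c_itg.
  exact/itgZ/itgD.
apply: ae_impl2 lev (H1_sup Hf) => x Hm Hs.
rewrite !reimE !mul0r subr0 addr0 -/BG in Hs *.
have -> : m' x * re (f x) * (m' x * re (f x)) + m' x * im (f x) * (m' x * im (f x)) =
  m' x ^+ 2 * (re (f x) ^+ 2 + im (f x) ^+ 2) by ring.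
have n0 : 0 <= re (f x) ^+ 2 + im (f x) ^+ 2 by rewrite addr_ge0// sqr_ge0.
apply: le_trans (ler_wpM2r n0 Hm) _.
rewrite -[leLHS]mulrA; apply: ler_wpM2l => //; rewrite [leLHS]mulrDl -!expr2 lerD2l.
rewrite [leRHS](_ : _ = q * w x * (4 * BG)); last by ring.
by apply: ler_wpM2l => //; exact: mulr_ge0.
Qed.

Lemma energy_growth (lambda sigma delta : R) phi (m' w : R -> R) (M D ell k al s0 : R)
    u r s :
  0 < lambda -> 2^-1 < sigma -> sigma <= 1 -> delta <= sigma -> 0 < al -> al <= delta ->
  2 * ell + 2 * al <= 3 * sigma - 2 - delta ->
  4 * al <= 5 * sigma - 4 - delta + 2 * k ->
  measurable_fun setT (fun x => re (phi x)) -> measurable_fun setT (fun x => im (phi x)) ->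
  abscont (density sigma phi) m' -> (forall x, density sigma phi x <= M) -> L2 m' ->
  0 <= D -> itg setT w -> (forall x, 0 <= w x) -> s0 < 1 ->
  (forall t, 0 < t -> t <= s0 ->
     {ae mu, forall x, m' x ^+ 2 <= D * (t `^ (- (2 * ell)) + t `^ k * w x)}) ->
  (forall t, 0 < t -> t < 1 ->
     curve_at u t (ham_slope (diag_coef lambda sigma phi t) (conj_coef lambda sigma phi t) (u t))) ->
  0 < r -> r <= s -> s <= s0 ->
  energy lambda sigma delta phi u s <=
    expR ((1 + 4 * lambda * sigma * M + lambda ^+ 2 / 4 * D * (1 + 4 * \int[mu]_x w x)) / al) *
    energy lambda sigma delta phi u r.
Proof.
move=> l0 s2 s1 ds al0 ald c1 c2 m1 m2 am mM Lm' D0 Iw w0 s01 lev cu.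
have sp : 0 < sigma by lra.
have M0 : 0 <= M by exact: le_trans (density_ge0 sigma phi 0) (mM 0).
have W0 : 0 <= \int[mu]_x w x by apply: Rintegral_ge0.
have K0 : 0 <= 1 + 4 * lambda * sigma * M + lambda ^+ 2 / 4 * D * (1 + 4 * \int[mu]_x w x).
  by rewrite !addr_ge0 ?mulr_ge0 ?divr_ge0 ?sqr_ge0 ?addr_ge0 ?mulr_ge0// ltW.
have Y0 t : 0 <= rotated_re2 lambda sigma phi u t by apply: Rintegral_ge0 => x _; exact: sqr_ge0.
have lo t : t <= s0 -> t < 1 by move=> ts; exact: le_lt_trans ts s01.
have F_le t : 0 < t -> t <= s0 ->
    0 <= 4^-1 * norm2 (grad (u t)) ^+ 2 + t `^ (- sigma + delta) * norm2 (u t) ^+ 2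
      <= energy lambda sigma delta phi u t.
  move=> t0 ts; have [Ht _ _ _] := cu t t0 (lo t ts).
  rewrite /energy -(norm2_sqr (H1_L2c Ht)) -(norm2_sqr (grad_L2c Ht)).
  apply/andP; split; last by rewrite lerDl !mulr_ge0 ?powR_ge0// ltW.
  by apply: addr_ge0; apply: mulr_ge0; rewrite ?invr_ge0 ?powR_ge0 ?sqr_ge0.
apply: (gronwall_powR al0 K0 s01).
- move=> t t0 ts; exact: (energy_has_slope delta l0 s2 s1 m1 m2 am mM Lm' cu t0 (lo t ts)).
- by move=> t t0 ts; have /andP[h1 h2] := F_le t t0 ts; exact: le_trans h1 h2.
move=> t t0 ts; have /andP[F0 FE] := F_le t t0 ts.
have tl := lo t ts; have [Ht _ _ _] := cu t t0 tl.
have Lu := H1_L2c Ht; have Lg := grad_L2c Ht.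
have L' := L2c_mult' am (density_ge0 sigma phi) mM Lm' Ht.
apply: le_trans (ler_wpM2l _ FE); last by rewrite mulr_ge0 ?powR_ge0.
rewrite -(norm2_sqr Lu).
apply: (@slope_bound _ lambda sigma delta M D _ ell k al t _ _ _ _ _
  (norm2 (fun x => (m' x)%:C * u t x) ^+ 2)) => //.
- by rewrite t0 ltW.
- exact: norm2_ge0.
- exact: norm2_ge0.
- exact: (rotated_reim_sqr_le lambda s2 s1 m1 m2 mM Lu).
- exact: sqr_ge0.
- have LiJ := L2cZ 'i%C L'.
  have := ip_CS Lg LiJ.
  rewrite (norm2E LiJ) ip_ii -norm2E// => J.
  rewrite -exprMn -real_normK ?num_real//.
  by rewrite ler_pXn2r// nnegrE mulr_ge0// norm2_ge0.
- apply: norm2_weighted_le => //; [exact: powR_ge0|exact: lev].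
Qed.

End Bounds.

(** * From the propagator to a curve *)

Section Solutions.
Context {R : realType}.
Local Notation mu := (@lebesgue_measure R).
Local Notation C := R[i].
Local Notation re := (@complex.Re R).
Local Notation im := (@complex.Im R).
Implicit Types (f g z : R -> C) (s t e : R).

Lemma near_unit_times s (P : R -> Prop) :
  (\forall t \near within unit_times (nbhs s), P t) <->
  exists2 eta : R, 0 < eta & forall t, `|t - s| < eta -> unit_times t -> P t.
Proof.
split=> [/nbhs_ballP[eta /= e0 H]|[eta e0 H]].
  by exists eta => // t ts; apply: H; rewrite /ball /= distrC.
by apply/nbhs_ballP; exists eta => //= t ts; apply: H; rewrite distrC.
Qed.

Lemma C_H1P (u : R -> R -> C) : C_H1 u <-> forall s, unit_times s ->
  H1 (u s) /\ forall e, 0 < e -> exists2 eta : R, 0 < eta & forall t, `|t - s| < eta ->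
    unit_times t -> normH1 (fun x => u t x - u s x) <= e.
Proof.
split=> H s us; have [Hs cont] := H s us; split=> //.
  move=> e e0; move/cvgrPdist_le: cont => /(_ e e0)/near_unit_times[eta eta0 K].
  exists eta => // t ts ut; have := K t ts ut.
  by rewrite sub0r normrN ger0_norm// sqrtr_ge0.
apply/cvgrPdist_le => e e0; apply/near_unit_times.
have [eta eta0 K] := cont e e0; exists eta => // t ts ut.
by rewrite sub0r normrN ger0_norm ?sqrtr_ge0// K.
Qed.

(** When the positive and the negative part both have infinite integrals, the two sides are
0 by convention. *)
Lemma Rintegral_opp (p : R -> R) : \int[mu]_x (- p x) = - \int[mu]_x p x.
Proof.
rewrite /Rintegral integralE [in RHS]integralE.
have -> : (fun x => (- p x)%:E) = (\- (EFin \o p))%E by [].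
rewrite funeposN funenegN.
have := @integral_ge0 _ _ R mu setT ((EFin \o p)^\+)%E (fun x _ => funepos_ge0 _ x).
have := @integral_ge0 _ _ R mu setT ((EFin \o p)^\-)%E (fun x _ => funeneg_ge0 _ x).
case: (\int[mu]_x _)%E => [a| |] //; case: (\int[mu]_x _)%E => [b| |] //= _ _; rewrite ?oppr0//.
by rewrite opprB.
Qed.

Lemma dual_ofN f g : dual_of (fun x => - f x) g = - dual_of f g.
Proof.
rewrite !dual_ofE; apply: complex_eq; rewrite /= -Rintegral_opp;
  by apply: eq_Rintegral => x _; rewrite !reimE; ring.
Qed.

Lemma dual_of_conj f g :
  dual_of (fun x => (f x)^*%C) g = (dual_of f (fun x => (g x)^*%C))^*%C.
Proof.
rewrite !dual_ofE; apply: complex_eq; rewrite /=.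
  by apply: eq_Rintegral => x _; rewrite !reimE mulNr mulrN.
rewrite -Rintegral_opp; apply: eq_Rintegral => x _.
by case: (f x) => a b; case: (g x) => c d /=; ring.
Qed.

Lemma laplacian_conj f g : H1 f -> H1 g ->
  laplacian (fun x => (f x)^*%C) g = (laplacian f (fun x => (g x)^*%C))^*%C.
Proof.
move=> Hf Hg.
have -> : (laplacian f (fun x => (g x)^*%C))^*%C =
  - (dual_of (grad f) (grad (fun x => (g x)^*%C)))^*%C.
  by apply: complex_eq; rewrite ?reimE.
have -> : laplacian (fun x => (f x)^*%C) g = - dual_of (grad (fun x => (f x)^*%C)) (grad g) by [].
congr (- _).
have gf := csobolev_grad (csobolev_conj (H1_csobolev Hf)).
have gg := csobolev_grad (csobolev_conj (H1_csobolev Hg)).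
have Lf := grad_L2c Hf; have Lg := grad_L2c Hg.
have Lf' := grad_L2c (H1_conj Hf); have Lg' := grad_L2c (H1_conj Hg).
have r0 (h : R -> C) : {ae mu, forall x, h x = h x} by exact: aeW.
have ri (h k : R -> C) : {ae mu, forall x, h x = k x} -> {ae mu, forall x, 'i%C * h x = 'i%C * k x}.
  by apply: ae_impl => x ->.
rewrite !dual_ofE (ip_ae Lf' Lg (L2c_conj Lf) Lg gf (r0 _)).
rewrite (ip_ae Lf' (L2cZ _ Lg) (L2c_conj Lf) (L2cZ _ Lg) gf (r0 _)).
rewrite (ip_ae Lf Lg' Lf (L2c_conj Lg) (r0 _) gg).
rewrite (ip_ae Lf (L2cZ _ Lg') Lf (L2cZ _ (L2c_conj Lg)) (r0 _) (ri _ _ gg)).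
by rewrite -!dual_ofE dual_of_conj.
Qed.

Variables (lambda sigma : R) (phi : R -> C).

(** The symmetry of the equation that fixes the pairs of the form (f, conj f). *)
Definition swap (Psi : state (R := R)) : state := (fun x => (Psi.2 x)^*%C, fun x => (Psi.1 x)^*%C).

Lemma hamiltonian_swap1 s Psi z : H1 Psi.2 -> H1 z ->
  - 'i%C * (hamiltonian lambda sigma phi s (swap Psi)).1 z =
  (- 'i%C * (hamiltonian lambda sigma phi s Psi).2 (fun x => (z x)^*%C))^*%C.
Proof.
move=> H2 Hz.
pose V x := - sigma%:C * (pot_off lambda sigma phi s x)^*%C * Psi.1 x
  - (sigma + 1)%:C * pot_diag sigma phi x * Psi.2 x.
have VE : (fun x => (sigma + 1)%:C * pot_diag sigma phi x * (Psi.2 x)^*%C +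
    sigma%:C * pot_off lambda sigma phi s x * (Psi.1 x)^*%C) = (fun x => (- V x)^*%C).
  apply/funext => x; rewrite /V /pot_diag.
  move: (_ `^ _) (pot_off _ _ _ _ _) (Psi.1 x) (Psi.2 x) => d [p1 p2] [a1 a2] [b1 b2].
  by apply: complex_eq; rewrite /=; ring.
rewrite /hamiltonian /fst /snd /swap VE laplacian_conj// dual_of_conj dual_ofN -/V.
move: (laplacian _ _) (dual_of _ _) (lambda * _) => [a1 a2] [b1 b2] c.
by apply: complex_eq; rewrite /=; ring.
Qed.

Lemma hamiltonian_swap2 s Psi z : H1 Psi.1 -> H1 z ->
  - 'i%C * (hamiltonian lambda sigma phi s (swap Psi)).2 z =
  (- 'i%C * (hamiltonian lambda sigma phi s Psi).1 (fun x => (z x)^*%C))^*%C.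
Proof.
move=> H2 Hz.
pose V x := (sigma + 1)%:C * pot_diag sigma phi x * Psi.1 x +
  sigma%:C * pot_off lambda sigma phi s x * Psi.2 x.
have VE : (fun x => - sigma%:C * (pot_off lambda sigma phi s x)^*%C * (Psi.2 x)^*%C
    - (sigma + 1)%:C * pot_diag sigma phi x * (Psi.1 x)^*%C) = (fun x => (- V x)^*%C).
  apply/funext => x; rewrite /V /pot_diag.
  move: (_ `^ _) (pot_off _ _ _ _ _) (Psi.1 x) (Psi.2 x) => d [p1 p2] [a1 a2] [b1 b2].
  by apply: complex_eq; rewrite /=; ring.
rewrite /hamiltonian /fst /snd /swap VE laplacian_conj// dual_of_conj dual_ofN -/V.
move: (laplacian _ _) (dual_of _ _) (lambda * _) => [a1 a2] [b1 b2] c.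
by apply: complex_eq; rewrite /=; ring.
Qed.

Lemma C_H1_conj (u : R -> R -> C) : C_H1 u -> C_H1 (fun t x => (u t x)^*%C).
Proof.
move=> /C_H1P H; apply/C_H1P => s us; have [Hs cont] := H s us.
split; first exact: H1_conj.
move=> e /cont[eta eta0 K]; exists eta; first exact: eta0.
move=> t ts ut.
have [Ht _] := H t ut.
have -> : (fun x => (u t x)^*%C - (u s x)^*%C) = (fun x => (u t x - u s x)^*%C).
  by apply/funext => x; rewrite rmorphB.
by rewrite (normH1_conj (H1B Ht Hs)); exact: K.
Qed.

Lemma Hm1_conj (u : R -> R -> C) s (L L' : functional) :
  (forall z, H1 z -> L' z = (L (fun x => (z x)^*%C))^*%C) ->
  has_derivative_Hm1 (fun t => dual_of (u t)) s L ->
  has_derivative_Hm1 (fun t => dual_of (fun x => (u t x)^*%C)) s L'.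
Proof.
move=> LL H e e0; apply/near_unit_times.
have /near_unit_times[eta eta0 K] := H e e0; exists eta => // t ts ut z Hz.
have := K t ts ut _ (H1_conj Hz); rewrite (normH1_conj Hz); apply: le_trans.
rewrite !dual_of_conj (LL z Hz) le_eqVlt; apply/orP; left; apply/eqP.
move: (dual_of _ _) (dual_of _ _) (L _) => [a1 a2] [b1 b2] [c1 c2].
by rewrite !normc_sqrt /=; congr (Num.sqrt _); ring.
Qed.

Lemma solution_swap Psi : solution lambda sigma phi Psi ->
  solution lambda sigma phi (fun t => swap (Psi t)).
Proof.
move=> [c1 c2 HD]; split; [exact: (C_H1_conj c2)|exact: (C_H1_conj c1)|].
move=> s us; have [D1 D2] := HD s us.
have [h1 _] := (C_H1P _).1 c1 s us; have [h2 _] := (C_H1P _).1 c2 s us.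
split.
  by apply: Hm1_conj D2 => z Hz; exact: hamiltonian_swap1.
by apply: Hm1_conj D1 => z Hz; exact: hamiltonian_swap2.
Qed.

(** The swapped solution has the same initial data, so that uniqueness identifies the two. *)
Lemma propagator_conj U psi0 r t : is_propagator lambda sigma phi U ->
  unit_times r -> unit_times t -> H1 psi0 ->
  {ae mu, forall x, (U t r (vec psi0)).2 x = ((U t r (vec psi0)).1 x)^*%C}.
Proof.
move=> HU ur ut H0; have [sol [e1 e2] uniq] := HU r (vec psi0) ur H0 (H1_conj H0).
have e : ae_eq_state (swap (U r r (vec psi0))) (vec psi0).
  split.
    by apply: ae_impl e2 => x /= ->; apply: complex_eq; rewrite !reimE ?opprK.
  by apply: ae_impl e1 => x /= ->.
have [_] := uniq _ (solution_swap sol) e t ut.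
by apply: ae_impl => x /= <-.
Qed.

End Solutions.

Section Curve.
Context {R : realType}.
Local Notation mu := (@lebesgue_measure R).
Local Notation C := R[i].
Local Notation re := (@complex.Re R).
Local Notation im := (@complex.Im R).
Implicit Types (f g z : R -> C) (s t e : R).
Variables (lambda sigma : R) (phi phit : R -> C) (M : R).
Hypotheses (l0 : 0 < lambda) (s2 : 2^-1 < sigma) (s1 : sigma <= 1).
Hypotheses (m1 : measurable_fun setT (fun x => re (phi x)))
  (m2 : measurable_fun setT (fun x => im (phi x))).
Hypotheses (n1 : measurable_fun setT (fun x => re (phit x)))
  (n2 : measurable_fun setT (fun x => im (phit x))).
Hypotheses (mM : forall x, density sigma phit x <= M)
  (phiE : {ae mu, forall x, phi x = phit x}).

Let s0 : 0 < sigma. Proof. by have := s2; lra. Qed.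

Definition potential s (Psi : state (R := R)) x : C :=
  (sigma + 1)%:C * pot_diag sigma phi x * Psi.1 x + sigma%:C * pot_off lambda sigma phi s x * Psi.2 x.

(** This is where the second component is replaced by the conjugate of the first, and phi by
a representative. *)
Lemma potential_ae s (Psi : state (R := R)) : 0 < s ->
  {ae mu, forall x, Psi.2 x = (Psi.1 x)^*%C} ->
  {ae mu, forall x, potential s Psi x = ((lambda * s `^ (sigma - 2))^-1)%:C *
    action (diag_coef lambda sigma phit s) (conj_coef lambda sigma phit s) Psi.1 x}.
Proof.
move=> sp; apply: ae_impl2 phiE => x E E2.
have c0 : lambda * s `^ (sigma - 2) != 0 by rewrite gt_eqF// mulr_gt0// powR_gt0.
have pE : pot_off lambda sigma phi s x = profile lambda sigma phit s x ^+ 2.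
  by rewrite -pot_offE /pot_off /vp E.
have dE : pot_diag sigma phi x = (density sigma phit x)%:C by rewrite /pot_diag /density E.
rewrite /potential /action /diag_coef /conj_coef pE dE E2.
move: c0; move: (density _ _ _) (profile _ _ _ _ _ ^+ 2) (Psi.1 x) (lambda * _) => d [k1 k2] [a1 a2] c c0.
by apply: complex_eq; rewrite /=; field.
Qed.

Definition cmeasurable f := measurable_fun setT (fun x => re (f x)) /\
  measurable_fun setT (fun x => im (f x)).

Lemma cmeasurableM f g : cmeasurable f -> cmeasurable g -> cmeasurable (fun x => f x * g x).
Proof.
move=> [f1 f2] [g1 g2]; split.
  by under eq_fun do rewrite reM; apply: measurable_funB; exact: measurable_funM.
by under eq_fun do rewrite imM; apply: measurable_funD; exact: measurable_funM.
Qed.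

Lemma measurable_potential s (Psi : state (R := R)) : L2c Psi.1 -> L2c Psi.2 ->
  measurable_fun setT (fun x => re (potential s Psi x)) /\
  measurable_fun setT (fun x => im (potential s Psi x)).
Proof.
move=> [[a1 _] [a2 _]] [[b1 _] [b2 _]].
have k := measurable_profile lambda s1 m1 m2 s.
have d : cmeasurable (fun x => ((sigma + 1) * density sigma phi x)%:C).
  by split => //; apply: measurable_funM => //; exact: measurable_density.
have [p1 p2] := cmeasurableM d (conj a1 a2).
have [q1 q2] := cmeasurableM (cmeasurableM k k) (conj b1 b2).
have pE x : potential s Psi x = ((sigma + 1) * density sigma phi x)%:C * Psi.1 x +
    sigma%:C * (profile lambda sigma phi s x * profile lambda sigma phi s x * Psi.2 x).
  rewrite /potential pot_offE expr2 /pot_diag -/(density sigma phi x).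
  move: (density _ _ _) (profile _ _ _ _ _) (Psi.1 x) (Psi.2 x) => e [? ?] [? ?] [? ?].
  by apply: complex_eq; rewrite /=; ring.
split.
  under eq_fun do rewrite pE reD [re (sigma%:C * _)]reM re_real im_real mul0r subr0.
  by apply: measurable_funD => //; exact: measurable_funM.
under eq_fun do rewrite pE imD [im (sigma%:C * _)]imM re_real im_real mul0r addr0.
by apply: measurable_funD => //; exact: measurable_funM.
Qed.

(** The slope of u is - i H u, and the real part of - i z is the imaginary part of z. *)
Lemma hamiltonian_im s (Psi : state (R := R)) z : 0 < s -> H1 Psi.1 -> H1 Psi.2 -> H1 z ->
  {ae mu, forall x, Psi.2 x = (Psi.1 x)^*%C} ->
  im ((hamiltonian lambda sigma phi s Psi).1 z) =
  ham_slope (diag_coef lambda sigma phit s) (conj_coef lambda sigma phit s) Psi.1 z.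
Proof.
move=> sp HP1 HP2 Hz PE; have c0 : lambda * s `^ (sigma - 2) != 0 by rewrite gt_eqF// mulr_gt0// powR_gt0.
have [N N0 bc] := coef_bounded l0 s2 s1 n1 n2 mM s.
have LA := action_L2c bc (H1_L2c HP1); have Lz := L2cZ 'i%C (H1_L2c Hz).
have pae := potential_ae sp PE.
have LcA := L2cZ ((lambda * s `^ (sigma - 2))^-1)%:C LA.
have LV : L2c (potential s Psi).
  have [p1 p2] := measurable_potential s (H1_L2c HP1) (H1_L2c HP2).
  have [L1 L2'] := LcA; split.
    by apply: ae_eq_L2 L1 => //; apply: ae_impl pae => x ->.
  by apply: ae_eq_L2 L2' => //; apply: ae_impl pae => x ->.
have -> : (hamiltonian lambda sigma phi s Psi).1 z =
  - (2^-1)%:C * - dual_of (grad Psi.1) (grad z) +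
  (lambda * s `^ (sigma - 2))%:C * dual_of (potential s Psi) z by [].
rewrite !dual_ofE (ip_ae LV Lz LcA Lz pae (aeW _ (fun=> erefl))) (ipZl _ LA Lz) /ham_slope.
move: c0; move: (ip _ _) (ip _ _) (ip _ _) (ip _ _) (lambda * _) => x1 x2 x3 x4 c c0.
by rewrite /=; field.
Qed.

Lemma solution_curve Psi s : solution lambda sigma phi Psi ->
  (forall t, unit_times t -> {ae mu, forall x, (Psi t).2 x = ((Psi t).1 x)^*%C}) ->
  0 < s -> s < 1 ->
  curve_at (fun t => (Psi t).1) s
    (ham_slope (diag_coef lambda sigma phit s) (conj_coef lambda sigma phit s) (Psi s).1).
Proof.
move=> [/C_H1P c1 /C_H1P c2 HD] PE sp sl.
have uP t : `|t - s| < Num.min s (1 - s) -> unit_times t.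
  rewrite lt_min => /andP[h1 h2]; rewrite /unit_times /= in_itv /=; apply/andP.
  by move: h1 h2; rewrite !ltr_norml => /andP[? ?] /andP[? ?]; split; lra.
have d0 : 0 < Num.min s (1 - s) by rewrite lt_min sp subr_gt0.
have us : unit_times s by apply: uP; rewrite subrr normr0.
have [Hs cont] := c1 s us; have [Hs2 _] := c2 s us; have [HD1 _] := HD s us.
have [N N0 bc] := coef_bounded l0 s2 s1 n1 n2 mM s.
split=> //.
- move=> e /cont[eta eta0 K]; exists (Num.min eta (Num.min s (1 - s))).
    by rewrite lt_min eta0.
  move=> t; rewrite lt_min => /andP[t1 /uP ut].
  by split; [exact: (c1 t ut).1|exact: K].
- exists (2^-1 * norm2 (grad (Psi s).1) + 2 * N * norm2 (Psi s).1).
    have := norm2_ge0 (H1_L2c Hs); have := norm2_ge0 (grad_L2c Hs).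
    by move=> h1 h2; rewrite addr_ge0 ?mulr_ge0.
  move=> z Hz; rewrite /ham_slope; apply: le_trans (ler_normD _ _) _.
  have Lz := H1_L2c Hz; have Lg := grad_L2c Hz.
  have b1 := ip_CS (grad_L2c Hs) (L2cZ 'i%C Lg).
  have b2 := action_ip_bound bc N0 (H1_L2c Hs) (L2cZ 'i%C Lz).
  rewrite (norm2E (L2cZ 'i%C Lg)) ip_ii -(norm2E Lg) in b1.
  rewrite (norm2E (L2cZ 'i%C Lz)) ip_ii -(norm2E Lz) in b2.
  rewrite mulrDl; apply: lerD.
    rewrite normrM ger0_norm ?invr_ge0// -mulrA ler_wpM2l ?invr_ge0//.
    apply: le_trans b1 _; rewrite ler_wpM2l ?norm2_ge0//; first exact: grad_L2c.
    exact: norm2_grad_le_normH1.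
  apply: le_trans b2 _; rewrite ler_wpM2l ?norm2_le_normH1//.
  by rewrite !mulr_ge0// norm2_ge0//; exact: H1_L2c.
move=> e e0; have /near_unit_times[eta eta0 K] := HD1 e e0.
exists (Num.min eta (Num.min s (1 - s))); first by rewrite lt_min eta0.
move=> t; rewrite lt_min => /andP[t1 /uP ut] z Hz.
have [Ht _] := c1 t ut.
apply: le_trans (K t t1 ut z Hz); apply: le_trans (re_le_normc _).
rewrite -(hamiltonian_im sp Hs Hs2 Hz (PE s us)) (ipBl (H1_L2c Ht) (H1_L2c Hs) (H1_L2c Hz)).
rewrite !dual_ofE; move: (ip _ _) (ip _ _) (ip _ _) (ip _ _) (_.1 z) => x1 x2 x3 x4 [h1 h2].
rewrite le_eqVlt; apply/orP; left; apply/eqP; congr (`|_|).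
by rewrite /=; ring.
Qed.

Variable delta : R.

(** The gradient and the potential are insensitive to the choice of representatives. *)
Lemma Q_energy f s : H1 f ->
  Q lambda sigma phi delta f s = Num.sqrt (energy lambda sigma delta phit (fun=> f) s).
Proof.
move=> Hf; have Lf := H1_L2c Hf.
have [[p1 _] [p2 _]] := Lf.
have [k1 k2] := measurable_profile lambda s1 m1 m2 s.
pose g x := normc (phi x) `^ (sigma - 1) * re ((vp lambda sigma phi s x)^*%C * f x).
have gE : {ae mu, forall x, g x = re (rotated lambda sigma phit s f x)}.
  by apply: ae_impl phiE => x E; rewrite /g -rotated_re /vp E.
have mg : measurable_fun setT g.
  have -> : g = (fun x => re (profile lambda sigma phi s x) * re (f x) +
      im (profile lambda sigma phi s x) * im (f x)).
    by apply/funext => x; rewrite /g rotated_re /rotated !reimE mulNr opprK.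
  by apply: measurable_funD; exact: measurable_funM.
have [Lr _] := rotated_L2c lambda s2 s1 n1 n2 mM s Lf.
have Lg : L2 g by apply: ae_eq_L2 Lr => //; apply: ae_impl gE => x ->.
have Lg' : L2c (fun x => (g x)%:C) by split=> //; exact: L2_0.
rewrite /Q -/g; congr Num.sqrt; rewrite /energy.
rewrite (norm2_sqr (grad_L2c Hf)) (norm2_sqr Lf) (norm2_sqr Lg'); congr (_ + _ * _).
rewrite /rotated_re2; apply: ae_eq_Rintegral => //.
- by apply: measurable_funD; apply: measurable_funM.
- by apply: measurable_funX; exact: Lr.1.
- by apply: ae_impl gE => x /= <-; rewrite mul0r addr0 expr2.
Qed.

Lemma Q_ae f g s : H1 f -> H1 g -> {ae mu, forall x, f x = g x} ->
  Q lambda sigma phi delta f s = Q lambda sigma phi delta g s.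
Proof.
move=> Hf Hg fg; rewrite !Q_energy//; congr Num.sqrt; rewrite /energy.
have gg := grad_ae_eq Hf Hg fg.
have Lf := H1_L2c Hf; have Lg := H1_L2c Hg.
have Gf := grad_L2c Hf; have Gg := grad_L2c Hg.
rewrite (ip_ae Lf Lf Lg Lg fg fg) (ip_ae Gf Gf Gg Gg gg gg); congr (_ + _ * _).
have [Lr _] := rotated_L2c lambda s2 s1 n1 n2 mM s Lf.
have [Lr' _] := rotated_L2c lambda s2 s1 n1 n2 mM s Lg.
apply: ae_eq_Rintegral => //; first by apply: measurable_funX; exact: Lr.1.
  by apply: measurable_funX; exact: Lr'.1.
by apply: ae_impl fg => x; rewrite /rotated => ->.
Qed.

End Curve.

(** * The energy bound for a level decomposition of the gradient *)

Section Bound.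
Context {R : realType}.
Local Notation mu := (@lebesgue_measure R).
Local Notation C := R[i].
Local Notation re := (@complex.Re R).
Local Notation im := (@complex.Im R).

(** Here phi is replaced by the representative with absolutely continuous density, and the
level decomposition of |grad phi|^2 becomes one of the square of the derivative of the
density. *)
Lemma energy_bound_of_levels (lambda sigma delta ell k al s0 : R) (phi : R -> C) (w : R -> R) U :
  0 < lambda -> 2^-1 < sigma -> sigma <= 1 -> delta <= sigma -> 0 < al -> al <= delta ->
  2 * ell + 2 * al <= 3 * sigma - 2 - delta ->
  4 * al <= 5 * sigma - 4 - delta + 2 * k ->
  H1 phi -> itg setT w -> (forall x, 0 <= w x) -> 0 < s0 -> s0 < 1 ->
  (forall t, 0 < t -> t <= s0 ->
     {ae mu, forall x, normc (grad phi x) ^+ 2 <= t `^ (- (2 * ell)) + t `^ k * w x}) ->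
  is_propagator lambda sigma phi U -> energy_bound lambda sigma phi delta U.
Proof.
move=> l0 s2 s1 ds al0 ald c1 c2 Hphi Iw w0 s00 s01 lev HU.
have [Sp Sq] := H1_csobolev Hphi.
have [P [Q0 [m' [M [D [[pP qQ] [mP mQ] [am Lm'] mM [D0 mD]]]]]]] := sobolev_powR s2 Sp Sq.
pose phit x : C := P x +i* Q0 x.
have n1 : measurable_fun setT (fun x => re (phit x)) by exact: mP.
have n2 : measurable_fun setT (fun x => im (phit x)) by exact: mQ.
have dE : density sigma phit = (fun x => (P x ^+ 2 + Q0 x ^+ 2) `^ sigma).
  apply/funext => x; rewrite /density normc_sqrt /= -powR12_sqrt; last by rewrite addr_ge0// sqr_ge0.
  by rewrite -powRrM; congr powR; field.
have phiE : {ae mu, forall x, phi x = phit x}.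
  by apply: ae_impl2 pP qQ => x h1 h2; exact: complex_eq.
rewrite -dE in am; have mM' x : density sigma phit x <= M by rewrite dE.
have [[m1 _] [m2 _]] := H1_L2c Hphi.
have lev' t : 0 < t -> t <= s0 -> {ae mu, forall x,
    m' x ^+ 2 <= 2 * D ^+ 2 * (t `^ (- (2 * ell)) + t `^ k * w x)}.
  move=> t0 ts; apply: ae_impl (lev t t0 ts) => x; rewrite normc_sqr => H.
  have D20 : 0 <= 2 * D ^+ 2 by rewrite mulr_ge0// sqr_ge0.
  apply: le_trans (ler_wpM2l D20 H).
  have := mD x; set a := re _; set b := im _ => h.
  have : `|m' x| ^+ 2 <= (D * (`|a| + `|b|)) ^+ 2.
    by rewrite ler_pXn2r// nnegrE mulr_ge0// addr_ge0.
  rewrite real_normK ?num_real// => h2; apply: le_trans h2 _.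
  rewrite exprMn [leRHS](_ : _ = D ^+ 2 * (2 * (a ^+ 2 + b ^+ 2))); last by ring.
  apply: ler_wpM2l; first exact: sqr_ge0.
  rewrite -[a ^+ 2]real_normK ?num_real// -[b ^+ 2]real_normK ?num_real//.
  rewrite -subr_ge0 (_ : _ - _ = (`|a| - `|b|) ^+ 2) ?sqr_ge0//; ring.
pose K := expR ((1 + 4 * lambda * sigma * M +
  lambda ^+ 2 / 4 * (2 * D ^+ 2) * (1 + 4 * \int[mu]_x w x)) / al).
exists s0, (Num.sqrt K); split=> //; [exact: ltW|by rewrite sqrtr_gt0 expR_gt0|].
move=> psi0 H0 r s r0 rs ss.
have u_of t : 0 < t -> t <= s0 -> unit_times t.
  by move=> t0 ts; rewrite /unit_times /= in_itv /= t0 (le_trans ts)// ltW.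
have ur : unit_times r by apply: u_of => //; exact: le_trans rs ss.
have [sol [e1 _] _] := HU r (vec psi0) ur H0 (H1_conj H0).
pose u t := (U t r (vec psi0)).1.
have [c1' _ _] := sol.
have Hu t : 0 < t -> t <= s0 -> H1 (u t).
  by move=> t0 ts; have [] := (C_H1P _).1 c1' t (u_of t t0 ts).
have cu t : 0 < t -> t < 1 ->
    curve_at u t (ham_slope (diag_coef lambda sigma phit t) (conj_coef lambda sigma phit t) (u t)).
  have PE t' : unit_times t' -> {ae mu, forall x, (U t' r (vec psi0)).2 x = ((U t' r (vec psi0)).1 x)^*%C}.
    by move=> ut'; exact: propagator_conj HU ur ut' H0.
  move=> t0 t1; exact: (solution_curve l0 s2 s1 m1 m2 n1 n2 mM' phiE sol PE t0 t1).
have := energy_growth l0 s2 s1 ds al0 ald c1 c2 n1 n2 am mM' Lm'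
  (mulr_ge0 (ler0n _ 2) (sqr_ge0 D)) Iw w0 s01 lev' cu r0 rs ss.
rewrite -/K => growth.
have Hur := Hu r r0 (le_trans rs ss); have Hus := Hu s (lt_le_trans r0 rs) ss.
rewrite /Qvec -/(u s) (Q_energy lambda s2 s1 m1 m2 n1 n2 mM' phiE delta s Hus).
rewrite -(Q_ae lambda s2 s1 m1 m2 n1 n2 mM' phiE delta r Hur H0 e1).
rewrite (Q_energy lambda s2 s1 m1 m2 n1 n2 mM' phiE delta r Hur).
by rewrite -sqrtrM ?expR_ge0// ler_wsqrtr.
Qed.

(** Below the level A = t^(- ell), y^2 <= A^2; above it, y^2 <= A^(- k) y^(k + 2). *)
Lemma sqr_le_levels (t y ell k : R) : 0 < t -> 0 <= y -> 0 <= k ->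
  y ^+ 2 <= t `^ (- (2 * ell)) + t `^ (ell * k) * y `^ (k + 2).
Proof.
move=> t0 y0 k0.
pose A := t `^ (- ell); have A0 : 0 < A by exact: powR_gt0.
have A2 : t `^ (- (2 * ell)) = A ^+ 2.
  by rewrite -powR_mulrn ?(ltW A0)// -powRrM; congr powR; ring.
have [yA|Ay] := leP y A.
  apply: le_trans (_ : t `^ (- (2 * ell)) <= _).
    by rewrite A2 ler_pXn2r// nnegrE// ltW.
  by rewrite lerDl mulr_ge0// powR_ge0.
apply: le_trans (_ : t `^ (ell * k) * y `^ (k + 2) <= _); last by rewrite lerDr powR_ge0.
have yp : 0 < y by exact: lt_trans Ay.
rewrite powRD; last by rewrite (gt_eqF yp) implybT.
rewrite (powR_mulrn 2 y0) mulrA ler_peMl ?sqr_ge0//.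
have -> : t `^ (ell * k) = (A `^ k)^-1 by rewrite -powRN -powRrM; congr powR; ring.
rewrite mulrC ler_pdivlMr ?powR_gt0// mul1r.
by apply: ge0_ler_powR => //; rewrite ?nnegrE ?ltW.
Qed.

Lemma Lp_itg (p : R) f : 1 <= p -> Lp p%:E f -> itg setT (fun x => normc (f x) `^ p).
Proof.
move=> p1 [m1 m2 fn].
have : (fun x => normc (f x)) \in Lfun mu p%:E.
  by rewrite inE; apply/andP; split; rewrite inE //=; exact: measurable_normc.
move=> /(Lfun_integrable p1); apply: eq_itg => // x _.
by rewrite ger0_norm ?normc_ge0.
Qed.

Lemma Lpoo_bound f : Lp +oo%E f -> exists2 B : R, 0 <= B & {ae mu, forall x, normc (f x) <= B}.
Proof.
move=> [m1 m2]; rewrite /finite_norm unlock /Lnorm.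
have -> : (0 < mu setT)%E.
  apply: (@lt_le_trans _ _ (mu `[0, 1]%classic)); last by apply: le_measure; rewrite ?inE.
  by rewrite lebesgue_measure_itv /= lte_fin ltr01 oppr0 adde0 lte_fin.
set E := ess_sup _ _ => Efin.
pose B := Num.max 0 (fine E).
have EB : (E <= B%:E)%E.
  by move: Efin; rewrite {}/B; case: E => [r| |]//= _; [rewrite lee_fin le_max lexx orbT|exact: leNye].
exists B; first by rewrite le_max lexx.
move/ess_supP: EB; apply: ae_impl => x /=.
by rewrite lee_fin ger0_norm ?normc_ge0.
Qed.

End Bound.

(** * Choice of the exponents *)

Section Main.
Context {R : realType}.
Local Notation mu := (@lebesgue_measure R).
Implicit Types (lambda nu sigma delta : R) (phi : R -> R[i]).

(** The gap equals (2 nu - 1) (sigma - delta) - 4 (1 - sigma), and 2 nu - 1 <= 2. *)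
Lemma exponents_of_gap nu sigma delta : 1 <= nu -> nu <= 3 / 2 -> sigma <= 1 ->
  0 < delta -> 0 < (3 + 2 * nu) * sigma - 4 - (2 * nu - 1) * delta ->
  [/\ 2^-1 < sigma, delta <= sigma & 0 < 3 * sigma - 2 - delta].
Proof.
move=> n1 n2 s1 d0 gap.
have sd : 0 <= sigma - delta.
  rewrite leNgt; apply/negP => sd.
  have : (2 * nu - 1) * (sigma - delta) <= 0 by rewrite mulr_ge0_le0 ?(ltW sd)//; lra.
  lra.
have : (2 * nu - 1) * (sigma - delta) <= 2 * (sigma - delta) by rewrite ler_wpM2r//; lra.
by move=> h; split; lra.
Qed.

(** With p = k + 2 = 2 / (3 - 2 nu), take 2 ell = 3 sigma - 2 - delta - 2 al.  The second
condition on the exponents then reads (4 + 2 k) al <= 5 sigma - 4 - delta + k (3 sigma - 2 - delta),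
whose right side is the gap divided by 3 - 2 nu. *)
Lemma energy_bound_finite lambda nu sigma delta phi U :
  0 < lambda -> 1 <= nu -> nu < 3 / 2 -> sigma <= 1 ->
  H1 phi -> Lp (2 / (3 - 2 * nu))%:E (grad phi) ->
  0 < delta -> 0 < (3 + 2 * nu) * sigma - 4 - (2 * nu - 1) * delta ->
  is_propagator lambda sigma phi U -> energy_bound lambda sigma phi delta U.
Proof.
move=> l0 n1 n2 s1 Hphi Lg d0 gap HU.
have [s2 ds E1] := exponents_of_gap n1 (ltW n2) s1 d0 gap.
have q0 : 0 < 3 - 2 * nu by lra.
pose k := (4 * nu - 4) / (3 - 2 * nu).
have kE : 2 / (3 - 2 * nu) = k + 2 by rewrite /k; field; rewrite gt_eqF.
have k0 : 0 <= k by rewrite divr_ge0 ?(ltW q0)//; lra.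
pose D := ((3 + 2 * nu) * sigma - 4 - (2 * nu - 1) * delta) / (3 - 2 * nu).
have D0 : 0 < D by exact: divr_gt0.
have DE : 5 * sigma - 4 - delta + k * (3 * sigma - 2 - delta) = D.
  by rewrite /D /k; field; rewrite gt_eqF.
have k4 : 0 < 4 + 2 * k by lra.
pose al := Num.min delta (Num.min ((3 * sigma - 2 - delta) / 2) (D / (4 + 2 * k))).
have al0 : 0 < al by rewrite !lt_min d0 !divr_gt0.
have ald : al <= delta by rewrite ge_min lexx.
have al2 : al <= (3 * sigma - 2 - delta) / 2 by rewrite !ge_min lexx orbT.
have al3 : al * (4 + 2 * k) <= D by rewrite -ler_pdivlMr// !ge_min lexx !orbT.
pose n := (3 * sigma - 2 - delta) / 2 - al.
have h01 : (2^-1 : R) < 1 by lra.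
apply: (@energy_bound_of_levels _ lambda sigma delta n (n * k) al 2^-1 phi
  (fun x => normc (grad phi x) `^ (2 / (3 - 2 * nu)))) => //.
- by rewrite /n; lra.
- by rewrite /n; lra.
- by apply: Lp_itg => //; rewrite kE; lra.
- by move=> x; exact: powR_ge0.
- by move=> t t0 _; apply: aeW => x; rewrite kE; apply: sqr_le_levels => //; exact: normc_ge0.
Qed.

(** For small times the level t^(- ell) exceeds the essential supremum of |grad phi|, so that
the integrable part can be taken to be 0 and its exponent k arbitrarily large. *)
Lemma energy_bound_infinite lambda sigma delta phi U :
  0 < lambda -> sigma <= 1 -> H1 phi -> Lp +oo%E (grad phi) ->
  0 < delta -> 0 < 6 * sigma - 4 - 2 * delta ->
  is_propagator lambda sigma phi U -> energy_bound lambda sigma phi delta U.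
Proof.
move=> l0 s1 Hphi Lg d0 gap HU.
have [B B0 gB] := Lpoo_bound Lg.
have E1 : 0 < 3 * sigma - 2 - delta by lra.
pose al := Num.min delta ((3 * sigma - 2 - delta) / 4).
have al0 : 0 < al by rewrite lt_min d0 divr_gt0.
have ald : al <= delta by rewrite ge_min lexx.
have al2 : al <= (3 * sigma - 2 - delta) / 4 by rewrite !ge_min lexx orbT.
pose n := (3 * sigma - 2 - delta) / 2 - al.
have n0 : 0 < n by rewrite /n; lra.
pose k := 2 * al - (5 * sigma - 4 - delta) / 2.
(* t <= s0 ensures t^(- n) >= 1 + B *)
pose s0 := Num.min 2^-1 ((1 + B) `^ (- n^-1)).
have B1 : 0 < 1 + B by rewrite ltr_pwDl.
have s00 : 0 < s0 by rewrite lt_min invr_gt0 ltr0n powR_gt0.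
have s01 : s0 < 1 by rewrite gt_min invf_lt1 ?ltr1n.
apply: (@energy_bound_of_levels _ lambda sigma delta n k al s0 phi (fun=> 0)) => //.
- by lra.
- by lra.
- by rewrite /n; lra.
- by rewrite /k; lra.
- exact: integrable0.
move=> t t0 ts; apply: ae_impl gB => x nB; rewrite mulr0 addr0.
have tB : t <= (1 + B) `^ (- n^-1) by apply: le_trans ts _; rewrite ge_min lexx orbT.
have : 1 + B <= t `^ (- n).
  rewrite powRN -[leLHS]invrK lef_pV2 ?posrE ?powR_gt0 ?invr_gt0//.
  apply: le_trans (_ : ((1 + B) `^ (- n^-1)) `^ n <= _).
    by apply: ge0_ler_powR => //; rewrite ?nnegrE ?powR_ge0 ?ltW.
  by rewrite -powRrM mulNr mulVf ?(gt_eqF n0)// powRN powRr1// ltW.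
move=> h; rewrite (_ : - (2 * n) = (- n) * 2%:R); last by ring.
rewrite powRrM powR_mulrn ?powR_ge0// ler_pXn2r ?nnegrE ?powR_ge0 ?normc_ge0//.
by apply: le_trans nB (le_trans _ h); rewrite lerDr.
Qed.

Lemma energy_bound_gap lambda nu sigma delta phi U :
  0 < lambda -> 1 <= nu -> nu <= 3 / 2 -> sigma <= 1 ->
  H1 phi -> Lp (grad_exponent nu) (grad phi) ->
  0 < delta -> 0 < (3 + 2 * nu) * sigma - 4 - (2 * nu - 1) * delta ->
  is_propagator lambda sigma phi U -> energy_bound lambda sigma phi delta U.
Proof.
move=> l0 n1 n2 s1 Hphi; rewrite /grad_exponent.
have [nE|nN] := eqVneq nu (3 / 2) => Lg d0 gap HU.
  by apply: energy_bound_infinite HU => //; move: gap; rewrite nE; lra.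
by apply: energy_bound_finite gap HU => //; rewrite lt_neqAle nN.
Qed.

End Main.

Theorem proposition2p3 (R : realType) :
  (forall (lambda nu sigma delta : R) (phi : R -> R[i])
          (U : R -> R -> state -> state),
     0 < lambda -> 1 <= nu -> nu <= 3 / 2 ->
     4 / (3 + 2 * nu) < sigma -> sigma <= 1 ->
     H1 phi -> Lp (grad_exponent nu) (grad phi) ->
     0 < delta -> 0 < (3 + 2 * nu) * sigma - 4 - (2 * nu - 1) * delta ->
     is_propagator lambda sigma phi U ->
     energy_bound lambda sigma phi delta U)
  /\
  (forall sigma : R, 4 / 5 < sigma -> sigma <= 1 ->
     exists delta0 : R, 0 < delta0 /\
     forall (delta lambda : R) (phi : R -> R[i])
            (U : R -> R -> state -> state),
       0 < delta -> delta < delta0 -> 0 < lambda ->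
       H1 phi ->
       is_propagator lambda sigma phi U ->
       energy_bound lambda sigma phi delta U)
  /\
  (forall sigma : R, 2 / 3 < sigma -> sigma <= 4 / 5 ->
     exists delta0 : R, 0 < delta0 /\
     forall (delta lambda : R) (phi : R -> R[i])
            (U : R -> R -> state -> state),
       0 < delta -> delta < delta0 -> 0 < lambda ->
       H1 phi -> Lp +oo%E (grad phi) ->
       is_propagator lambda sigma phi U ->
       energy_bound lambda sigma phi delta U).
Proof.
split; [|split].
- move=> lambda nu sigma delta phi U l0 n1 n2 _ s1 Hphi Lg d0 gap HU.
  exact: energy_bound_gap l0 n1 n2 s1 Hphi Lg d0 gap HU.
- move=> sigma s45 s1; exists (5 * sigma - 4); split; first by lra.
  move=> delta lambda phi U d0 dd l0 Hphi HU.
  apply: (@energy_bound_finite _ lambda 1 sigma delta phi U) => //; [lra| |lra].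
  rewrite (_ : 3 - 2 * 1 = 1 :> R) ?divr1; last by ring.
  exact/Lp2P/grad_L2c.
- move=> sigma s23 s45; exists (3 * sigma - 2); split; first by lra.
  move=> delta lambda phi U d0 dd l0 Hphi Lg HU.
  apply: (energy_bound_infinite l0 _ Hphi Lg d0 _ HU); lra.
Qed.
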